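(* Let $N\ge1$ be an integer and let $D=G^\dagger*G\in\mathcal{D}_{N,1}$ with $G\in L^2(\mathbb{R}^3\times\mathbb{R}^3)$ and $\nabla_2G\in L^2(\mathbb{R}^3\times\mathbb{R}^3_{\mathrm{loc}})$. For every $\Gamma\in\mathcal{D}_N$ such that $\Gamma\mapsto D$, it then holds that the density $\rho_\Gamma=\rho\in L^1(\mathbb{R}^3)$, the momentum density $\mathbf{c}_\Gamma=\mathbf{c}\in L^1_{\mathrm{loc}}(\mathbb{R}^3)$, and the kinetic energy density $\tau_\Gamma=\tau\in L^1_{\mathrm{loc}}(\mathbb{R}^3)$ are given almost everywhere by \begin{align*}\rho(\mathbf{r})&=\int_{\mathbb{R}^3}G^*(\mathbf{u},\mathbf{r})\,G(\mathbf{u},\mathbf{r})\,d\mathbf{u},\\ \mathbf{c}(\mathbf{r})&=\int_{\mathbb{R}^3}[-\mathrm{i}\nabla_2G^*(\mathbf{u},\mathbf{r})]\,G(\mathbf{u},\mathbf{r})\,d\mathbf{u},\\ \tau(\mathbf{r})&=\frac12\int_{\mathbb{R}^3}[\nabla_2G^*(\mathbf{u},\mathbf{r})]\cdot[\nabla_2G(\mathbf{u},\mathbf{r})]\,d\mathbf{u}.\end{align*}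
   Context: All derivatives are weak derivatives; $\nabla_i$ is the weak gradient with respect to the $i$th argument. $L^2(\mathbb{R}^3\times\mathbb{R}^3_{\mathrm{loc}})$ is the set of functions lying in $L^2(\mathbb{R}^3\times K)$ for every compact $K\subset\mathbb{R}^3$. With $G^\dagger(\mathbf{r},\mathbf{u})=G(\mathbf{u},\mathbf{r})^*$, $(G^\dagger*G)(\mathbf{r},\mathbf{s})=\int_{\mathbb{R}^3}G(\mathbf{u},\mathbf{r})^*G(\mathbf{u},\mathbf{s})\,d\mathbf{u}$, and $D=G^\dagger*G$ is an equality in $L^2(\mathbb{R}^3\times\mathbb{R}^3)$ (a.e.). $\mathcal{D}_N$ is the set of (spin-free) mixed $N$-electron states $\Gamma(\mathbf{r}_{1:N},\mathbf{s}_{1:N})=\sum_ip_i\Psi_i(\mathbf{r}_{1:N})\Psi_i^*(\mathbf{s}_{1:N})$, a countable convex combination ($p_i\ge0$, $\sum_ip_i=1$) of normalized $\Psi_i\in L^2(\mathbb{R}^{3N})$, each either totally symmetric or totally antisymmetric under permutations of its $N$ arguments in $\mathbb{R}^3$. For such $\Gamma$: the 1-rdm is $D_\Gamma(\mathbf{r},\mathbf{s})=N\sum_ip_i\int_{\mathbb{R}^{3N-3}}\Psi_i(\mathbf{r},\mathbf{r}_{2:N})\Psi_i^*(\mathbf{s},\mathbf{r}_{2:N})\,d\mathbf{r}_{2:N}$; the density is $\rho_\Gamma(\mathbf{r})=N\sum_ip_i\int|\Psi_i(\mathbf{r},\mathbf{r}_{2:N})|^2\,d\mathbf{r}_{2:N}$;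 the momentum density is $\mathbf{c}_\Gamma(\mathbf{r})=N\sum_ip_i\int[-\mathrm{i}\nabla_{\mathbf{r}}\Psi_i(\mathbf{r},\mathbf{r}_{2:N})]\Psi_i^*(\mathbf{r},\mathbf{r}_{2:N})\,d\mathbf{r}_{2:N}$; the kinetic energy density is $\tau_\Gamma(\mathbf{r})=\frac N2\sum_ip_i\int|\nabla_{\mathbf{r}}\Psi_i(\mathbf{r},\mathbf{r}_{2:N})|^2\,d\mathbf{r}_{2:N}$. $\Gamma\mapsto D$ means $D_\Gamma=D$ almost everywhere on $\mathbb{R}^3\times\mathbb{R}^3$. $\mathcal{D}_{N,1}$ (the set of 1-rdms of mixed $N$-electron states) consists of those $D\in L^2(\mathbb{R}^3\times\mathbb{R}^3)$ that are kernels of trace-class operators on $L^2(\mathbb{R}^3)$, are Hermitian ($D(\mathbf{r},\mathbf{s})=D(\mathbf{s},\mathbf{r})^*$ a.e.), satisfy $0\le\iint\phi^*(\mathbf{r})D(\mathbf{r},\mathbf{s})\phi(\mathbf{s})\,d\mathbf{r}\,d\mathbf{s}\le2\|\phi\|_2^2$ for all $\phi\in L^2(\mathbb{R}^3)$, and have $\operatorname{Tr}D=N$. *)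

(* Defs.v *)
From HB Require Import structures.
From mathcomp Require Import all_boot all_order all_algebra perm.
From mathcomp Require Import all_classical all_reals all_analysis.
From mathcomp Require Import complex.

Set Implicit Arguments.
Unset Strict Implicit.
Unset Printing Implicit Defensive.

Import Order.TTheory GRing.Theory Num.Theory.
Import numFieldNormedType.Exports.

Local Open Scope classical_set_scope.
Local Open Scope ring_scope.

Definition measure_matrix_display : measure_display -> measure_display.
Proof. exact. Qed.

Section measurable_matrix.
Context d (T : measurableType d) (m n : nat).

(* The sigma-algebra generated by the entries; for T = R it is the Borel one. *)
Definition matrix_sigma_algebra : set (set 'M[T]_(m, n)) :=
  <<s \bigcup_(ij in [set: 'I_m * 'I_n]) preimage_set_system setT
        (fun A : 'M[T]_(m, n) => A ij.1 ij.2) measurable >>.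

HB.instance Definition _ := @isMeasurable.Build (measure_matrix_display d)
  'M[T]_(m, n) matrix_sigma_algebra (@sigma_algebra0 _ setT _)
  (@sigma_algebraC _ _) (@sigma_algebra_bigcup _ setT _).

Lemma measurable_entry i j :
  measurable_fun [set: 'M[T]_(m, n)] (fun A : 'M[T]_(m, n) => A i j).
Proof.
move=> _ B mB; apply: sub_sigma_algebra; exists (i, j) => //.
by exists B.
Qed.

Lemma measurable_fun_matrix d' (S : measurableType d') (f : S -> 'M[T]_(m, n)) :
  (forall i j, measurable_fun setT (fun x => f x i j)) -> measurable_fun setT f.
Proof.
move=> mf; apply: (@measurability _ _ _ _ _ _ (\bigcup_(ij in [set: 'I_m * 'I_n])
  preimage_set_system setT (fun A : 'M[T]_(m, n) => A ij.1 ij.2) measurable)) => //.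
move=> _ [_ [[i j] _ [B mB <-]] <-].
rewrite !setTI -comp_preimage -[X in measurable X]setTI.
exact: mf.
Qed.

End measurable_matrix.

Section image_product.
Context d1 d2 d3 (X : measurableType d1) (Y : measurableType d2)
  (Z : measurableType d3) (R : realType).
Variables (m1 : {sigma_finite_measure set X -> \bar R})
  (m2 : {sigma_finite_measure set Y -> \bar R}).
Variables (f : X * Y -> Z) (g : Z -> X * Y).
Hypothesis mf : measurable_fun setT f.
Hypothesis mg : measurable_fun setT g.
Hypothesis fK : cancel f g.

(* The proof arguments do not occur in the body; they let the measure structure
   be inferred from the term. *)
Definition image_product of measurable_fun setT f & measurable_fun setT g
  & cancel f g : set Z -> \bar R := pushforward (m1 \x m2)%E f.

Local Notation mu := (image_product mf mg fK).

Let mu0 : mu set0 = 0%E.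
Proof. by rewrite /image_product /pushforward preimage_set0 measure0. Qed.

Let mu_ge0 A : (0 <= mu A)%E.
Proof. exact: measure_ge0. Qed.

Let mu_sigma_additive : semi_sigma_additive mu.
Proof.
have mfA A : measurable A -> measurable (f @^-1` A).
  by move=> mA; rewrite -[X in measurable X]setTI; exact: mf.
move=> F mF tF mUF; rewrite /image_product /pushforward preimage_bigcup.
apply: measure_semi_sigma_additive.
- by move=> n; exact: mfA.
- apply/trivIsetP => i j _ _ ij; rewrite -preimage_setI.
  by move/trivIsetP : tF => /(_ _ _ _ _ ij) -> //; rewrite preimage_set0.
- by rewrite -preimage_bigcup; exact: mfA.
Qed.

HB.instance Definition _ :=
  isMeasure.Build _ _ _ mu mu0 mu_ge0 mu_sigma_additive.

Let mu_sigma_finite : sigma_finite setT mu.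
Proof.
have /sigma_finiteP[F [FT _ Foo]] := sigma_finiteT m1.
have /sigma_finiteP[G [GT _ Goo]] := sigma_finiteT m2.
have [E ET Eoo] : sigma_finite setT (m1 \x m2)%E.
  exists (fun n => let ij := unpickle n in
    if ij is Some (i, j) then F i `*` G j else set0).
    apply/esym; rewrite -subTset => -[x y] _.
    have [i _ Fix] : (\bigcup_i F i) x by rewrite -FT.
    have [j _ Gjy] : (\bigcup_i G i) y by rewrite -GT.
    by exists (pickle (i, j)) => //=; rewrite pickleK.
  move=> n /=; case: unpickle => [[i j]|]; last by rewrite measure0.
  have [? ?] := Foo i; have [? ?] := Goo j; split; first exact: measurableX.
  by rewrite product_measure1E// lte_mul_pinfty// ge0_fin_numE.
exists (fun n => g @^-1` E n); first by rewrite -preimage_bigcup -ET.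
move=> n; have [mE En] := Eoo n; split.
  by rewrite -[X in measurable X]setTI; exact: mg.
rewrite /image_product /pushforward -comp_preimage.
by have -> : g \o f = id by apply/funext => x /=; rewrite fK.
Qed.

HB.instance Definition _ :=
  Measure_isSigmaFinite.Build _ _ _ mu mu_sigma_finite.

End image_product.

Section lebesgue.
Variable R : realType.

Definition rV_cons n (p : R * 'rV[R]_n) : 'rV[R]_n.+1 := row_mx p.1%:M p.2.
Definition rV_uncons n (v : 'rV[R]_n.+1) : R * 'rV[R]_n :=
  (v ord0 ord0, @rsubmx R 1 1 n v).

Lemma rV_consK n : cancel (@rV_cons n) (@rV_uncons n).
Proof.
move=> [x v]; congr pair; last by rewrite /= row_mxKr.
have -> : ord0 = lshift n (ord0 : 'I_1) by apply/val_inj.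
by rewrite /rV_cons (@row_mxEl R 1 1 n) mxE.
Qed.

Lemma measurable_rV_cons n : measurable_fun setT (@rV_cons n).
Proof.
apply: measurable_fun_matrix => i j; case: (@split_ordP 1 n j) => k ->.
  under eq_fun do rewrite /rV_cons (@row_mxEl R 1 1 n) mxE !ord1 eqxx mulr1n.
  exact: measurable_fst.
under eq_fun do rewrite /rV_cons (@row_mxEr R 1 1 n).
by apply: (measurableT_comp (measurable_entry _ _)); exact: measurable_snd.
Qed.

Lemma measurable_rV_uncons n : measurable_fun setT (@rV_uncons n).
Proof.
apply/measurable_fun_pairP; split; first exact: measurable_entry.
apply: measurable_fun_matrix => i j.
under eq_fun do rewrite /rV_uncons /= mxE.
exact: measurable_entry.
Qed.

Definition mx_cons m n (p : 'rV[R]_m * 'M[R]_(n, m)) : 'M[R]_(n.+1, m) :=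
  col_mx p.1 p.2.
Definition mx_uncons m n (A : 'M[R]_(n.+1, m)) : 'rV[R]_m * 'M[R]_(n, m) :=
  (@usubmx R 1 n m A, @dsubmx R 1 n m A).

Lemma mx_consK m n : cancel (@mx_cons m n) (@mx_uncons m n).
Proof. by move=> [u A]; rewrite /mx_uncons /mx_cons col_mxKu col_mxKd. Qed.

Lemma measurable_mx_cons m n : measurable_fun setT (@mx_cons m n).
Proof.
apply: measurable_fun_matrix => i j; case: (@split_ordP 1 n i) => k ->.
  under eq_fun do rewrite /mx_cons (@col_mxEu R 1 n m).
  by apply: (measurableT_comp (measurable_entry _ _)); exact: measurable_fst.
under eq_fun do rewrite /mx_cons (@col_mxEd R 1 n m).
by apply: (measurableT_comp (measurable_entry _ _)); exact: measurable_snd.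
Qed.

Lemma measurable_mx_uncons m n : measurable_fun setT (@mx_uncons m n).
Proof.
apply/measurable_fun_pairP; split; apply: measurable_fun_matrix => i j;
  under eq_fun do rewrite /mx_uncons /= mxE; exact: measurable_entry.
Qed.

(* R^0 is a point, so its Lebesgue measure is a Dirac mass; R^(n+1) = R * R^n. *)
Fixpoint lebesgue_rV n : {sigma_finite_measure set 'rV[R]_n -> \bar R} :=
  if n is n'.+1 then
    image_product lebesgue_measure (lebesgue_rV n')
      (@measurable_rV_cons n') (@measurable_rV_uncons n') (@rV_consK n')
  else \d_(0 : 'rV[R]_0).

Fixpoint lebesgue_mx m n : {sigma_finite_measure set 'M[R]_(n, m) -> \bar R} :=
  if n is n'.+1 then
    image_product (lebesgue_rV m) (lebesgue_mx m n')
      (@measurable_mx_cons m n') (@measurable_mx_uncons m n') (@mx_consK m n')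
  else \d_(0 : 'M[R]_(0, m)).

End lebesgue.

Notation normc := ComplexField.Normc.normc.

Section complex_functions.
Context d (T : measurableType d) (R : realType).
Implicit Types (mu : {measure set T -> \bar R}) (f g : T -> R[i]).

Definition cmeasurable f : Prop :=
  measurable_fun setT (fun x => complex.Re (f x)) /\
  measurable_fun setT (fun x => complex.Im (f x)).

Definition cintegral mu f : R[i] :=
  Complex (\int[mu]_x complex.Re (f x)) (\int[mu]_x complex.Im (f x)).

Definition norm2_sq mu f : \bar R := (\int[mu]_x (normc (f x) ^+ 2)%:E)%E.

Definition L2 mu f : Prop := cmeasurable f /\ (norm2_sq mu f < +oo)%E.

(* Local integrability is integrability over each member of a family of sets. *)
Definition L1_on mu (F : set (set T)) f : Prop :=
  cmeasurable f /\
  forall A, F A -> (\int[mu]_(x in A) (normc (f x))%:E < +oo)%E.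

Definition L2_on mu (F : set (set T)) f : Prop :=
  cmeasurable f /\
  forall A, F A -> (\int[mu]_(x in A) (normc (f x) ^+ 2)%:E < +oo)%E.

Definition inner mu f g : R[i] := cintegral mu (fun x => (f x)^*%C * g x).

Definition orthonormal_basis mu (e : nat -> T -> R[i]) : Prop :=
  [/\ forall k, L2 mu (e k),
      forall k l, inner mu (e k) (e l) = (k == l)%:R
    & forall phi, L2 mu phi -> (forall k, inner mu (e k) phi = 0) ->
        {ae mu, forall x, phi x = 0}].

End complex_functions.

Section complex_series.
Variable R : realType.
Implicit Type u : nat -> R[i].

Definition cseries u : R[i] :=
  Complex (limn (series (fun k => complex.Re (u k))))
          (limn (series (fun k => complex.Im (u k)))).

Definition cseries_cvg u (z : R[i]) : Prop :=
  (series (fun k => complex.Re (u k)) @ \oo --> complex.Re z) /\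
  (series (fun k => complex.Im (u k)) @ \oo --> complex.Im z).

End complex_series.

Section weak_derivatives.
Variable R : realType.

(* All iterated directional derivatives exist and are continuous. *)
Definition smooth (V : normedModType R) (phi : V -> R) : Prop :=
  forall s : seq V, let psi := foldr (fun v h => 'D_v h) phi s in
  continuous psi /\ forall x v, derivable psi x v.

Definition test_function (V : normedModType R) (phi : V -> R) : Prop :=
  smooth phi /\ compact (closure [set x | phi x != 0]).

Variable n : nat.
Local Notation V := ('rV[R]_3 * 'M[R]_(n, 3))%type.
Variable mu : {measure set V -> \bar R}.
Implicit Types (v : V) (f g : V -> R[i]).

Definition is_weak_derivative v f g : Prop :=
  [/\ L1_on mu compact f, L1_on mu compact g
    & forall phi : V -> R, test_function phi ->
        cintegral mu (fun x => f x * ('D_v phi x)%:C%C) =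
        - cintegral mu (fun x => g x * (phi x)%:C%C)].

Definition weakly_derivable v f : Prop := exists g, is_weak_derivative v f g.

(* Weak derivatives are unique up to null sets; one of them is chosen. *)
Definition weak_derivative v f : V -> R[i] :=
  xget (fun=> 0) (is_weak_derivative v f).

End weak_derivatives.

Section kernels.
Variable R : realType.
Local Notation R3 := 'rV[R]_3.
Local Notation mu3 := (lebesgue_rV R 3).
Local Notation mu33 := (mu3 \x mu3)%E.
Implicit Types (A B D P G : R3 * R3 -> R[i]) (phi : R3 -> R[i]).

Definition kernel_adj A : R3 * R3 -> R[i] := fun p => (A (p.2, p.1))^*%C.

Definition kernel_comp A B : R3 * R3 -> R[i] :=
  fun p => cintegral mu3 (fun u => A (p.1, u) * B (u, p.2)).

Definition quad_form A phi : R[i] :=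
  cintegral mu33 (fun p => (phi p.1)^*%C * A p * phi p.2).

Definition has_trace A (t : R[i]) : Prop :=
  forall e, orthonormal_basis mu3 e ->
    cseries_cvg (fun k => quad_form A (e k)) t.

(* The operator with the square integrable kernel D is trace class iff its
   absolute value sqrt(D^* D) has a finite trace.  The latter is the positive
   operator P with P^* P = D^* D; it is Hilbert-Schmidt, hence has a square
   integrable kernel. *)
Definition trace_class D : Prop :=
  exists P, [/\ L2 mu33 P,
    forall phi, L2 mu3 phi -> 0 <= quad_form P phi,
    {ae mu33, forall p,
      kernel_comp (kernel_adj P) P p = kernel_comp (kernel_adj D) D p}
    & exists t, has_trace P t].

Definition is_1rdm (N : nat) D : Prop :=
  [/\ L2 mu33 D,
      trace_class D,
      {ae mu33, forall p, D p = kernel_adj D p},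
      forall phi, L2 mu3 phi ->
        0 <= quad_form D phi <= 2 * (fine (norm2_sq mu3 phi))%:C%C
    & has_trace D N%:R].

(* [grad1] differentiates in the first argument, [grad2] in the second. *)
Definition weakly_differentiable1 n (f : R3 * 'M[R]_(n, 3) -> R[i]) : Prop :=
  forall j, weakly_derivable (mu3 \x lebesgue_mx R 3 n)%E (delta_mx 0 j, 0) f.
Definition grad1 n (f : R3 * 'M[R]_(n, 3) -> R[i]) (j : 'I_3) :=
  weak_derivative (mu3 \x lebesgue_mx R 3 n)%E (delta_mx 0 j, 0) f.

Definition weakly_differentiable2 G : Prop :=
  forall j, @weakly_derivable R 1 mu33 (0, delta_mx 0 j) G.
Definition grad2 G (j : 'I_3) : R3 * R3 -> R[i] :=
  @weak_derivative R 1 mu33 (0, delta_mx 0 j) G.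

(* The family defining L^2(R^3 x R^3_loc). *)
Definition strips : set (set (R3 * R3)) :=
  [set setT `*` K | K in [set K : set R3 | compact K]].

End kernels.

(* A mixed state of n.+1 electrons, presented by an ensemble.  Row k of
   the (n.+1) x 3 matrix argument is the position of the k-th electron. *)
Record mixed_state (R : realType) (n : nat) := MixedState {
  weight : nat -> R;
  wavefun : nat -> 'M[R]_(n.+1, 3) -> R[i];
  weight_ge0 : forall i, 0 <= weight i;
  weight_sum1 : series weight @ \oo --> (1 : R);
  wavefun_L2 : forall i, L2 (lebesgue_mx R 3 n.+1) (wavefun i);
  wavefun_normalized : forall i,
    norm2_sq (lebesgue_mx R 3 n.+1) (wavefun i) = 1%E;
  wavefun_symmetry : forall i,
    (forall s : 'S_n.+1, {ae lebesgue_mx R 3 n.+1, forall x,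
       wavefun i (row_perm s x) = wavefun i x}) \/
    (forall s : 'S_n.+1, {ae lebesgue_mx R 3 n.+1, forall x,
       wavefun i (row_perm s x) = (-1) ^+ s * wavefun i x})
}.

Section densities.
Context (R : realType) (n : nat) (Gamma : mixed_state R n).
Local Notation R3 := 'rV[R]_3.
Local Notation mu := (lebesgue_mx R 3 n).
Local Notation p := (weight Gamma).
(* Psi i (r, r_{2:N}) *)
Definition split_wavefun i (q : R3 * 'M[R]_(n, 3)) : R[i] :=
  wavefun Gamma i (mx_cons q).
Local Notation Psi := split_wavefun.

Definition rdm (q : R3 * R3) : R[i] := n.+1%:R * cseries (fun i =>
  (p i)%:C%C * cintegral mu (fun x => Psi i (q.1, x) * (Psi i (q.2, x))^*%C)).

(* Densities with nonnegative integrands take values in \bar R: no convergence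
   is presupposed. *)
Definition density (r : R3) : \bar R := (n.+1%:R%:E * \sum_(i <oo)
  (p i)%:E * \int[mu]_x (normc (Psi i (r, x)) ^+ 2)%:E)%E.

Definition momentum_density (j : 'I_3) (r : R3) : R[i] :=
  n.+1%:R * cseries (fun i => (p i)%:C%C * cintegral mu (fun x =>
    (- 'i%C * grad1 (Psi i) j (r, x)) * (Psi i (r, x))^*%C)).

Definition kinetic_energy_density (r : R3) : \bar R :=
  ((n.+1%:R / 2)%:E * \sum_(i <oo) (p i)%:E *
    \int[mu]_x (\sum_(j < 3) normc (grad1 (Psi i) j (r, x)) ^+ 2)%R%:E)%E.

(* Absolute convergence of the integrals and of the series in
   [momentum_density]. *)
Definition momentum_density_abs_cvg (j : 'I_3) (r : R3) : Prop :=
  (\sum_(i <oo) (p i)%:E *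
    \int[mu]_x (normc (grad1 (Psi i) j (r, x)) * normc (Psi i (r, x)))%:E
   < +oo)%E.

End densities.

(* Main.v *)
Require Import Defs.
From HB Require Import structures.
From mathcomp Require Import all_boot all_order all_algebra perm.
From mathcomp Require Import all_classical all_reals all_analysis.
From mathcomp Require Import measurable_realfun complex ring lra.
Import Order.TTheory GRing.Theory Num.Theory.
Import numFieldNormedType.Exports.
Local Open Scope classical_set_scope.
Local Open Scope ring_scope.

Set Implicit Arguments.
Unset Strict Implicit.
Unset Printing Implicit Defensive.

(* Put H((i,x),r) = sqrt(N p_i) Psi_i(r,x)^*, a kernel whose first variable ranges
   over W = nat * R^(3N-3).  Then G^dagger * G = D = H^dagger * H, so that
   <G phi, G psi> = <H phi, H psi> for all phi and psi.  Let eta_k be a mollifier.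
   Convolving the second variable with its derivative turns G into the mollified
   nabla_2 G, which converges in L^2(R^3 x R^3_loc); by equality of the Gram forms
   the same convolutions of H are Cauchy in L^2(W x R^3_loc), and their limit is
   the weak derivative of H.  Evaluating the Gram identities at the translates
   eta_k(r - .) and (d_j eta_k)(r - .) gives identities valid for every r, whose
   limits in L^1_loc are the three formulas.  Complex kernels are handled through
   their real and imaginary parts. *)

(** * Square integrability and Fubini theorems *)

(** The diagonal is a null set of pairs, so the almost everywhere identity between the two
    factorizations of D gives no information on it directly; after smearing both variables around
    the same point, both sides become numbers that can be compared at every [r]. No regularity of
    [Gamma] is assumed: the weak gradients of its wavefunctions have to be produced along the way.
    Equality of Gram forms suffices to carry Cauchy sequences from one kernel to the other, so no
    partial isometry between the two factorizations is constructed. Counting measure on [nat] turns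
    the sum over the ensemble into an integral, which makes H a kernel of the same kind as G. The
    conjugate in its definition is forced: D(r,s) contains Psi(r) times the conjugate of Psi(s),
    whereas a product of the form H^dagger H conjugates the factor at r. An index of weight 0 leaves
    no trace in H; its wavefunction may have no weak gradient, and the vanishing factor annihilates
    whatever function is chosen in its place. *)

Section square_integrals.
Context d (T : measurableType d) (R : realType) (m : {measure set T -> \bar R}).
Implicit Types f g h : T -> R.

(** The squared norm is kept, with values in [\bar R]. No square root is taken: the triangle
    inequality is replaced by [sqintD], with a factor 2, and Cauchy-Schwarz by Young's inequality
    with a parameter. *)
Definition sqint f : \bar R := (\int[m]_x ((f x) ^+ 2)%:E)%E.

Definition Lsq f : Prop := measurable_fun setT f /\ (sqint f < +oo)%E.

Lemma sqint_ge0 f : (0 <= sqint f)%E.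
Proof. by apply: integral_ge0 => x _; rewrite lee_fin sqr_ge0. Qed.

Lemma measurable_sqE f : measurable_fun setT f ->
  measurable_fun setT (fun x => ((f x) ^+ 2)%:E : \bar R).
Proof. by move=> mf; apply/measurable_EFinP; exact: measurable_funX. Qed.

Lemma le_sqint f g : measurable_fun setT f -> measurable_fun setT g ->
  (forall x, `|f x| <= `|g x|) -> (sqint f <= sqint g)%E.
Proof.
move=> mf mg fg; apply: ge0_le_integral => //.
- by move=> x _; rewrite lee_fin sqr_ge0.
- exact: measurable_sqE.
- exact: measurable_sqE.
- move=> x _; rewrite lee_fin -[f x ^+ 2]real_normK ?num_real//.
  by rewrite -[g x ^+ 2]real_normK ?num_real// lerXn2r ?nnegrE.
Qed.

Lemma ae_le_sqint f g : measurable_fun setT f -> measurable_fun setT g ->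
  {ae m, forall x, `|f x| <= `|g x|} -> (sqint f <= sqint g)%E.
Proof.
move=> mf mg fg; apply: ae_ge0_le_integral => //.
- by move=> x _; rewrite lee_fin sqr_ge0.
- exact: measurable_sqE.
- by move=> x _; rewrite lee_fin sqr_ge0.
- exact: measurable_sqE.
- apply: filterS fg => x fg _.
  rewrite lee_fin -[f x ^+ 2]real_normK ?num_real//.
  by rewrite -[g x ^+ 2]real_normK ?num_real// lerXn2r ?nnegrE.
Qed.

Lemma ae_eq_sqint f g : measurable_fun setT f -> measurable_fun setT g ->
  {ae m, forall x, f x = g x} -> sqint f = sqint g.
Proof.
move=> mf mg fg; apply/eqP; rewrite eq_le; apply/andP; split;
  by apply: ae_le_sqint => //; apply: filterS fg => x ->.
Qed.

Lemma sqintZ c f : measurable_fun setT f ->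
  sqint (fun x => c * f x)%R = ((c ^+ 2)%:E * sqint f)%E.
Proof.
move=> mf; rewrite /sqint -ge0_integralZl_EFin//.
- by apply: eq_integral => x _; rewrite exprMn.
- by move=> x _; rewrite lee_fin sqr_ge0.
- exact: measurable_sqE.
- exact: sqr_ge0.
Qed.

Lemma sqintN f : sqint (fun x => - f x) = sqint f.
Proof. by apply: eq_integral => x _; rewrite sqrrN. Qed.

Lemma sqintD f g : measurable_fun setT f -> measurable_fun setT g ->
  (sqint (fun x => f x + g x)%R <= 2%:E * (sqint f + sqint g))%E.
Proof.
move=> mf mg; rewrite /sqint -ge0_integralD//; last 4 first.
- by move=> x _; rewrite lee_fin sqr_ge0.
- exact: measurable_sqE.
- by move=> x _; rewrite lee_fin sqr_ge0.
- exact: measurable_sqE.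
rewrite -ge0_integralZl_EFin//; last 2 first.
- by move=> x _; rewrite adde_ge0// lee_fin sqr_ge0.
- by apply: emeasurable_funD; exact: measurable_sqE.
apply: ge0_le_integral => //.
- by move=> x _; rewrite lee_fin sqr_ge0.
- by apply: measurable_sqE; exact: measurable_funD.
- by apply: measurable_funeM; apply: emeasurable_funD; exact: measurable_sqE.
- move=> x _; rewrite -EFinD -EFinM lee_fin; have := sqr_ge0 (f x - g x).
  by nra.
Qed.

Lemma sqintB f g : measurable_fun setT f -> measurable_fun setT g ->
  (sqint (fun x => f x - g x)%R <= 2%:E * (sqint f + sqint g))%E.
Proof.
move=> mf mg; rewrite -(sqintN g); apply: sqintD => //.
exact: measurable_funN.
Qed.

Lemma LsqZ c f : Lsq f -> Lsq (fun x => c * f x).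
Proof.
move=> [mf if_]; split; first exact: measurable_funM.
by rewrite sqintZ// lte_mul_pinfty// lee_fin sqr_ge0.
Qed.

Lemma LsqN f : Lsq f -> Lsq (fun x => - f x).
Proof. by move=> [mf if_]; split; [exact: measurable_funN|rewrite sqintN]. Qed.

Lemma LsqD f g : Lsq f -> Lsq g -> Lsq (fun x => f x + g x).
Proof.
move=> [mf if_] [mg ig]; split; first exact: measurable_funD.
apply: le_lt_trans (sqintD mf mg) _.
by rewrite lte_mul_pinfty ?lee_fin// lte_add_pinfty.
Qed.

Lemma LsqB f g : Lsq f -> Lsq g -> Lsq (fun x => f x - g x).
Proof. by move=> Lf Lg; apply: LsqD => //; exact: LsqN. Qed.

Lemma le_Lsq f g : measurable_fun setT f -> (forall x, `|f x| <= `|g x|) ->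
  Lsq g -> Lsq f.
Proof. by move=> mf fg [mg gi]; split=> //; exact: le_lt_trans (le_sqint _ _ fg) gi. Qed.

Lemma sqint_eq0 f : measurable_fun setT f -> sqint f = 0%E ->
  {ae m, forall x, f x = 0}.
Proof.
move=> mf f0.
have : (\int[m]_x `|(fun y => ((f y) ^+ 2)%:E) x| = 0)%E.
  by rewrite -f0; apply: eq_integral => x _; rewrite gee0_abs// lee_fin sqr_ge0.
move/(ae_eq_integral_abs m measurableT (measurable_sqE mf)).
by apply: filterS => x /(_ I) /= [] /eqP; rewrite sqrf_eq0 => /eqP.
Qed.

(** Pointwise, t a^2 + b^2 / t = (t a - b)^2 / t + 2 a b. The free parameter stands in for
    Cauchy-Schwarz: a small weight can be put on a fixed function and the large one on a function
    tending to 0. *)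
Lemma young_integral (t : R) f g : 0 < t -> measurable_fun setT f -> measurable_fun setT g ->
  (\int[m]_x (`|f x * g x|)%:E <= t%:E * sqint f + t^-1%:E * sqint g)%E.
Proof.
move=> t0 mf mg; rewrite /sqint -!ge0_integralZl_EFin//; last 6 first.
- by move=> x _; rewrite lee_fin sqr_ge0.
- exact: measurable_sqE.
- by rewrite invr_ge0 ltW.
- by move=> x _; rewrite lee_fin sqr_ge0.
- exact: measurable_sqE.
- exact: ltW.
rewrite -ge0_integralD//; last 4 first.
- by move=> x _; rewrite -EFinM lee_fin mulr_ge0 ?sqr_ge0 ?ltW.
- by apply: measurable_funeM; exact: measurable_sqE.
- by move=> x _; rewrite -EFinM lee_fin mulr_ge0 ?sqr_ge0 ?invr_ge0 ?ltW.
- by apply: measurable_funeM; exact: measurable_sqE.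
apply: ge0_le_integral => //.
- apply/measurable_EFinP; apply: measurableT_comp => //; exact: measurable_funM.
- by apply: emeasurable_funD; apply: measurable_funeM; exact: measurable_sqE.
- move=> x _; rewrite -!EFinM -EFinD lee_fin normrM.
  rewrite -[f x ^+ 2]real_normK ?num_real// -[g x ^+ 2]real_normK ?num_real//.
  set a : R := `|f x|; set b : R := `|g x|.
  have a0 : 0 <= a by exact: normr_ge0.
  have b0 : 0 <= b by exact: normr_ge0.
  have -> : t * a ^+ 2 + t^-1 * b ^+ 2 = t^-1 * ((t * a - b) ^+ 2) + 2 * (a * b).
    by field; rewrite gt_eqF.
  have ? : 0 <= t^-1 * (t * a - b) ^+ 2 by rewrite mulr_ge0 ?sqr_ge0 ?invr_ge0 ?ltW.
  have ? : 0 <= a * b by rewrite mulr_ge0.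
  lra.
Qed.

Lemma integrable_Lsq_mul f g : Lsq f -> Lsq g ->
  m.-integrable setT (fun x => (f x * g x)%:E).
Proof.
move=> [mf fi] [mg gi]; apply/integrableP; split.
  by apply/measurable_EFinP; exact: measurable_funM.
apply: le_lt_trans (young_integral ltr01 mf mg) _.
by rewrite invr1 !mul1e lte_add_pinfty.
Qed.

Lemma sqint_Rintegral f : Lsq f -> sqint f = (\int[m]_x (f x * f x))%:E.
Proof.
move=> [mf fi]; have -> : \int[m]_x (f x * f x) = fine (sqint f) by [].
by rewrite fineK// ge0_fin_numE// sqint_ge0.
Qed.

End square_integrals.

Section ecvg0.
Variable R : realType.
Implicit Types u v : nat -> \bar R.
Local Open Scope ereal_scope.

(** One-sided on purpose: for nonnegative sequences it is convergence to 0, and it passes to any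
    smaller sequence without further conditions. *)
Definition ecvg0 u : Prop :=
  forall e : R, (0 < e)%R -> exists N, forall k, (N <= k)%N -> u k <= e%:E.

Lemma ecvg0_le u v : (forall k, u k <= v k) -> ecvg0 v -> ecvg0 u.
Proof.
move=> uv v0 e e0; have [N vN] := v0 e e0.
by exists N => k Nk; exact: le_trans (uv k) (vN k Nk).
Qed.

Lemma ecvg0D u v : ecvg0 u -> ecvg0 v -> ecvg0 (fun k => u k + v k).
Proof.
move=> u0 v0 e e0; have e2 : (0 < e / 2)%R by rewrite divr_gt0.
have [N uN] := u0 _ e2; have [M vM] := v0 _ e2.
exists (maxn N M) => k; rewrite geq_max => /andP[Nk Mk].
by rewrite [e]splitr EFinD leeD ?uN ?vM.
Qed.

Lemma ecvg0Z (c : R) u : (forall k, 0 <= u k) -> ecvg0 u ->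
  ecvg0 (fun k => c%:E * u k).
Proof.
move=> u_ge0 u0 e e0.
(* The added 1 keeps the divisor positive when [c] is 0. *)
have c0 : (0 < `|c| + 1)%R by rewrite ltr_wpDl.
have [N uN] := u0 (e / (`|c| + 1))%R (divr_gt0 e0 c0).
exists N => k /uN; move: (u_ge0 k); case: (u k) => [r| |]//.
rewrite !lee_fin => r0; rewrite ler_pdivlMr// => re.
rewrite (le_trans _ re)//.
rewrite mulrC ler_wpM2l// (le_trans (ler_norm c))// lerDl//.
Qed.

Lemma ecvg0_cvg u : u @ \oo --> 0 -> ecvg0 u.
Proof.
move=> u0 e e0.
have /u0[N _ uN] : nbhs (0 : \bar R) [set x | x <= e%:E].
  exists e => //= x /=; rewrite sub0r normrN => xe.
  by rewrite lee_fin (le_trans (ler_norm _))// ltW.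
by exists N => k Nk; exact: uN.
Qed.

Lemma cvg_ecvg0 u : (forall k, 0 <= u k) -> ecvg0 u -> u @ \oo --> 0.
Proof.
move=> u_ge0 u0 A [e /= e0 eA].
have [N uN] := u0 (e / 2)%R (divr_gt0 e0 (ltr0n _ 2)).
exists N => // k /= Nk.
have uk : u k \is a fin_num.
  by rewrite ge0_fin_numE// (le_lt_trans (uN _ Nk))// ltry.
rewrite -(fineK uk); apply: eA => /=; rewrite sub0r normrN.
rewrite ger0_norm ?fine_ge0//.
rewrite -lte_fin fineK// (le_lt_trans (uN _ Nk))// lte_fin.
by rewrite ltr_pdivrMr// ltr_pMr// ltr1n.
Qed.

Lemma ecvg0_const (c : \bar R) u : (forall k, c <= u k) -> ecvg0 u -> c <= 0.
Proof.
move=> cu u0; apply/lee_addgt0Pr => e e0; have [N uN] := u0 e e0.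
by rewrite add0e (le_trans (cu N))// uN.
Qed.

Lemma ecvg0_sub u (s : nat -> nat) : (forall k, (k <= s k)%N) -> ecvg0 u ->
  ecvg0 (u \o s).
Proof.
move=> ks u0 e e0; have [N uN] := u0 e e0.
by exists N => k Nk /=; apply: uN; exact: leq_trans (ks k).
Qed.

End ecvg0.

Section real_fubini.
Context d1 d2 (T1 : measurableType d1) (T2 : measurableType d2) (R : realType).
Variables (m1 : {sigma_finite_measure set T1 -> \bar R})
  (m2 : {sigma_finite_measure set T2 -> \bar R}).
Implicit Types f g : T1 * T2 -> R.

Lemma measurable_section1 d (T : measurableType d) (f : T1 * T2 -> T) x :
  measurable_fun setT f -> measurable_fun setT (fun y => f (x, y)).
Proof. by move=> mf; exact: (measurableT_comp mf (pair1_measurable x)). Qed.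

Lemma measurable_section2 d (T : measurableType d) (f : T1 * T2 -> T) y :
  measurable_fun setT f -> measurable_fun setT (fun x => f (x, y)).
Proof. by move=> mf; exact: (measurableT_comp mf (pair2_measurable y)). Qed.

(** The integral is the real part of the difference of the integrals of the positive and negative
    parts; each is measurable by Tonelli, whether or not the sections of [f] are integrable. *)
Lemma measurable_Rintegral1 f : measurable_fun setT f ->
  measurable_fun setT (fun x => \int[m2]_y f (x, y)).
Proof.
move=> mf; apply: measurableT_comp => //.
have mf' : measurable_fun setT (EFin \o f) by exact/measurable_EFinP.
rewrite (_ : (fun x => _) = (fun x => \int[m2]_y (EFin \o f)^\+ (x, y)) \-
                       (fun x => \int[m2]_y (EFin \o f)^\- (x, y)))%E.
  apply: emeasurable_funB.
    apply: (measurable_fun_fubini_tonelli_F (m2 := m2) ((EFin \o f)^\+)%E) => //.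
    exact: measurable_funepos.
  apply: (measurable_fun_fubini_tonelli_F (m2 := m2) ((EFin \o f)^\-)%E) => //.
  exact: measurable_funeneg.
apply/funext => x; rewrite [LHS]integralE.
by congr (_ - _)%E; apply: eq_integral => y _; rewrite ?funeposE ?funenegE.
Qed.

Lemma measurable_Rintegral2 f : measurable_fun setT f ->
  measurable_fun setT (fun y => \int[m1]_x f (x, y)).
Proof.
move=> mf; apply: measurableT_comp => //.
have mf' : measurable_fun setT (EFin \o f) by exact/measurable_EFinP.
rewrite (_ : (fun x => _) = (fun y => \int[m1]_x (EFin \o f)^\+ (x, y)) \-
                       (fun y => \int[m1]_x (EFin \o f)^\- (x, y)))%E.
  apply: emeasurable_funB.
    apply: (measurable_fun_fubini_tonelli_G (m1 := m1) ((EFin \o f)^\+)%E) => //.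
    exact: measurable_funepos.
  apply: (measurable_fun_fubini_tonelli_G (m1 := m1) ((EFin \o f)^\-)%E) => //.
  exact: measurable_funeneg.
apply/funext => x; rewrite [LHS]integralE.
by congr (_ - _)%E; apply: eq_integral => y _; rewrite ?funeposE ?funenegE.
Qed.

Lemma ae_EFin_Rintegral1 f : (m1 \x m2)%E.-integrable setT (EFin \o f) ->
  {ae m1, forall x, (\int[m2]_y f (x, y))%:E = (\int[m2]_y (f (x, y))%:E)%E}.
Proof.
move=> /ae_integrable1; apply: filterS => x fx.
by rewrite fineK//; exact: integrable_fin_num.
Qed.

Lemma ae_EFin_Rintegral2 f : (m1 \x m2)%E.-integrable setT (EFin \o f) ->
  {ae m2, forall y, (\int[m1]_x f (x, y))%:E = (\int[m1]_x (f (x, y))%:E)%E}.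
Proof.
move=> /ae_integrable2; apply: filterS => x fx.
by rewrite fineK//; exact: integrable_fin_num.
Qed.

Lemma integrable_Rintegral1 f : (m1 \x m2)%E.-integrable setT (EFin \o f) ->
  m1.-integrable setT (fun x => (\int[m2]_y f (x, y))%:E).
Proof.
move=> fi; have mf : measurable_fun setT f by apply/measurable_EFinP; exact: measurable_int fi.
apply/integrableP; split.
  by apply/measurable_EFinP; exact: measurable_Rintegral1.
rewrite (@ae_eq_integral _ _ _ _ _ (abse \o fubini_F m2 (EFin \o f)))//.
- by have /integrableP[] := integrable_fubini_F fi.
- apply: measurableT_comp => //; apply/measurable_EFinP.
  exact: measurable_Rintegral1.
- by apply: measurableT_comp => //; exact: measurable_fubini_F fi.
- apply: filterS (ae_EFin_Rintegral1 fi) => x fx _; rewrite /fubini_F [RHS]/=.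
  by rewrite -[in RHS]fx abse_EFin.
Qed.

(** Sections that are not integrable form a null set, so the default value taken there by the inner
    integral does not affect the outer one. *)
Lemma Rintegral_prod1 f : (m1 \x m2)%E.-integrable setT (EFin \o f) ->
  \int[m1]_x \int[m2]_y f (x, y) = \int[(m1 \x m2)%E]_p f p.
Proof.
move=> fi; have mf : measurable_fun setT f by apply/measurable_EFinP; exact: measurable_int fi.
congr fine; rewrite -(integral12_prod_meas1 fi); apply: ae_eq_integral => //.
- by apply/measurable_EFinP; exact: measurable_Rintegral1.
- exact: measurable_fubini_F fi.
- by apply: filterS (ae_EFin_Rintegral1 fi) => x + _ /= => ->.
Qed.

Lemma Rintegral_prod2 f : (m1 \x m2)%E.-integrable setT (EFin \o f) ->
  \int[m2]_y \int[m1]_x f (x, y) = \int[(m1 \x m2)%E]_p f p.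
Proof.
move=> fi; have mf : measurable_fun setT f by apply/measurable_EFinP; exact: measurable_int fi.
congr fine; rewrite -(integral21_prod_meas1 fi); apply: ae_eq_integral => //.
- by apply/measurable_EFinP; exact: measurable_Rintegral2.
- exact: measurable_fubini_G fi.
- by apply: filterS (ae_EFin_Rintegral2 fi) => x + _ /= => ->.
Qed.

Lemma sqint_prod1 f : measurable_fun setT f ->
  sqint (m1 \x m2)%E f = (\int[m1]_x sqint m2 (fun y => f (x, y)))%E.
Proof.
move=> mf; rewrite /sqint (fubini_tonelli1 (fun p => ((f p) ^+ 2)%:E))//.
- exact: measurable_sqE.
- by move=> x; rewrite lee_fin sqr_ge0.
Qed.

Lemma sqint_prod2 f : measurable_fun setT f ->
  sqint (m1 \x m2)%E f = (\int[m2]_y sqint m1 (fun x => f (x, y)))%E.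
Proof.
move=> mf; rewrite /sqint (fubini_tonelli2 (fun p => ((f p) ^+ 2)%:E))//.
- exact: measurable_sqE.
- by move=> x; rewrite lee_fin sqr_ge0.
Qed.

Lemma measurable_sqint1 f : measurable_fun setT f ->
  measurable_fun setT (fun x => sqint m2 (fun y => f (x, y))).
Proof.
move=> mf; apply: (measurable_fun_fubini_tonelli_F (m2 := m2)
  (fun p => ((f p) ^+ 2)%:E)).
- exact: measurable_sqE.
- by move=> x; rewrite lee_fin sqr_ge0.
Qed.

Lemma measurable_sqint2 f : measurable_fun setT f ->
  measurable_fun setT (fun y => sqint m1 (fun x => f (x, y))).
Proof.
move=> mf; apply: (measurable_fun_fubini_tonelli_G (m1 := m1)
  (fun p => ((f p) ^+ 2)%:E)).
- exact: measurable_sqE.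
- by move=> x; rewrite lee_fin sqr_ge0.
Qed.

(** By Tonelli the squared norms of the sections have a finite integral, hence are finite almost
    everywhere. *)
Lemma ae_Lsq1 f : Lsq (m1 \x m2)%E f ->
  {ae m1, forall x, Lsq m2 (fun y => f (x, y))}.
Proof.
move=> [mf fi].
have : m1.-integrable setT (fun x => sqint m2 (fun y => f (x, y))).
  apply/integrableP; split; first exact: measurable_sqint1.
  rewrite (eq_integral (fun x => sqint m2 (fun y => f (x, y)))) -?sqint_prod1//.
  by move=> x _; rewrite gee0_abs// sqint_ge0.
move/(integrable_ae measurableT); apply: filterS => x /(_ I) fx.
split; first exact: measurable_section1.
by rewrite -ge0_fin_numE ?sqint_ge0.
Qed.

Lemma ae_Lsq2 f : Lsq (m1 \x m2)%E f ->
  {ae m2, forall y, Lsq m1 (fun x => f (x, y))}.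
Proof.
move=> [mf fi].
have : m2.-integrable setT (fun y => sqint m1 (fun x => f (x, y))).
  apply/integrableP; split; first exact: measurable_sqint2.
  rewrite (eq_integral (fun y => sqint m1 (fun x => f (x, y)))) -?sqint_prod2//.
  by move=> x _; rewrite gee0_abs// sqint_ge0.
move/(integrable_ae measurableT); apply: filterS => x /(_ I) fx.
split; first exact: measurable_section2.
by rewrite -ge0_fin_numE ?sqint_ge0.
Qed.

Lemma ae_prod1 (P : T1 * T2 -> Prop) : {ae (m1 \x m2)%E, forall p, P p} ->
  {ae m1, forall x, {ae m2, forall y, P (x, y)}}.
Proof.
move=> [N [mN N0 PN]].
have /(ae_eq_integral_abs m1 measurableT) N0' :
    (\int[m1]_x `|(m2 \o xsection N) x| = 0)%E.
  by rewrite -[RHS]N0; apply: eq_integral => x _; rewrite gee0_abs.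
apply: filterS (N0' (measurable_fun_xsection _ mN)) => x /(_ I) /= Nx.
exists (xsection N x); split => //; first exact: measurable_xsection.
by move=> y /= Pxy; rewrite /xsection /= inE; exact: PN.
Qed.

(** Null sections give a null set only if the set is measurable; this comes from the measurability
    of [f] and [g], through Tonelli for the square of their difference. *)
Lemma ae_eq_prod1 f g : measurable_fun setT f -> measurable_fun setT g ->
  {ae m1, forall x, {ae m2, forall y, f (x, y) = g (x, y)}} ->
  {ae (m1 \x m2)%E, forall p, f p = g p}.
Proof.
move=> mf mg fg.
suff : sqint (m1 \x m2)%E (f \- g) = 0%E.
  move/(sqint_eq0 (measurable_funB mf mg)); apply: filterS => p /= /eqP.
  by rewrite subr_eq0 => /eqP.
rewrite sqint_prod1; last exact: measurable_funB.
rewrite -(integral0 m1 setT); apply: ae_eq_integral => //.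
  by apply: measurable_sqint1; exact: measurable_funB.
apply: filterS fg => x fg _; rewrite -(integral0 m2 setT).
apply: ae_eq_integral => //.
  apply: measurable_sqE; apply: measurable_funB; exact: measurable_section1.
by apply: filterS fg => y /= -> _; rewrite subrr expr0n.
Qed.

Lemma ae_eq_prod2 f g : measurable_fun setT f -> measurable_fun setT g ->
  {ae m2, forall y, {ae m1, forall x, f (x, y) = g (x, y)}} ->
  {ae (m1 \x m2)%E, forall p, f p = g p}.
Proof.
move=> mf mg fg.
suff : sqint (m1 \x m2)%E (f \- g) = 0%E.
  move/(sqint_eq0 (measurable_funB mf mg)); apply: filterS => p /= /eqP.
  by rewrite subr_eq0 => /eqP.
rewrite sqint_prod2; last exact: measurable_funB.
rewrite -(integral0 m2 setT); apply: ae_eq_integral => //.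
  by apply: measurable_sqint2; exact: measurable_funB.
apply: filterS fg => x fg _; rewrite -(integral0 m1 setT).
apply: ae_eq_integral => //.
  apply: measurable_sqE; apply: measurable_funB; exact: measurable_section2.
by apply: filterS fg => y /= -> _; rewrite subrr expr0n.
Qed.

End real_fubini.

(** * Convergence in mean of products and inner products *)

Section mean_convergence.
Context d (T : measurableType d) (R : realType) (m : {measure set T -> \bar R}).
Implicit Types f g : T -> R.

Definition L1cvg (u : nat -> T -> R) f : Prop :=
  ecvg0 (fun k => \int[m]_x (`|u k x - f x|)%:E)%E.

(** For every [k], the integral of |f - g| is at most the sum of two distances tending to 0.
    Identities between mollified quantities become almost everywhere identities between their limits
    in this way. *)
Lemma L1cvg_unique (u v : nat -> T -> R) f g :
  (forall k, measurable_fun setT (u k)) -> (forall k, measurable_fun setT (v k)) ->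
  measurable_fun setT f -> measurable_fun setT g ->
  (forall k, {ae m, forall x, u k x = v k x}) ->
  L1cvg u f -> L1cvg v g -> {ae m, forall x, f x = g x}.
Proof.
move=> mu mv mf mg uv uf vg.
pose h : T -> \bar R := fun x => (f x - g x)%:E.
have mh : measurable_fun setT h by apply/measurable_EFinP; exact: measurable_funB.
have mn (w : T -> R) : measurable_fun setT w ->
    measurable_fun setT (fun x => (`|w x|)%:E : \bar R).
  by move=> mw; apply/measurable_EFinP; exact: measurableT_comp.
suff : (\int[m]_x `|h x| = 0)%E.
  move/(ae_eq_integral_abs m measurableT mh); apply: filterS => x /(_ I) /= [].
  by move=> /eqP; rewrite subr_eq0 => /eqP.
apply/eqP; rewrite eq_le; apply/andP; split; last exact: integral_ge0.
apply: ecvg0_const (ecvg0D uf vg) => k.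
rewrite -ge0_integralD//; last 2 first.
- by apply: mn; exact: measurable_funB.
- by apply: mn; exact: measurable_funB.
apply: ae_ge0_le_integral => //.
- exact: measurableT_comp.
- by move=> x _; rewrite -EFinD lee_fin addr_ge0.
- apply: emeasurable_funD; apply: mn; exact: measurable_funB.
- apply: filterS (uv k) => x uvx _; rewrite /h /= -EFinD lee_fin uvx.
  have -> : f x - g x = - (v k x - f x) + (v k x - g x) by ring.
  by rewrite (le_trans (ler_normD _ _))// normrN.
Qed.

Lemma L1cvgD (u v : nat -> T -> R) f g :
  (forall k, measurable_fun setT (u k)) -> (forall k, measurable_fun setT (v k)) ->
  measurable_fun setT f -> measurable_fun setT g ->
  L1cvg u f -> L1cvg v g ->
  L1cvg (fun k x => u k x + v k x) (fun x => f x + g x).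
Proof.
move=> mu mv mf mg uf vg.
apply: ecvg0_le (ecvg0D uf vg) => k.
have mn (w : T -> R) : measurable_fun setT w ->
    measurable_fun setT (fun x => (`|w x|)%:E : \bar R).
  by move=> mw; apply/measurable_EFinP; exact: measurableT_comp.
rewrite -ge0_integralD//; last 2 first.
- by apply: mn; exact: measurable_funB.
- by apply: mn; exact: measurable_funB.
apply: ge0_le_integral => //.
- by apply: mn; apply: measurable_funB; exact: measurable_funD.
- apply: emeasurable_funD; apply: mn; exact: measurable_funB.
- move=> x _; rewrite -EFinD lee_fin opprD addrACA; exact: ler_normD.
Qed.

Lemma L1cvgN (u : nat -> T -> R) f :
  L1cvg u f -> L1cvg (fun k x => - u k x) (fun x => - f x).
Proof.
by apply: ecvg0_le => k; under eq_integral do rewrite -opprD normrN.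
Qed.

End mean_convergence.

Section inner_product_convergence.
Context d1 d2 (T1 : measurableType d1) (T2 : measurableType d2) (R : realType).
Variables (m1 : {sigma_finite_measure set T1 -> \bar R})
  (m2 : {sigma_finite_measure set T2 -> \bar R}).
Implicit Types f g : T1 * T2 -> R.
Local Notation m12 := (m1 \x m2)%E.

Lemma Lsq_mul_cvg (d : measure_display) (T : measurableType d)
    (m : {measure set T -> \bar R}) (u v : nat -> T -> R) (f g : T -> R) :
  (forall k, measurable_fun setT (u k)) -> (forall k, measurable_fun setT (v k)) ->
  Lsq m f -> Lsq m g ->
  ecvg0 (fun k => sqint m (fun x => u k x - f x)) ->
  ecvg0 (fun k => sqint m (fun x => v k x - g x)) ->
  L1cvg m (fun k x => u k x * v k x) (fun x => f x * g x).
Proof.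
move=> mu mv [mf fi] [mg gi] uf vg e e0.
pose A := fine (sqint m f); pose B := fine (sqint m g).
have A0 : 0 <= A by apply: fine_ge0; exact: sqint_ge0.
have B0 : 0 <= B by apply: fine_ge0; exact: sqint_ge0.
have fA : sqint m f = A%:E by rewrite fineK// ge0_fin_numE// sqint_ge0.
have gB : sqint m g = B%:E by rewrite fineK// ge0_fin_numE// sqint_ge0.
(* With a and b the squared distances, Young's inequality leaves (1 + 1/t)(a + b) + t(A + B). This
   [t] bounds the second summand by e/4, and [s] below then bounds the first by e/2. *)
pose t := e / (4 * (1 + A + B)).
have AB : 0 < 4 * (1 + A + B) by rewrite mulr_gt0// -addrA ltr_wpDr// addr_ge0.
have t0 : 0 < t by rewrite divr_gt0.
pose s := e / (4 * (1 + t^-1)).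
have t'0 : 0 < t^-1 by rewrite invr_gt0.
have s0 : 0 < s by rewrite divr_gt0// mulr_gt0// addr_gt0.
have [N uN] := uf s s0; have [M vM] := vg s s0.
exists (maxn N M) => k; rewrite geq_max => /andP[/uN us /vM vs].
have mfu : measurable_fun setT (fun x => u k x - f x) by exact: measurable_funB.
have mgv : measurable_fun setT (fun x => v k x - g x) by exact: measurable_funB.
have mn (w : T -> R) : measurable_fun setT w ->
    measurable_fun setT (fun x => (`|w x|)%:E : \bar R).
  by move=> mw; apply/measurable_EFinP; exact: measurableT_comp.
have mp (w w' : T -> R) : measurable_fun setT w -> measurable_fun setT w' ->
    measurable_fun setT (fun x => (`|w x * w' x|)%:E : \bar R).
  by move=> mw mw'; apply: mn; exact: measurable_funM.
apply: (@le_trans _ _ (\int[m]_x (`|(u k x - f x) * (v k x - g x)|%:E +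
    (`|(u k x - f x) * g x|%:E + `|f x * (v k x - g x)|%:E)))%E).
  apply: ge0_le_integral => //.
  - by apply: mn; apply: measurable_funB; exact: measurable_funM.
  - by apply: emeasurable_funD; [exact: mp|apply: emeasurable_funD; exact: mp].
  - move=> x _; rewrite -!EFinD lee_fin.
    have -> : u k x * v k x - f x * g x = (u k x - f x) * (v k x - g x) +
      ((u k x - f x) * g x + f x * (v k x - g x)) by ring.
    by rewrite (le_trans (ler_normD _ _))// lerD2l ler_normD.
rewrite ge0_integralD//; [|exact: mp|by move=> x _; rewrite -EFinD lee_fin addr_ge0
  |by apply: emeasurable_funD; exact: mp].
rewrite ge0_integralD//; [|exact: mp|exact: mp].
have Y1 := young_integral m ltr01 mfu mgv.
have Y2 := young_integral m t'0 mfu mg.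
have Y3 := young_integral m t0 mf mgv.
apply: (le_trans (leeD Y1 (leeD Y2 Y3))).
move: us vs (sqint_ge0 m (fun x => u k x - f x)) (sqint_ge0 m (fun x => v k x - g x)).
rewrite fA gB; case: (sqint m _) => [a| |]//; case: (sqint m _) => [b| |]//.
rewrite -!EFinM -!EFinD !lee_fin => sa sb a0 b0; rewrite invrK invr1 !mul1r.
have Es : s * (1 + t^-1) = e / 4.
  by rewrite /s; field; rewrite !gt_eqF//; rewrite ?mulr_gt0 ?addr_gt0.
have Et : t * (1 + A + B) = e / 4 by rewrite /t; field; rewrite gt_eqF// -addrA ltr_wpDr// addr_ge0.
have h1 : t^-1 * a <= t^-1 * s by rewrite ler_wpM2l// ltW.
have h2 : t^-1 * b <= t^-1 * s by rewrite ler_wpM2l// ltW.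
rewrite mulrDr mulr1 in Es; rewrite !mulrDr mulr1 in Et.
lra.
Qed.

(** Integrating out the first variable does not increase the L^1 norm, so this follows from
    convergence of the products on the product space. *)
Lemma inner_L1cvg (u v : nat -> T1 * T2 -> R) f g :
  (forall k, Lsq m12 (u k)) -> (forall k, Lsq m12 (v k)) ->
  Lsq m12 f -> Lsq m12 g ->
  ecvg0 (fun k => sqint m12 (fun p => u k p - f p)) ->
  ecvg0 (fun k => sqint m12 (fun p => v k p - g p)) ->
  L1cvg m2 (fun k y => \int[m1]_x (u k (x, y) * v k (x, y)))
           (fun y => \int[m1]_x (f (x, y) * g (x, y))).
Proof.
move=> Lu Lv Lf Lg uf vg.
have mM (w w' : T1 * T2 -> R) : Lsq m12 w -> Lsq m12 w' ->
    measurable_fun setT (fun p => w p * w' p).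
  by move=> [mw _] [mw' _]; exact: measurable_funM.
have mI (w w' : T1 * T2 -> R) : Lsq m12 w -> Lsq m12 w' ->
    measurable_fun setT (fun y => \int[m1]_x (w (x, y) * w' (x, y))).
  by move=> Lw Lw'; apply: (measurable_Rintegral2 m1 (mM _ _ Lw Lw')).
apply: ecvg0_le (Lsq_mul_cvg (fun k => (Lu k).1) (fun k => (Lv k).1) Lf Lg uf vg) => k.
have mF : measurable_fun setT (fun p : T1 * T2 => (`|u k p * v k p - f p * g p|)%:E : \bar R).
  by apply/measurable_EFinP; apply: measurableT_comp => //; apply: measurable_funB; exact: mM.
rewrite (fubini_tonelli2 (fun p => `|u k p * v k p - f p * g p|%:E))//.
apply: ae_ge0_le_integral => //.
- apply/measurable_EFinP; apply: measurableT_comp => //.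
  by apply: measurable_funB; exact: mI.
- by move=> y _; apply: integral_ge0.
- exact: (measurable_fun_fubini_tonelli_G (fun p => `|u k p * v k p - f p * g p|%:E)).
apply: filterS2 (filterI (ae_Lsq2 Lg) (ae_Lsq2 Lf)) (filterI (ae_Lsq2 (Lv k)) (ae_Lsq2 (Lu k))).
move=> y [Ly1 Ly2] [Ly3 Ly4] _.
have i1 := integrable_Lsq_mul Ly4 Ly3; have i2 := integrable_Lsq_mul Ly2 Ly1.
rewrite -RintegralB// EFin_normr_Rintegral//; last first.
  by have := integrableB measurableT i1 i2; apply: eq_integrable.
apply: le_trans (le_abse_integral _ _ _) _ => //.
apply/measurable_EFinP; apply: measurable_funB; apply: measurable_funM.
exact: Ly4.1. exact: Ly3.1. exact: Ly2.1. exact: Ly1.1.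
Qed.

End inner_product_convergence.

(** * Topology and measurability on matrix spaces *)

Section measurable_base.

(** The sigma-algebras on matrices and on products are generated by coordinates, not by open sets; a
    countable family of this kind makes every open set measurable. Its members are not asked to be
    open. *)
Definition has_measurable_base (T : topologicalType) (M : set (set T)) : Prop :=
  exists B : nat -> set T, (forall k, M (B k)) /\
    forall x O, nbhs x O -> exists k, B k x /\ B k `<=` O.

Lemma base_open_measurable d (T : measurableType d) (U : topologicalType)
    (f : T -> U) (O : set U) :
  has_measurable_base (fun A => measurable (f @^-1` A)) -> open O ->
  measurable (f @^-1` O).
Proof.
move=> [B [mB BO]] oO.
rewrite (_ : _ @^-1` _ = \bigcup_(k in [set k | B k `<=` O]) (f @^-1` (B k))).
  by apply: bigcup_measurable => k _; exact: mB.
apply/seteqP; split => [x /= Ofx|x [k /= kO Bk]]; last exact: kO.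
have [k [Bk kO]] := BO (f x) O (open_nbhs_nbhs (conj oO Ofx)).
by exists k.
Qed.

Lemma has_measurable_base_prod (T1 T2 : topologicalType) (M1 : set (set T1))
    (M2 : set (set T2)) (M : set (set (T1 * T2))) :
  (forall A B, M1 A -> M2 B -> M (A `*` B)) ->
  has_measurable_base M1 -> has_measurable_base M2 -> has_measurable_base M.
Proof.
move=> M12 [B1 [mB1 B1O]] [B2 [mB2 B2O]].
(* Indices that code no pair get a fixed product as default, so that every member lies in [M]. *)
exists (fun k => if unpickle k is Some (i, j) then B1 i `*` B2 j else B1 0%N `*` B2 0%N).
split=> [k|[x y] O [[A1 A2] /= [nA1 nA2] A12]].
  by case: unpickle => [[i j]|]; exact: M12.
have [i [Bi iO]] := B1O x A1 nA1; have [j [Bj jO]] := B2O y A2 nA2.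
exists (pickle (i, j)); rewrite pickleK; split=> //.
by move=> [u v] [/= /iO ? /jO ?]; exact: A12.
Qed.

Lemma has_measurable_base_R (R : realType) :
  has_measurable_base (@measurable _ R).
Proof.
exists (fun k => if unpickle k is Some (p, q) then `](ratr p : R), ratr q[%classic else set0).
split=> [k|x O].
  by case: unpickle => [[p q]|].
move=> /nbhs_ballP[e /= e0 eO].
have xe1 : x - e < x by rewrite ltrBlDr ltrDl.
have xe2 : x < x + e by rewrite ltrDl.
have [p /itvP p_] := rat_in_itvoo xe1; have [q /itvP q_] := rat_in_itvoo xe2.
exists (pickle (p, q)); rewrite pickleK; split.
  by rewrite /= in_itv /= p_ q_.
move=> y /=; rewrite in_itv /= => /andP[py yq]; apply: eO.
rewrite /ball /= ltr_distlC; apply/andP; split.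
  by rewrite (lt_trans _ py)// p_.
by rewrite (lt_trans yq)// q_.
Qed.

(** A ball of the sup norm is a product of balls of R, so coordinate preimages can be intersected
    over the finitely many entries. Finite functions from entries to [nat] keep the family
    countable. *)
Lemma has_measurable_base_mx (R : realType) m n :
  has_measurable_base (@measurable _ 'M[R]_(m, n)).
Proof.
have [B [mB BO]] := has_measurable_base_R R.
pose I := {ffun 'I_m * 'I_n -> nat}.
pose C (s : I) : set 'M[R]_(m, n) := \bigcap_(ij in [set: 'I_m * 'I_n])
  ((fun A : 'M[R]_(m, n) => A ij.1 ij.2) @^-1` B (s ij)).
have mC s : measurable (C s).
  apply: fin_bigcap_measurable => // -[i j] _.
  rewrite -[X in measurable X]setTI.
  by apply: measurable_entry.
exists (fun k => if unpickle k is Some s then C s else setT).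
split=> [k|A O]; first by case: unpickle => [s|]; [exact: mC|exact: measurableT].
move=> /nbhs_ballP[e /= e0 eO].
have /choice[s sP] : forall ij : 'I_m * 'I_n, exists k, B k (A ij.1 ij.2) /\
    B k `<=` ball (A ij.1 ij.2) e.
  by move=> ij; apply: BO; exact: nbhsx_ballx.
exists (pickle [ffun ij => s ij]); rewrite pickleK; split.
  by move=> ij _ /=; rewrite ffunE; exact: (sP ij).1.
move=> A' CA'; apply: eO; split => // i j.
have := CA' (i, j) Logic.I; rewrite /= ffunE; exact: (sP (i, j)).2.
Qed.

Lemma measurable_fun_open d (T : measurableType d) (R : realType) (f : T -> R) :
  (forall O : set R, open O -> measurable (f @^-1` O)) -> measurable_fun setT f.
Proof.
move=> fO; apply: (measurability _ (RGenOInfty.measurableE R)).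
move=> /= _ [_ [a ->]] <-; rewrite setTI; apply: fO.
by rewrite set_itvE; exact: open_gt.
Qed.

End measurable_base.

Section matrix_norm.
Variables (R : realType) (m n : nat).
Implicit Types A B : 'M[R]_(m, n).

Lemma mx_norm_entry A i j : `|A i j| <= `|A|.
Proof.
rewrite [leRHS]/Num.Def.normr /= mx_normrE; apply/bigmax_geP; right => /=.
by exists (i, j).
Qed.

Lemma mx_norm_leP A (M : R) : 0 <= M ->
  (forall i j, `|A i j| <= M) -> `|A| <= M.
Proof.
move=> M0 AM; rewrite [leLHS]/Num.Def.normr /= mx_normrE; apply/bigmax_leP; split=> [//|[i j] _].
exact: AM.
Qed.

End matrix_norm.

Section matrix_topology.
Variables (R : realType) (m n : nat).

Lemma open_measurable_mx (O : set 'M[R]_(m, n)) : open O -> measurable O.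
Proof.
have := @base_open_measurable _ 'M[R]_(m, n) 'M[R]_(m, n) id O.
by apply; exact: has_measurable_base_mx.
Qed.

Lemma continuous_measurable_mx (f : 'M[R]_(m, n) -> R) :
  continuous f -> measurable_fun setT f.
Proof.
move=> cf; apply: measurable_fun_open => O oO; apply: open_measurable_mx.
by move/continuousP : cf; apply.
Qed.

Lemma compact_cball_mx (M : R) : compact [set A : 'M[R]_(m, n) | `|A| <= M].
Proof.
have [M0|M0] := ltP M 0.
  rewrite (_ : [set _ | _] = set0); first exact: compact0.
  apply/seteqP; split => // A /= AM.
  by move: (le_lt_trans AM M0); rewrite normr_lt0.
(* Heine-Borel is applied to row vectors; reshaping by [vec_mx] is continuous and maps one ball onto
   the other. *)
have -> : [set A : 'M[R]_(m, n) | `|A| <= M] =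
    vec_mx @` [set v : 'rV[R]_(m * n) | `|v| <= M].
  apply/seteqP; split => [A /= AM|_ [v /= vM <-]].
    exists (mxvec A); last exact: mxvecK.
    apply: mx_norm_leP => // i j; rewrite ord1.
    case/mxvec_indexP : j => i' j'; rewrite mxvecE.
    exact: le_trans (mx_norm_entry _ _ _) AM.
  apply: mx_norm_leP => // i j; rewrite mxE.
  apply: le_trans vM; rewrite [leRHS]/Num.Def.normr /= mx_normrE; apply/bigmax_geP; right => /=.
  by exists (ord0, mxvec_index i j).
apply: continuous_compact; last first.
  apply: bounded_closed_compact.
    exists M; split; first exact: num_real.
    by move=> M' MM' v /= vM; rewrite (le_trans vM)// ltW.
  apply: (@closed_comp _ _ (fun v : 'rV[R]_(m * n) => `|v|) [set x | x <= M]) => //.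
    by move=> v _; exact: norm_continuous.
apply: continuous_subspaceT => v A /nbhs_ballP[e /= e0 eA].
apply/nbhs_ballP; exists e => //= w [_ vw]; apply: eA; split => // i j.
by rewrite !mxE; exact: vw.
Qed.

Lemma measurable_cball_mx (M : R) : measurable [set A : 'M[R]_(m, n) | `|A| <= M].
Proof.
rewrite -[X in measurable X]setCK; apply: measurableC; apply: open_measurable_mx.
apply: closed_openC; apply: compact_closed; [exact: norm_hausdorff|exact: compact_cball_mx].
Qed.

Lemma compact_measurable_mx (K : set 'M[R]_(m, n)) : compact K -> measurable K.
Proof.
move=> cK; rewrite -[X in measurable X]setCK; apply: measurableC.
apply: open_measurable_mx; apply: closed_openC; exact: compact_closed.
Qed.

End matrix_topology.

Lemma compact_sub_cball (R : realType) (V : normedModType R) (K : set V) :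
  compact K -> exists k : nat, K `<=` [set x | `|x| <= k%:R].
Proof.
move=> /compact_bounded[M [_ MK]].
exists (Num.truncn (`|M| + 1)).+1 => x Kx /=.
have M1 : M < `|M| + 1 by rewrite (le_lt_trans (ler_norm M))// ltrDl.
apply: le_trans (MK _ M1 x Kx) _; apply/ltW.
by apply: truncnS_gt.
Qed.

Section product_topology.
Variables (R : realType) (m n m' n' : nat).
Local Notation V := ('M[R]_(m, n) * 'M[R]_(m', n'))%type.

Definition cbox (M : R) : set V := [set x | `|x.1| <= M /\ `|x.2| <= M].

Lemma open_measurable_prod (O : set V) : open O -> measurable O.
Proof.
move=> oO; apply: (@base_open_measurable _ V V id O) => //.
apply: has_measurable_base_prod (has_measurable_base_mx R m n)
  (has_measurable_base_mx R m' n').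
by move=> A B mA mB; exact: measurableX.
Qed.

Lemma continuous_measurable_prod (f : V -> R) :
  continuous f -> measurable_fun setT f.
Proof.
move=> cf; apply: measurable_fun_open => O oO; apply: open_measurable_prod.
by move/continuousP : cf; apply.
Qed.

Lemma cboxE M : cbox M = [set x | `|x| <= M] `*` [set x | `|x| <= M].
Proof. by []. Qed.

Lemma compact_cbox M : compact (cbox M).
Proof. by rewrite cboxE; apply: compact_setX; exact: compact_cball_mx. Qed.

Lemma measurable_cbox M : measurable (cbox M).
Proof. by rewrite cboxE; apply: measurableX; exact: measurable_cball_mx. Qed.

Lemma compact_measurable_prod (K : set V) : compact K -> measurable K.
Proof.
move=> cK; rewrite -[X in measurable X]setCK; apply: measurableC.
apply: open_measurable_prod; apply: closed_openC; exact: compact_closed.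
Qed.

Lemma compact_sub_cbox (K : set V) :
  compact K -> exists k : nat, K `<=` cbox k%:R.
Proof.
move=> cK.
have [k1 K1] : exists k : nat, fst @` K `<=` [set x | `|x| <= k%:R].
  apply: compact_sub_cball; apply: continuous_compact => //.
  by apply: continuous_subspaceT => x; exact: cvg_fst.
have [k2 K2] : exists k : nat, snd @` K `<=` [set x | `|x| <= k%:R].
  apply: compact_sub_cball; apply: continuous_compact => //.
  by apply: continuous_subspaceT => x; exact: cvg_snd.
exists (maxn k1 k2) => x Kx; split.
  by apply: le_trans (K1 x.1 _) _; [exists x|rewrite ler_nat leq_maxl].
by apply: le_trans (K2 x.2 _) _; [exists x|rewrite ler_nat leq_maxr].
Qed.

End product_topology.

(** * Smooth bump functions *)

Section theta.
Variable R : realType.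
Implicit Types t x : R.

(** The flat function exp(-1/t), multiplied by t^(-k): taken over all [k], these functions span a
    space stable under differentiation. *)
Definition theta (k : nat) t : R := if 0 < t then t ^- k * expR (- t^-1) else 0.

Lemma theta_ge0 k t : 0 <= theta k t.
Proof.
rewrite /theta; case: ifP => // t0.
by rewrite mulr_ge0 ?expR_ge0// invr_ge0 exprn_ge0// ltW.
Qed.

Lemma theta0_le1 t : theta 0 t <= 1.
Proof.
rewrite /theta; case: ifP => // t0; rewrite expr0 invr1 mul1r.
by rewrite -expR0 ler_expR oppr_le0 invr_ge0 ltW.
Qed.

Lemma theta_le0 k t : t <= 0 -> theta k t = 0.
Proof. by rewrite /theta; case: ltP. Qed.

Lemma theta_gt0 k t : 0 < t -> 0 < theta k t.
Proof.
by move=> t0; rewrite /theta t0 mulr_gt0 ?expR_gt0// invr_gt0 exprn_gt0.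
Qed.

(** From exp(1/t) >= t^(-k-2) / (k+2)!. A quadratic bound is what makes the derivative at 0 exist
    and vanish. *)
Lemma theta_sqr_bound k t : theta k t <= (k.+2)`!%:R * t ^+ 2.
Proof.
rewrite /theta; case: ifP => t0; last by rewrite mulr_ge0// sqr_ge0.
have t'0 : 0 <= t^-1 by rewrite invr_ge0 ltW.
have := expR_ge1Dxn k.+1 t'0.
set F := (k.+2)`!%:R.
have F0 : 0 < F :> R by rewrite ltr0n fact_gt0.
move=> h; have {}h : t^-1 ^+ k.+2 / F <= expR t^-1.
  by apply: le_trans h; rewrite lerDr.
rewrite expRN ler_pdivrMr ?expR_gt0//.
apply: le_trans (_ : F * t ^+ 2 * (t^-1 ^+ k.+2 / F) <= _); last first.
  by rewrite ler_wpM2l// mulr_ge0 ?sqr_ge0// ltW.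
rewrite le_eqVlt; apply/orP; left; apply/eqP.
rewrite !exprS expr0 exprVn; field.
by rewrite expf_eq0 !gt_eqF// andbF.
Qed.

Lemma is_derive_theta k t :
  is_derive t 1 (theta k) (- k%:R * theta k.+1 t + theta k.+2 t).
Proof.
have [t0|t0|->] := ltgtP t 0.
- rewrite !theta_le0 ?ltW// mulr0 addr0.
  apply: (@near_eq_is_derive _ _ _ (cst 0)).
  by near=> s; rewrite theta_le0//=; apply/ltW; near: s; exact: lt_nbhsl.
- have tn0 : t != 0 by rewrite gt_eqF.
  apply: (@near_eq_is_derive _ _ _ (fun s : R => s ^- k * expR (- s^-1))).
    by near=> s; rewrite /theta ifT//; near: s; exact: lt_nbhsr.
  have dV : is_derive t 1 (fun s : R => - s^-1) (t ^- 2).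
    have h := @is_deriveV R (fun s : R => s) t 1 1 tn0 (is_derive_id _ _).
    have := is_deriveN h.
    by move=> h'; apply: is_derive_eq h' _; rewrite scaleNr opprK /GRing.scale /= mulr1.
  have dE : is_derive t 1 (fun s : R => expR (- s^-1)) (expR (- t^-1) * t ^- 2).
    exact: (is_derive1_comp (f := expR) (g := fun s : R => - s^-1)).
  have dP : is_derive t 1 (fun s : R => s ^- k) (- k%:R * t ^- k.+1).
    case: k => [|k].
      rewrite oppr0 mul0r (_ : (fun _ => _) = cst 1); first exact: is_derive_cst.
      by apply/funext => s; rewrite expr0 invr1.
    have hX : is_derive t 1 (fun s : R => s ^+ k.+1) (k.+1%:R * t ^+ k).
      have h := @is_deriveX R R (fun s : R => s) k.+1 t 1 1 (is_derive_id _ _).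
      rewrite [X in is_derive _ _ X _](_ : _ = (fun s : R => s) ^+ k.+1); last first.
        by apply/funext => s; rewrite exprfctE.
      by apply: is_derive_eq h _; rewrite /GRing.scale /= mulr1.
    have tk0 : t ^+ k.+1 != 0 by rewrite expf_neq0.
    have h := @is_deriveV R (fun s : R => s ^+ k.+1) t _ 1 tk0 hX.
    apply: is_derive_eq h _; rewrite /GRing.scale /=.
    rewrite !exprS; field.
    by rewrite expf_neq0.
  have h := is_deriveM dP dE.
  apply: is_derive_eq h _; rewrite /GRing.scale /= /theta t0.
  rewrite !exprS; field.
  by rewrite expf_neq0.
(* At 0 the difference quotient is at most (k+2)! |h|, by [theta_sqr_bound]. *)
- rewrite !theta_le0// mulr0 addr0.
  have h0 : h^-1 *: ((theta k \o shift 0) (h *: (1 : R)) - theta k 0) @[h --> 0^'] --> (0 : R).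
    apply/cvgrPdist_le => e e0; near=> h.
    have hn0 : h != 0 by near: h; exact: nbhs_dnbhs_neq.
    rewrite /= addr0 [theta k 0]theta_le0// subr0 sub0r normrN /GRing.scale /= mulr1.
    rewrite normrM normfV ger0_norm ?theta_ge0// mulrC ler_pdivrMr ?normr_gt0//.
    apply: le_trans (theta_sqr_bound _ _) _.
    rewrite -[h ^+ 2]real_normK ?num_real// expr2 mulrA ler_wpM2r//.
    rewrite mulrC -ler_pdivlMr ?ltr0n ?fact_gt0//.
    near: h; apply: dnbhs0_le; rewrite divr_gt0// ltr0n fact_gt0//.
  by split; [exact: cvgP h0|exact: cvg_lim h0].
Unshelve. all: by end_near. Qed.

End theta.

Section line.
Variables (R : realType) (V : normedModType R).

(** Both sides are limits of the same difference quotient; one-variable rules thereby apply to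
    directional derivatives. *)
Lemma is_derive_line (f : V -> R) x v d :
  is_derive (0 : R) 1 (fun h : R => f (h *: v + x)) d <-> is_derive x v f d.
Proof.
have E : (fun h : R => h^-1 *: (((fun h : R => f (h *: v + x)) \o shift 0) (h *: (1 : R)) -
      (fun h : R => f (h *: v + x)) 0)) =
    (fun h : R => h^-1 *: ((f \o shift x) (h *: v) - f x)).
  by apply/funext => h /=; rewrite scale0r add0r addr0 /GRing.scale /= mulr1.
by split => -[] h1 h2; split; move: h1 h2; rewrite /derivable /derive E.
Qed.

End line.

Section boxes.
Variables (T : Type) (R : realType) (I : finType) (c : I -> T -> R).

Definition obox (a b : I -> R) : set T := [set x | forall i, a i < c i x < b i].

(** The coordinate functions [c] are left abstract, so that matrices and products of two matrix
    spaces are treated at once. The scale [k.+1] sharpens the bump towards the indicator of the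
    box. *)
Definition bump (a b : I -> R) (k : nat) (x : T) : R :=
  \prod_i (theta 0 (k.+1%:R * (c i x - a i)) * theta 0 (k.+1%:R * (b i - c i x))).

End boxes.

Section null.
Context d (T : measurableType d) (R : realType) (mu : {measure set T -> \bar R}).
Variables (I : finType) (c : I -> T -> R).
Hypothesis mc : forall i, measurable_fun setT (c i).

Local Notation obox := (@obox T R I c).
Local Notation bump := (@bump T R I c).

Lemma measurable_obox a b : measurable (obox a b).
Proof.
rewrite (_ : obox a b = \bigcap_(i in [set: I]) (c i @^-1` `]a i, b i[%classic)).
  apply: fin_bigcap_measurable => // i _; rewrite -[X in measurable X]setTI.
  exact: mc.
apply/seteqP; split => [x xab i _ /=|x xab i]; first by rewrite in_itv /= xab.
by have := xab i Logic.I; rewrite /= in_itv.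
Qed.

Hypothesis gen : forall d' (S : measurableType d') (f : S -> T),
  (forall i, measurable_fun setT (c i \o f)) -> measurable_fun setT f.

Let G : set (set T) := [set obox ab.1 ab.2 | ab in [set: (I -> R) * (I -> R)]].

Lemma oboxI a b a' b' : obox a b `&` obox a' b' =
  obox (fun i => Num.max (a i) (a' i)) (fun i => Num.min (b i) (b' i)).
Proof.
apply/seteqP; split => [x [ab ab'] i|x ab].
  by rewrite gt_max lt_min; move: (ab i) (ab' i) => /andP[-> ->] /andP[-> ->].
by split => i; have := ab i; rewrite gt_max lt_min => /andP[/andP[? ?] /andP[? ?]]; apply/andP.
Qed.

Lemma obox_cover : \bigcup_k obox (fun=> - k%:R) (fun=> k%:R) = setT.
Proof.
rewrite -subTset => x _.
pose M := \sum_i `|c i x|.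
exists (Num.truncn M).+1 => // i.
rewrite -ltr_norml; apply: le_lt_trans (truncnS_gt _).
by rewrite /M (bigD1 i)//= lerDl sumr_ge0.
Qed.

(** The assumption [gen] says that the coordinates generate the sigma-algebra, so it suffices to
    exhibit a half-line in one coordinate as a countable union of boxes. *)
Lemma measurable_obox_gen : @measurable _ T = <<s G >>.
Proof.
apply/seteqP; split; last first.
  apply: smallest_sub; first exact: sigma_algebra_measurable.
  by move=> _ [ab _ <-]; exact: measurable_obox.
suff : measurable_fun setT (id : g_sigma_algebraType G -> T).
  by move=> mid A mA; have := mid measurableT A mA; rewrite setTI.
apply: gen => i; apply: (measurability _ (RGenOInfty.measurableE R)).
move=> /= _ [_ [r ->]] <-; rewrite setTI.
rewrite (_ : _ @^-1` _ = \bigcup_k (obox (fun j => if j == i then r else - k%:R) (fun=> k%:R))).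
  apply: bigcupT_measurable => k; apply: sub_sigma_algebra.
  by exists (fun j => if j == i then r else - k%:R, fun=> k%:R).
apply/seteqP; split => [x|x [k _ xk]].
  rewrite /= in_itv /= andbT => rx.
  have [k _ xk] : (\bigcup_k obox (fun=> - k%:R) (fun=> k%:R)) x by rewrite obox_cover.
  exists k => // j; case: eqP => [->|_]; last exact: xk.
  by rewrite rx /=; have /andP[] := xk i.
by rewrite /= in_itv /= andbT; have := xk i; rewrite eqxx => /andP[].
Qed.

Lemma bump_ge0 a b k x : 0 <= bump a b k x.
Proof. by apply: prodr_ge0 => i _; rewrite mulr_ge0// theta_ge0. Qed.

Lemma bump_le1 a b k x : bump a b k x <= 1.
Proof.
apply: prodr_ile1 => i _.
by rewrite mulr_ge0 ?theta_ge0//= mulr_ile1 ?theta_ge0 ?theta0_le1.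
Qed.

Lemma bump_eq0 a b k x : ~ obox a b x -> bump a b k x = 0.
Proof.
move=> /existsNP[i xi]; rewrite /bump (bigD1 i)//=.
suff -> : theta 0 (k.+1%:R * (c i x - a i)) * theta 0 (k.+1%:R * (b i - c i x)) = 0.
  by rewrite mul0r.
have [xa|ax] := leP (c i x) (a i).
  by rewrite theta_le0 ?mul0r// mulr_ge0_le0// subr_le0.
have [bx|xb] := leP (b i) (c i x).
  by rewrite [X in _ * X]theta_le0 ?mulr0// mulr_ge0_le0// subr_le0.
by case: xi; rewrite ax xb.
Qed.

Lemma cvg_theta (s : R) : 0 < s -> (fun k : nat => theta 0 (k.+1%:R * s)) @ \oo --> (1 : R).
Proof.
move=> s0; rewrite (_ : (fun _ => _) = (fun k : nat => expR (- (s^-1 * k.+1%:R^-1)))); last first.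
  apply/funext => k; rewrite /theta mulr_gt0 ?ltr0n// expr0 invr1 mul1r.
  by rewrite invfM mulrC.
rewrite -[X in _ --> X]expR0; apply: continuous_cvg; first exact: continuous_expR.
rewrite -oppr0; apply: cvgN; rewrite -(mulr0 s^-1); apply: cvgMr.
exact: cvg_harmonic.
Qed.

Lemma cvg_bump a b x : bump a b ^~ x @ \oo --> (\1_(obox a b) x : R).
Proof.
rewrite indicE; case: (boolP (x \in obox a b)) => [|/negP]; rewrite inE => xab; last first.
  rewrite (_ : bump a b ^~ x = cst 0); first exact: cvg_cst.
  by apply/funext => k; rewrite bump_eq0.
rewrite /bump (_ : true%:R = \prod_(i : I) 1); last by rewrite big1.
apply: cvg_big => [|i _]; first exact: mul_continuous.
rewrite -[X in _ --> X]mulr1.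
by have /andP[? ?] := xab i; apply: cvgM; apply: cvg_theta; rewrite subr_gt0.
Qed.

Lemma measurable_theta k : measurable_fun setT (@theta R k).
Proof.
apply: continuous_measurable_fun => x.
apply: differentiable_continuous; apply/derivable1_diffP.
by case: (is_derive_theta k x).
Qed.

Lemma measurable_bump a b k : measurable_fun setT (bump a b k).
Proof.
apply: measurable_prod => i _; apply: measurable_funM; apply: measurableT_comp => //;
  try exact: measurable_theta; apply: measurable_funM => //; exact: measurable_funB.
Qed.

Variable g : T -> R.
Hypothesis mg : measurable_fun setT g.
Hypothesis ig : forall a b, mu.-integrable (obox a b) (EFin \o g).
Hypothesis g0 : forall a b k, \int[mu]_x (g x * bump a b k x) = 0.

(** The bumps tend to the indicator of the box and stay below it, so dominated convergence carries
    [g0] over to the indicator. *)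
Lemma integral_obox_eq0 a b : (\int[mu]_(x in obox a b) (g x)%:E)%E = 0%E.
Proof.
pose f := fun k x => (g x * bump a b k x)%:E.
pose h := fun x => (g x * \1_(obox a b) x)%:E.
have mo := measurable_obox a b.
have ig1 : mu.-integrable setT ((EFin \o g) \_ (obox a b)).
  by apply/(integrable_mkcond _ mo).1; exact: ig.
have Eh x : h x = ((EFin \o g) \_ (obox a b)) x.
  by rewrite /h patchE indicE; case: (x \in _); rewrite ?mulr1 ?mulr0.
have [] := @dominated_convergence _ _ _ mu setT measurableT f h
   (abse \o ((EFin \o g) \_ (obox a b))).
- move=> k; apply/measurable_EFinP; apply: measurable_funM => //; exact: measurable_bump.
- by apply/measurable_EFinP; apply: measurable_funM.
- apply: aeW => x _; apply: cvg_EFin; first by apply: nearW.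
  by apply: cvgMr; exact: cvg_bump.
- exact: integrable_abse.
- apply: aeW => x k _; rewrite /= patchE.
  case: ifPn => [_|/negP]; last first.
    by rewrite inE => nx; rewrite /f bump_eq0// mulr0.
  rewrite /= lee_fin normrM -[leRHS]mulr1 ler_wpM2l// ger0_norm ?bump_ge0//.
  exact: bump_le1.
move=> ih _; rewrite /= [X in X @ _ --> _](_ : _ = cst 0%E); last first.
  apply/funext => k /=; have := g0 a b k.
  rewrite /Rintegral -/(f k _) => fk0.
  rewrite -[LHS]fineK ?fk0//.
  apply: integrable_fin_num => //.
  apply: le_integrable ig1 => //.
    by apply/measurable_EFinP; apply: measurable_funM => //; exact: measurable_bump.
  move=> x _; rewrite patchE; case: ifPn => [_|/negP]; last first.
    by rewrite inE => nx; rewrite /f bump_eq0// mulr0.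
  rewrite /= lee_fin normrM -[leRHS]mulr1 ler_wpM2l// ger0_norm ?bump_ge0//.
  exact: bump_le1.
move/(cvg_unique (@ereal_hausdorff R)) => /(_ _ (@cvg_cst _ (0%E : \bar R) _ _ _)) h0.
rewrite integral_mkcond -[RHS]h0//.
by apply: eq_integral => x _; rewrite Eh.
Qed.

(** The fundamental lemma of the calculus of variations, with bumps as the only test functions.
    Boxes are stable under intersection and generate the sigma-algebra, so a Dynkin argument makes
    the integral of [g] vanish on every measurable part of each [E k]. *)
Lemma ae_eq0_bump : {ae mu, forall x, g x = 0}.
Proof.
pose E (k : nat) : set T := obox (fun=> - k%:R) (fun=> k%:R).
have mE k : measurable (E k) by exact: measurable_obox.
have iE k : mu.-integrable (E k) (EFin \o g) by exact: ig.
have H k A : measurable A -> (\int[mu]_(x in E k `&` A) (g x)%:E = 0)%E.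
  rewrite measurable_obox_gen; move: A.
  apply: (@dynkin_induction _ _ G (fun A => \int[mu]_(x in E k `&` A) (g x)%:E = 0)%E).
  - exact: measurable_obox_gen.
  - by move=> _ _ [ab _ <-] [ab' _ <-]; rewrite oboxI; eexists (_, _).
  - by rewrite setIT integral_obox_eq0.
  - by move=> _ [ab _ <-]; rewrite oboxI integral_obox_eq0.
  - move=> S mS iS.
    have : (\int[mu]_(x in E k) (g x)%:E = 0)%E by rewrite integral_obox_eq0.
    rewrite -[in X in X -> _](setUIDK (E k) S) integral_setU//.
    + by rewrite iS add0e setDE.
    + exact: measurableI.
    + exact: measurableD.
    + by rewrite setUIDK; exact: measurable_int (iE k).
    + by apply/disj_setPS => x [[_ Sx] [_ /(_ Sx)]].
  - move=> F mF tF F0; rewrite setI_bigcupr integral_bigcup//.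
    + by rewrite eseries0.
    + exact: trivIset_setIl.
    + by move=> n; exact: measurableI.
    + rewrite -setI_bigcupr; apply: integrableS (iE k) => //.
      by apply: measurableI => //; exact: bigcupT_measurable.
have gE k : {ae mu, forall x, E k x -> g x = 0}.
  have : ae_eq mu (E k) (EFin \o g) (cst 0%E).
    apply: integral_ae_eq => // A AE mA; rewrite integral0.
    by have := H k A mA; rewrite (setIidr AE).
  by apply: filterS => x h /h [].
have : {ae mu, forall x, forall k, E k x -> g x = 0} by exact/ae_foralln.
apply: filterS => x Hx.
have [k _ xk] : (\bigcup_k E k) x by rewrite obox_cover.
exact: Hx xk.
Qed.

End null.

Section smooth_class.
Variables (R : realType) (V : normedModType R).
Implicit Types (f g l : V -> R) (x v : V).

Definition affine_form l : Prop := continuous l /\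
  forall v, exists s : R, forall x (h : R), l (h *: v + x) = h * s + l x.

(* A class of functions containing the bumps and stable under directional
   derivatives: [theta k]' is a combination of [theta k.+1] and [theta k.+2]. *)
Inductive theta_class : (V -> R) -> Prop :=
| theta_class_theta k l : affine_form l -> theta_class (fun x => theta k (l x))
| theta_class_cst c : theta_class (fun=> c)
| theta_classD f g : theta_class f -> theta_class g -> theta_class (fun x => f x + g x)
| theta_classM f g : theta_class f -> theta_class g -> theta_class (fun x => f x * g x).

Lemma theta_continuous k : continuous (@theta R k).
Proof.
move=> x; apply: differentiable_continuous; apply/derivable1_diffP.
by case: (is_derive_theta k x).
Qed.

Lemma theta_class_continuous f : theta_class f -> continuous f.
Proof.
elim=> [k l [cl _]|c|{}f g _ cf _ cg|{}f g _ cf _ cg] x.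
- by apply: (@continuous_comp _ _ _ l (theta k)); [exact: cl|exact: theta_continuous].
- exact: cvg_cst.
- exact: cvgD (cf x) (cg x).
- exact: cvgM (cf x) (cg x).
Qed.

Lemma is_derive_affine_comp (F : R -> R) l x v (s d : R) :
  (forall x (h : R), l (h *: v + x) = h * s + l x) ->
  is_derive (l x) 1 F d -> is_derive x v (fun y => F (l y)) (s * d).
Proof.
move=> ls dF; apply/is_derive_line.
rewrite (_ : (fun h => _) = F \o (fun h : R => h * s + l x)); last first.
  by apply/funext => h /=; rewrite ls.
rewrite mulrC; apply: is_derive1_comp; first by rewrite mul0r add0r.
have h1 : is_derive (0 : R) 1 (fun h : R => s * h) s.
  have := @is_deriveZ R R R (fun h : R => h) s 0 1 1 (is_derive_id _ _).
  by move=> h; apply: is_derive_eq h _; rewrite /GRing.scale /= mulr1.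
have h2 := is_deriveD h1 (is_derive_cst (l x) (0 : R) (1 : R)).
rewrite (_ : (fun _ => _) = (fun h : R => s * h) + cst (l x)).
  by apply: is_derive_eq h2 _; rewrite addr0.
by apply/funext => h; rewrite fctE /= mulrC.
Qed.

Lemma theta_class_derive f v : theta_class f ->
  exists2 f', theta_class f' & forall x, is_derive x v f (f' x).
Proof.
elim=> [k l al|c|{}f g _ [f' sf df] _ [g' sg dg]|{}f g tf [f' sf df] tg [g' sg dg]].
- have [s ls] := al.2 v.
  exists (fun x => s * (- k%:R * theta k.+1 (l x) + theta k.+2 (l x))).
    apply: theta_classM; first exact: theta_class_cst.
    apply: theta_classD; last exact: theta_class_theta.
    by apply: theta_classM; [exact: theta_class_cst|exact: theta_class_theta].
  move=> x; apply: is_derive_affine_comp => //; exact: is_derive_theta.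
- exists (fun=> 0); first exact: theta_class_cst.
  by move=> x; exact: is_derive_cst.
- exists (fun x => f' x + g' x); first exact: theta_classD.
  by move=> x; exact: is_deriveD.
- exists (fun x => f x * g' x + g x * f' x).
    by apply: theta_classD; apply: theta_classM.
  by move=> x; exact: is_deriveM.
Qed.

(** All iterated directional derivatives stay in the class, whose members are continuous and
    differentiable in every direction. *)
Lemma theta_class_smooth f : theta_class f -> smooth f.
Proof.
move=> tf s /=.
have tpsi : theta_class (foldr (fun v h => 'D_v h) f s).
  elim: s => //= v s ih.
  have [f' tf' df'] := theta_class_derive v ih.
  rewrite (_ : 'D_v _ = f') //; apply/funext => x.
  exact: (derive_val (is_derive := df' x)).
split; first exact: theta_class_continuous.
by move=> x v; have [f' _ /(_ x)[]] := theta_class_derive v tpsi.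
Qed.

Lemma theta_class_prod (I : Type) (s : seq I) (F : I -> V -> R) :
  (forall i, theta_class (F i)) -> theta_class (fun x => \prod_(i <- s) F i x).
Proof.
move=> tF; elim: s => [|i s ih].
  rewrite (_ : (fun _ => _) = (fun=> 1)); first exact: theta_class_cst.
  by apply/funext => x; rewrite big_nil.
rewrite (_ : (fun _ => _) = (fun x => F i x * \prod_(j <- s) F j x)).
  exact: theta_classM.
by apply/funext => x; rewrite big_cons.
Qed.

Lemma theta_class_test f (K : set V) : theta_class f -> compact K ->
  (forall x, ~ K x -> f x = 0) -> test_function f.
Proof.
move=> tf cK fK; split; first exact: theta_class_smooth.
apply: (subclosed_compact _ cK); first exact: closed_closure.
have : closed K by apply: compact_closed => //; exact: norm_hausdorff.
move/closure_id => ->; apply: closure_subset => x /= /eqP fx.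
by apply: contrapT => nK; apply: fx; exact: fK.
Qed.

Lemma affine_form_comp l (p q : R) : affine_form l -> affine_form (fun x => p * l x + q).
Proof.
move=> [cl al]; split.
  by move=> x; apply: cvgD; [apply: cvgMr; exact: cl|exact: cvg_cst].
move=> v; have [s ls] := al v; exists (p * s) => x h.
by rewrite ls; ring.
Qed.

Lemma theta_class_bump (I : finType) (c : I -> V -> R) (a b : I -> R) k :
  (forall i, affine_form (c i)) -> theta_class (bump c a b k).
Proof.
move=> ac; apply: theta_class_prod => i; apply: theta_classM.
  rewrite (_ : (fun _ => _) = fun x => theta 0 (k.+1%:R * c i x + (- k.+1%:R * a i))).
    by apply: theta_class_theta; exact: affine_form_comp.
  by apply/funext => x; congr theta; ring.
rewrite (_ : (fun _ => _) = fun x => theta 0 (- k.+1%:R * c i x + (k.+1%:R * b i))).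
  by apply: theta_class_theta; exact: affine_form_comp.
by apply/funext => x; congr theta; ring.
Qed.

End smooth_class.

Section coordinates.
Variables (R : realType) (m n : nat).
Local Notation M := 'M[R]_(m, n).

Definition mx_coord (ij : 'I_m * 'I_n) (A : M) : R := A ij.1 ij.2.

Lemma continuous_entry i j : continuous (fun A : M => A i j).
Proof.
move=> A B /nbhs_ballP[e /= e0 eB]; apply/nbhs_ballP; exists e => //= A' [_ AA'].
by apply: eB; exact: AA'.
Qed.

Lemma affine_mx_coord ij : affine_form (mx_coord ij).
Proof.
split; first exact: continuous_entry.
by move=> v; exists (v ij.1 ij.2) => x h; rewrite /mx_coord !mxE.
Qed.

Lemma affine_form_fst (V W : normedModType R) (l : V -> R) :
  affine_form l -> affine_form (fun x : V * W => l x.1).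
Proof.
move=> [cl al]; split.
  move=> x; apply: (@continuous_comp _ _ _ (@fst V W) l); [exact: cvg_fst|exact: cl].
by move=> [v w]; have [s ls] := al v; exists s => x h; exact: ls.
Qed.

Lemma affine_form_snd (V W : normedModType R) (l : W -> R) :
  affine_form l -> affine_form (fun x : V * W => l x.2).
Proof.
move=> [cl al]; split.
  move=> x; apply: (@continuous_comp _ _ _ (@snd V W) l); [exact: cvg_snd|exact: cl].
by move=> [v w]; have [s ls] := al w; exists s => x h; exact: ls.
Qed.

Lemma measurable_mx_coord ij : measurable_fun setT (mx_coord ij).
Proof. exact: measurable_entry. Qed.

Lemma mx_coord_gen d' (S : measurableType d') (f : S -> M) :
  (forall ij, measurable_fun setT (mx_coord ij \o f)) -> measurable_fun setT f.
Proof. by move=> h; apply: measurable_fun_matrix => i j; exact: (h (i, j)). Qed.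

Lemma obox_mx_cball a b : exists k : nat,
  obox mx_coord a b `<=` [set A : M | `|A| <= k%:R].
Proof.
pose N := \sum_ij (`|a ij| + `|b ij|).
exists (Num.truncn N).+1 => A Aab /=.
apply: mx_norm_leP => // i j.
apply: le_trans (_ : N <= _); last by apply/ltW/truncnS_gt.
have /andP[/ltW h1 /ltW h2] := Aab (i, j).
have h3 : `|A i j| <= `|a (i, j)| + `|b (i, j)|.
  rewrite ler_norml; apply/andP; split.
    apply: le_trans h1.
    by rewrite -subr_ge0; have := ler_norm (- a (i, j)); rewrite normrN; have := normr_ge0 (b (i, j)); lra.
  by apply: (le_trans h2); have := ler_norm (b (i, j)); have := normr_ge0 (a (i, j)); lra.
by apply: (le_trans h3); rewrite /N (bigD1 (i, j))//= lerDl sumr_ge0.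
Qed.

End coordinates.

Section product_coordinates.
Variables (R : realType) (m n m' n' : nat).
Local Notation M := 'M[R]_(m, n).
Local Notation M' := 'M[R]_(m', n').
Local Notation V := (M * M')%type.

Definition prod_coord (s : ('I_m * 'I_n) + ('I_m' * 'I_n')) (x : V) : R :=
  match s with inl ij => mx_coord ij x.1 | inr ij => mx_coord ij x.2 end.

Lemma affine_prod_coord s : affine_form (prod_coord s).
Proof.
case: s => ij /=.
  by apply: (@affine_form_fst R M M' (mx_coord ij)); exact: affine_mx_coord.
by apply: (@affine_form_snd R M M' (mx_coord ij)); exact: affine_mx_coord.
Qed.

Lemma measurable_prod_coord s : measurable_fun setT (prod_coord s).
Proof.
case: s => ij /=.
  apply: (measurableT_comp (measurable_mx_coord ij)); exact: measurable_fst.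
apply: (measurableT_comp (measurable_mx_coord ij)); exact: measurable_snd.
Qed.

Lemma prod_coord_gen d' (S : measurableType d') (f : S -> V) :
  (forall s, measurable_fun setT (prod_coord s \o f)) -> measurable_fun setT f.
Proof.
move=> h; apply/measurable_fun_pairP; split; apply: mx_coord_gen => ij.
  exact: (h (inl ij)).
exact: (h (inr ij)).
Qed.

Lemma obox_prod_cbox a b : exists k : nat, obox prod_coord a b `<=` @cbox R m n m' n' k%:R.
Proof.
have [k1 h1] := @obox_mx_cball R m n (a \o inl) (b \o inl).
have [k2 h2] := @obox_mx_cball R m' n' (a \o inr) (b \o inr).
exists (maxn k1 k2) => x xab; split.
  apply: (@le_trans _ _ k1%:R); last by rewrite ler_nat leq_maxl.
  by apply: h1 => ij; exact: (xab (inl ij)).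
apply: (@le_trans _ _ k2%:R); last by rewrite ler_nat leq_maxr.
by apply: h2 => ij; exact: (xab (inr ij)).
Qed.

Lemma test_function_bump a b k : test_function (bump prod_coord a b k).
Proof.
have [N hN] := obox_prod_cbox a b.
apply: (@theta_class_test _ _ _ (@cbox R m n m' n' N%:R)).
- by apply: theta_class_bump; exact: affine_prod_coord.
- exact: compact_cbox.
- by move=> x nx; apply: bump_eq0 => xab; apply: nx; exact: hN.
Qed.

End product_coordinates.

(** * Real and imaginary parts, and uniqueness of weak derivatives *)

Section complex_parts.
Variable R : realType.
Implicit Types z w : R[i].
Local Notation Re := (@complex.Re R).
Local Notation Im := (@complex.Im R).

Lemma Re_mulr z (r : R) : Re (z * r%:C%C) = Re z * r.
Proof. by case: z => a b /=; rewrite mulr0 subr0. Qed.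

Lemma Im_mulr z (r : R) : Im (z * r%:C%C) = Im z * r.
Proof. by case: z => a b /=; rewrite mulr0 add0r. Qed.

Lemma normc_sq z : normc z ^+ 2 = Re z ^+ 2 + Im z ^+ 2.
Proof. by case: z => a b /=; rewrite sqr_sqrtr// addr_ge0// sqr_ge0. Qed.

Lemma normc_ge0' z : 0 <= normc z.
Proof. by case: z => a b /=; exact: sqrtr_ge0. Qed.

Lemma ler_Re_normc z : `|Re z| <= normc z.
Proof.
rewrite -(@ler_pXn2r _ 2)// ?nnegrE ?normc_ge0'// real_normK ?num_real//.
by rewrite normc_sq lerDl sqr_ge0.
Qed.

Lemma ler_Im_normc z : `|Im z| <= normc z.
Proof.
rewrite -(@ler_pXn2r _ 2)// ?nnegrE ?normc_ge0'// real_normK ?num_real//.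
by rewrite normc_sq lerDr sqr_ge0.
Qed.

Lemma normc_le_parts z : normc z <= `|Re z| + `|Im z|.
Proof.
rewrite -(@ler_pXn2r _ 2)// ?nnegrE ?normc_ge0' ?addr_ge0//.
rewrite normc_sq sqrrD !real_normK ?num_real// -addrA lerD2l lerDr.
by rewrite mulrn_wge0// mulr_ge0.
Qed.

Lemma Re_sum (I : Type) (s : seq I) (P : pred I) (F : I -> R[i]) :
  Re (\sum_(i <- s | P i) F i) = \sum_(i <- s | P i) Re (F i).
Proof. by apply: (big_morph Re) => // -[? ?] [? ?]. Qed.

Lemma Im_sum (I : Type) (s : seq I) (P : pred I) (F : I -> R[i]) :
  Im (\sum_(i <- s | P i) F i) = \sum_(i <- s | P i) Im (F i).
Proof. by apply: (big_morph Im) => // -[? ?] [? ?]. Qed.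

Lemma measurable_normc d (T : measurableType d) (f : T -> R[i]) :
  cmeasurable f -> measurable_fun setT (fun x => normc (f x)).
Proof.
move=> [mr mi].
rewrite (_ : (fun _ => _) = (fun x => Num.sqrt (Re (f x) ^+ 2 + Im (f x) ^+ 2))).
  apply: (measurableT_comp (f := @Num.sqrt R)).
    by apply: continuous_measurable_fun; exact: sqrt_continuous.
  by apply: measurable_funD; exact: measurable_funX.
by apply/funext => x; case: (f x).
Qed.

End complex_parts.

Section weak_derivative_parts.
Variables (R : realType) (n : nat).
Local Notation V := ('rV[R]_3 * 'M[R]_(n, 3))%type.
Variable mu : {measure set V -> \bar R}.
Implicit Types (v : V) (f g : V -> R[i]).

(** Only the integration by parts identity; local integrability is kept apart so that the real and
    imaginary parts can share it. *)
Definition real_weak_derivative v (f g : V -> R) : Prop :=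
  forall phi : V -> R, test_function phi ->
    \int[mu]_x (f x * 'D_v phi x) = - \int[mu]_x (g x * phi x).

(** Test functions are real, so the complex identity splits into two real ones. *)
Lemma is_weak_derivativeP v f g : is_weak_derivative mu v f g <->
  [/\ L1_on mu compact f, L1_on mu compact g,
    real_weak_derivative v (fun x => complex.Re (f x)) (fun x => complex.Re (g x)) &
    real_weak_derivative v (fun x => complex.Im (f x)) (fun x => complex.Im (g x))].
Proof.
have E (h : V -> R[i]) (psi : V -> R) : cintegral mu (fun x => h x * (psi x)%:C%C) =
    Complex (\int[mu]_x (complex.Re (h x) * psi x)) (\int[mu]_x (complex.Im (h x) * psi x)).
  by congr Complex; apply: eq_Rintegral => x _; rewrite ?Re_mulr ?Im_mulr.
split=> [[L1f L1g fg]|[L1f L1g fgr fgi]]; split => // phi tphi.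
- by have := fg _ tphi; rewrite !E => -[].
- by have := fg _ tphi; rewrite !E => -[].
- by rewrite !E fgr// fgi.
Qed.

Lemma L1_on_integrable f : L1_on mu compact f -> forall K, compact K ->
  mu.-integrable K (fun x => (complex.Re (f x))%:E) /\
  mu.-integrable K (fun x => (complex.Im (f x))%:E).
Proof.
move=> [mf fi] K cK; have mK := compact_measurable_prod cK.
have mn := measurable_normc mf; case: mf => mr mi.
have mF (h : V -> R) : measurable_fun setT h ->
    measurable_fun K (fun x => (h x)%:E : \bar R).
  by move=> mh; apply: (@measurable_funS _ _ _ _ setT) => //; apply/measurable_EFinP.
split; (apply/integrableP; split; first exact: mF);
  apply: le_lt_trans (fi K cK); apply: ge0_le_integral => //.
- by apply: mF; exact: measurableT_comp.
- exact: mF.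
- by move=> x _; rewrite lee_fin ler_Re_normc.
- by apply: mF; exact: measurableT_comp.
- exact: mF.
- by move=> x _; rewrite lee_fin ler_Im_normc.
Qed.

Lemma compact_support_Rintegral (K : set V) (g phi : V -> R) : compact K ->
  mu.-integrable K (EFin \o g) -> measurable_fun setT g -> measurable_fun setT phi ->
  (exists M : R, forall x, `|phi x| <= M) -> (forall x, ~ K x -> phi x = 0) ->
  mu.-integrable setT (fun x => (g x * phi x)%:E).
Proof.
move=> cK ig mg mphi [M phiM] phi0; have mK := compact_measurable_prod cK.
have igK : mu.-integrable setT ((EFin \o g) \_ K) by apply/(integrable_mkcond _ mK).1.
apply: le_integrable (integrableZl measurableT M igK) => //.
  by apply/measurable_EFinP; exact: measurable_funM.
move=> x _; rewrite patchE; case: ifPn => [_|/negP]; last first.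
  by rewrite inE => /phi0 ->; rewrite mulr0 mule0.
rewrite -[(EFin \o g) x]/((g x)%:E) -EFinM /= lee_fin !normrM mulrC ler_wpM2r//.
by apply: le_trans (phiM x) _; exact: ler_norm.
Qed.

(** Bumps on boxes are test functions, so the difference of two weak derivatives is orthogonal to
    all of them and [ae_eq0_bump] applies. *)
Lemma real_weak_derivative_unique v (f g1 g2 : V -> R) :
  measurable_fun setT g1 -> measurable_fun setT g2 ->
  (forall K, compact K -> mu.-integrable K (EFin \o g1)) ->
  (forall K, compact K -> mu.-integrable K (EFin \o g2)) ->
  real_weak_derivative v f g1 -> real_weak_derivative v f g2 ->
  {ae mu, forall x, g1 x = g2 x}.
Proof.
move=> mg1 mg2 ig1 ig2 fg1 fg2.
have mg : measurable_fun setT (g1 \- g2) by exact: measurable_funB.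
have ig K : compact K -> mu.-integrable K (EFin \o (g1 \- g2)).
  move=> cK; have := integrableB (compact_measurable_prod cK) (ig1 K cK) (ig2 K cK).
  by apply: eq_integrable => //; exact: compact_measurable_prod.
suff : {ae mu, forall x, (g1 \- g2) x = 0}.
  by apply: filterS => x /eqP; rewrite subr_eq0 => /eqP.
apply: (@ae_eq0_bump _ V R mu _ (@prod_coord R 1 3 n 3) (@measurable_prod_coord _ _ _ _ _) (@prod_coord_gen _ _ _ _ _) _ mg).
  move=> a b; have [N hN] := obox_prod_cbox a b.
  apply: (integrableS (measurable_cbox _) _ hN (ig _ (@compact_cbox _ _ _ _ _ N%:R))).
  by apply: measurable_obox; exact: measurable_prod_coord.
move=> a b k; have [N hN] := obox_prod_cbox a b.
have tb := test_function_bump a b k.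
have bi (g : V -> R) : measurable_fun setT g -> (forall K, compact K -> mu.-integrable K (EFin \o g)) ->
    mu.-integrable setT (fun x => (g x * bump (@prod_coord R 1 3 n 3) a b k x)%:E).
  move=> mg' ig'; apply: (@compact_support_Rintegral (@cbox R 1 3 n 3 N%:R)) => //.
  - exact: compact_cbox.
  - by apply: ig'; exact: compact_cbox.
  - by apply: measurable_bump; exact: measurable_prod_coord.
  - by exists 1 => x; rewrite ger0_norm ?bump_ge0// bump_le1.
  - by move=> x nx; apply: bump_eq0 => xab; apply: nx; exact: hN.
under eq_Rintegral do rewrite mulrBl.
rewrite RintegralB//; [|exact: bi|exact: bi].
by apply/eqP; rewrite subr_eq0 -eqr_opp -fg1// -fg2.
Qed.

Lemma is_weak_derivative_unique v f g1 g2 :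
  is_weak_derivative mu v f g1 -> is_weak_derivative mu v f g2 ->
  {ae mu, forall x, g1 x = g2 x}.
Proof.
move=> /is_weak_derivativeP[_ L1 r1 i1] /is_weak_derivativeP[_ L2 r2 i2].
have R1 := @real_weak_derivative_unique _ _ _ _ L1.1.1 L2.1.1
  (fun K cK => (L1_on_integrable L1 cK).1) (fun K cK => (L1_on_integrable L2 cK).1) r1 r2.
have I1 := @real_weak_derivative_unique _ _ _ _ L1.1.2 L2.1.2
  (fun K cK => (L1_on_integrable L1 cK).2) (fun K cK => (L1_on_integrable L2 cK).2) i1 i2.
apply: filterS2 R1 I1 => x.
by case: (g1 x) => a b; case: (g2 x) => a' b' /= -> ->.
Qed.

End weak_derivative_parts.

(** * Translation invariance *)

Section measure_preserving.
Context d (T : measurableType d) (R : realType).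
Implicit Types (m : {measure set T -> \bar R}) (t : T -> T).

Definition measure_preserving m t : Prop := measurable_fun setT t /\
  forall A, measurable A -> m (t @^-1` A) = m A.

Lemma ge0_integral_preserving m t (f : T -> \bar R) : measure_preserving m t ->
  measurable_fun setT f -> (forall x, 0 <= f x)%E ->
  (\int[m]_x f (t x) = \int[m]_x f x)%E.
Proof.
move=> [mt tm] mf f0.
rewrite -[LHS]/(\int[m]_(x in t @^-1` setT) (f \o t) x)%E.
rewrite -ge0_integral_pushforward//.
by apply: eq_measure_integral => A mA _; exact: tm.
Qed.

Lemma Rintegral_preserving m t (f : T -> R) : measure_preserving m t ->
  measurable_fun setT f -> \int[m]_x f (t x) = \int[m]_x f x.
Proof.
move=> pt mf; congr fine; rewrite integralE [in RHS]integralE.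
have mf' : measurable_fun setT (EFin \o f) by exact/measurable_EFinP.
congr (_ - _)%E.
  rewrite -(ge0_integral_preserving pt (f := ((EFin \o f)^\+)%E))//.
    by apply: eq_integral => x _; rewrite !funeposE.
  exact: measurable_funepos.
rewrite -(ge0_integral_preserving pt (f := ((EFin \o f)^\-)%E))//.
  by apply: eq_integral => x _; rewrite !funenegE.
exact: measurable_funeneg.
Qed.

End measure_preserving.

Section product_preserving.
Context d1 d2 (T1 : measurableType d1) (T2 : measurableType d2) (R : realType).
Variables (m1 : {sigma_finite_measure set T1 -> \bar R})
  (m2 : {sigma_finite_measure set T2 -> \bar R}).

(** Computed on sections: [t2] preserves the measure of each section, and [t1] the integral of these
    measures. *)
Lemma measure_preserving_prod t1 t2 : measure_preserving m1 t1 ->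
  measure_preserving m2 t2 ->
  measure_preserving (m1 \x m2)%E (fun p => (t1 p.1, t2 p.2)).
Proof.
move=> p1 [mt2 tm2].
have mt : measurable_fun setT (fun p : T1 * T2 => (t1 p.1, t2 p.2)).
  apply/measurable_fun_pairP; split.
    by apply: (measurableT_comp p1.1); exact: measurable_fst.
  by apply: (measurableT_comp mt2); exact: measurable_snd.
split => // X mX.
transitivity (\int[m1]_x (m2 \o xsection X) (t1 x))%E.
  apply: eq_integral => x _ /=.
  rewrite -(tm2 (xsection X (t1 x))); last exact: measurable_xsection.
  by congr (m2 _); apply/seteqP; split => y; rewrite /xsection /= !inE.
rewrite (ge0_integral_preserving p1)//; exact: measurable_fun_xsection.
Qed.

End product_preserving.

Section lebesgue_translation.
Variable R : realType.

(** The translated measure agrees with Lebesgue measure on half-open intervals, which determine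
    it. *)
Lemma lebesgue_translation (h : R) :
  measure_preserving (@lebesgue_measure R) (fun x => x + h).
Proof.
have mh : measurable_fun setT (fun x : R => x + h) by exact: measurable_funD.
split => // A mA.
have := @lebesgue_measure_unique R (pushforward lebesgue_measure
  ((fun x => x + h) : measurableTypeR R -> measurableTypeR R)).
move=> H; rewrite [RHS](H mh)// => _ [[a b] _ <-].
transitivity (lebesgue_measure (`]a - h, b - h]%classic : set R)); last first.
  congr lebesgue_measure.
  by apply/seteqP; split => x /=; rewrite !in_itv /= ltrBlDr lerBrDr.
rewrite !lebesgue_measure_itv /= !lte_fin ltrD2r.
by case: ifPn => // ab; rewrite -!EFinB; congr EFin; ring.
Qed.

(** By induction on the dimension: [rV_cons] turns a translation into the product of a translation
    of R and one of the remaining coordinates. In dimension 0 the space is a point. *)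
Lemma lebesgue_rV_translation n (h : 'rV[R]_n) :
  measure_preserving (lebesgue_rV R n) (fun v => v + h).
Proof.
have mh k (u : 'rV[R]_k) : measurable_fun setT (fun v : 'rV[R]_k => v + u).
  apply: measurable_fun_matrix => i j; under eq_fun do rewrite mxE.
  by apply: measurable_funD => //; exact: measurable_entry.
elim: n h => [|n ih] h.
  split => [|A mA]; first exact: mh.
  suff -> : (fun v : 'rV[R]_0 => v + h) @^-1` A = A by [].
  by apply/seteqP; split => x /=; rewrite [x + h]thinmx0 [x]thinmx0.
split => [|A mA]; first exact: mh.
pose h1 := (rV_uncons h).1; pose h2 := (rV_uncons h).2.
have [_ P] := measure_preserving_prod (lebesgue_translation h1) (ih h2).
have mc : measurable (@rV_cons R n @^-1` A).
  by rewrite -[X in measurable X]setTI; exact: measurable_rV_cons.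
rewrite -[RHS]/((lebesgue_measure \x lebesgue_rV R n)%E (@rV_cons R n @^-1` A)).
rewrite -P//.
rewrite -[LHS]/((lebesgue_measure \x lebesgue_rV R n)%E
   (@rV_cons R n @^-1` ((fun v => v + h) @^-1` A))).
congr ((_ \x _)%E _); apply/seteqP.
have E p : rV_cons p + h = rV_cons (p.1 + h1, p.2 + h2).
  apply/rowP => j; rewrite mxE; case: (@split_ordP 1 n j) => k ->.
    rewrite /rV_cons !(@row_mxEl R 1 1 n) !mxE !ord1 eqxx !mulr1n.
    by congr (_ + h _ _); apply/val_inj.
  by rewrite /rV_cons !(@row_mxEr R 1 1 n) !mxE.
by split => p /=; rewrite E.
Qed.

(** Strict bounds on the entries factor under [rV_cons] and [mx_cons], so measures of cubes are
    accessible by induction on the dimension; balls are then compared with cubes. *)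
Definition cube (m n : nat) (e : R) : set 'M[R]_(m, n) := [set A | forall i j, `|A i j| < e].
Arguments cube : clear implicits.

Lemma measurable_cube m n e : measurable (cube m n e).
Proof.
rewrite (_ : cube m n e = obox (@mx_coord R m n) (fun=> - e) (fun=> e)).
  by apply: measurable_obox; exact: measurable_mx_coord.
apply/seteqP; split => A; first by move=> Ae [i j]; rewrite -ltr_norml; exact: Ae.
by move=> Ae i j; rewrite ltr_norml; exact: (Ae (i, j)).
Qed.

(** Finiteness makes bounded functions of bounded support integrable; positivity allows the
    mollifiers to be normalized. *)
Lemma lebesgue_rV_cube n (e : R) : 0 < e ->
  (0 < lebesgue_rV R n (cube 1 n e) < +oo)%E.
Proof.
move=> e0; elim: n => [|n ih].
  rewrite /= diracE mem_set ?lte01 ?ltry// => i [].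
  by case.
rewrite -[lebesgue_rV R n.+1 _]/((lebesgue_measure \x lebesgue_rV R n)%E
   (@rV_cons R n @^-1` cube 1 n.+1 e)).
have -> : @rV_cons R n @^-1` cube 1 n.+1 e = `]- e, e[%classic `*` cube 1 n e.
  apply/seteqP; split => [[x v]|[x v] [/= xe ve]] /=.
    move=> xv; split => /=.
      rewrite in_itv /= -ltr_norml; have := xv ord0 (lshift n (ord0 : 'I_1)).
      by rewrite /rV_cons (@row_mxEl R 1 1 n) mxE.
    move=> i j; have := xv i (rshift 1 j).
    by rewrite /rV_cons (@row_mxEr R 1 1 n).
  move=> i j; case: (@split_ordP 1 n j) => k ->.
    rewrite /rV_cons (@row_mxEl R 1 1 n) mxE !ord1 eqxx mulr1n ltr_norml.
    by rewrite in_itv /= in xe.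
  by rewrite /rV_cons (@row_mxEr R 1 1 n); exact: ve.
rewrite product_measure1E//; last exact: measurable_cube.
have Ee : lebesgue_measure (`]- e, e[%classic : set R) = (2 * e)%:E.
  rewrite lebesgue_measure_itv /= lte_fin gtrN// -EFinB; congr EFin; ring.
have /andP[h1 h2] := ih.
suff : (0 < (2 * e)%:E * lebesgue_rV R n (cube 1 n e) < +oo)%E by rewrite -Ee.
apply/andP; split.
  by rewrite mule_gt0// lte_fin mulr_gt0.
by rewrite lte_mul_pinfty// lee_fin mulr_ge0// ltW.
Qed.

Lemma lebesgue_mx_cube m n (e : R) : 0 < e -> (lebesgue_mx R m n (cube n m e) < +oo)%E.
Proof.
move=> e0; elim: n => [|n ih].
  by rewrite /= diracE mem_set ?ltry// => -[].
rewrite -[lebesgue_mx R m n.+1 _]/((lebesgue_rV R m \x lebesgue_mx R m n)%E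
   (@mx_cons R m n @^-1` cube n.+1 m e)).
apply: (@le_lt_trans _ _ ((lebesgue_rV R m \x lebesgue_mx R m n)%E (cube 1 m e `*` cube n m e))).
  apply: le_measure.
  - rewrite inE -[X in measurable X]setTI; apply: measurable_mx_cons => //.
    exact: measurable_cube.
  - by rewrite inE; apply: measurableX; exact: measurable_cube.
  - move=> [u A] /= uA; split => i j /=.
      by have := uA (lshift n i) j; rewrite /mx_cons (@col_mxEu R 1 n m).
    by have := uA (rshift 1 i) j; rewrite /mx_cons (@col_mxEd R 1 n m).
rewrite product_measure1E//; [|exact: measurable_cube|exact: measurable_cube].
have /andP[h1 h2] := lebesgue_rV_cube m e0.
by rewrite lte_mul_pinfty// ge0_fin_numE.
Qed.

Lemma cball_sub_cube m n (M : R) : [set A : 'M[R]_(m, n) | `|A| <= M] `<=` cube m n (M + 1).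
Proof.
by move=> A /= AM i j; rewrite (le_lt_trans (mx_norm_entry A i j))// (le_lt_trans AM)// ltrDl.
Qed.

Lemma lebesgue_rV_cball n (M : R) : (lebesgue_rV R n [set v | (`|v| <= M)%R] < +oo)%E.
Proof.
have [M0|M0] := ltP M 0.
  rewrite (_ : [set v : 'rV[R]_n | _] = set0) ?measure0 ?ltry//.
  by apply/seteqP; split => // v /= vM; have := lt_le_trans M0 (le_trans (normr_ge0 v) vM); rewrite ltxx.
have M1 : 0 < M + 1 by rewrite ltr_wpDl.
have /andP[_] := lebesgue_rV_cube n M1; apply: le_lt_trans.
by apply: le_measure; rewrite ?inE; [exact: measurable_cball_mx|exact: measurable_cube|exact: cball_sub_cube].
Qed.

Lemma lebesgue_mx_cball m n (M : R) : (lebesgue_mx R m n [set v | (`|v| <= M)%R] < +oo)%E.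
Proof.
have [M0|M0] := ltP M 0.
  rewrite (_ : [set v : 'M[R]_(n, m) | _] = set0) ?measure0 ?ltry//.
  by apply/seteqP; split => // v /= vM; have := lt_le_trans M0 (le_trans (normr_ge0 v) vM); rewrite ltxx.
have M1 : 0 < M + 1 by rewrite ltr_wpDl.
have := lebesgue_mx_cube m n M1; apply: le_lt_trans.
by apply: le_measure; rewrite ?inE; [exact: measurable_cball_mx|exact: measurable_cube|exact: cball_sub_cube].
Qed.

End lebesgue_translation.

(** * Mollification *)

Section dominated_squares.
Context d (T : measurableType d) (R : realType) (m : {measure set T -> \bar R}).

Lemma sqint_dominated (g : nat -> T -> R) (f h : T -> R) :
  (forall j, measurable_fun setT (g j)) -> measurable_fun setT f -> Lsq m h ->
  (forall j x, `|f x - g j x| <= `|h x|) -> (forall x, g ^~ x @ \oo --> f x) ->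
  ecvg0 (fun j => sqint m (fun x => f x - g j x)).
Proof.
move=> mg mf [mh hi] fgh gf; apply: ecvg0_cvg.
have [] := @dominated_convergence _ _ _ m setT measurableT
   (fun j x => ((f x - g j x) ^+ 2)%:E) (cst 0%E) (fun x => ((h x) ^+ 2)%:E).
- by move=> j; apply: measurable_sqE; exact: measurable_funB.
- exact: measurable_cst.
- apply: aeW => x _; apply: cvg_EFin; first exact: nearW.
  have h0 : f x - g j x @[j --> \oo] --> (0 : R).
    by rewrite -(subrr (f x)); apply: cvgB; [exact: cvg_cst|exact: gf].
  rewrite (_ : fine \o _ = (fun j => f x - g j x) \* (fun j => f x - g j x)).
    by rewrite -[X in _ --> X](mulr0 0); exact: cvgM.
  by apply/funext => j /=; rewrite expr2.
- apply/integrableP; split; first exact: measurable_sqE.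
  by under eq_integral do rewrite gee0_abs ?lee_fin ?sqr_ge0//.
- apply: aeW => x j _; rewrite /= lee_fin ger0_norm ?sqr_ge0//.
  rewrite -[X in X <= _]real_normK ?num_real// -[X in _ <= X]real_normK ?num_real//.
  by rewrite lerXn2r ?nnegrE.
by move=> _ _; rewrite integral0.
Qed.

End dominated_squares.

Section convolution.
Variables (R : realType) (N : nat).
Local Notation V := 'rV[R]_N.
Local Notation mu := (lebesgue_rV R N).
Implicit Types (f g phi : V -> R) (r s : V).

Definition bounded_support phi : Prop := measurable_fun setT phi /\
  exists2 M : R, (forall x, `|phi x| <= M) & (forall x, M < `|x| -> phi x = 0).

Definition cball (M : R) : set V := [set x | `|x| <= M].

Lemma measurable_cball M : measurable (cball M).
Proof. exact: measurable_cball_mx. Qed.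

Lemma Lsq_indic (A : set V) M : measurable A -> A `<=` cball M -> Lsq mu (\1_A).
Proof.
move=> mA AM; split; first exact: measurable_indic.
apply: (@le_lt_trans _ _ (mu (cball M))); last exact: lebesgue_rV_cball.
rewrite -(setIT (cball M)) -integral_indic//; last exact: measurable_cball.
apply: ge0_le_integral => //.
- by apply: measurable_sqE; exact: measurable_indic.
- by apply/measurable_EFinP; apply: measurable_indic; exact: measurable_cball.
- move=> x _; rewrite lee_fin !indicE; case: (boolP (x \in A)) => xA.
    by rewrite expr1n mem_set//; apply: AM; rewrite -inE.
  by rewrite expr0n.
Qed.

Lemma bounded_support_Lsq phi : bounded_support phi -> Lsq mu phi.
Proof.
move=> [mphi [M phiM phi0]].
have L1 := LsqZ M (Lsq_indic (measurable_cball M) (@subset_refl _ _)).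
apply: le_Lsq L1 => // x; rewrite indicE; case: (boolP (x \in cball M)) => xM.
  by rewrite mulr1; apply: le_trans (phiM x) _; exact: ler_norm.
rewrite phi0 ?normr0//; move: xM; apply: contraR; rewrite -leNgt => xM.
by rewrite inE.
Qed.

Lemma bounded_supportB phi psi : bounded_support phi -> bounded_support psi ->
  bounded_support (fun x => phi x - psi x).
Proof.
move=> [mphi [M phiM phi0]] [mpsi [M' psiM psi0]]; split.
  exact: measurable_funB.
have M0 : 0 <= M by apply: le_trans (phiM 0).
have M'0 : 0 <= M' by apply: le_trans (psiM 0).
exists (M + M') => x; last first.
  move=> Mx; rewrite phi0 ?psi0 ?subrr//; apply: le_lt_trans Mx.
    by rewrite lerDr.
  by rewrite lerDl.
by rewrite (le_trans (ler_normB _ _))// lerD.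
Qed.

Lemma measurable_reflect r : measurable_fun setT (fun s : V => r - s).
Proof.
apply: measurable_fun_matrix => i j; under eq_fun do rewrite !mxE.
by apply: measurable_funB => //; exact: measurable_entry.
Qed.

Lemma measurable_diff : measurable_fun setT (fun p : V * V => p.1 - p.2).
Proof.
apply: measurable_fun_matrix => i j; under eq_fun do rewrite !mxE.
apply: measurable_funB.
  by apply: (measurableT_comp (measurable_entry i j)); exact: measurable_fst.
by apply: (measurableT_comp (measurable_entry i j)); exact: measurable_snd.
Qed.

Lemma bounded_support_reflect phi r : bounded_support phi ->
  bounded_support (fun s => phi (r - s)).
Proof.
move=> [mphi [M phiM phi0]]; split.
  exact: (measurableT_comp mphi (measurable_reflect r)).
exists (M + `|r|) => [s|s Ms].
  by apply: le_trans (phiM _) _; rewrite lerDl.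
apply: phi0; rewrite -(ltrD2r `|r|); apply: lt_le_trans Ms _.
have {1}-> : s = - (r - s) + r by rewrite opprB subrK.
by rewrite (le_trans (ler_normD _ _))// normrN.
Qed.

(** For [f] in L^2 and [phi] bounded with bounded support the integral converges at every [r], not
    merely almost everywhere; this is what allows evaluation on the diagonal. *)
Definition conv f phi : V -> R := fun r => \int[mu]_s (f s * phi (r - s)).

Lemma bounded_support_shift phi s : bounded_support phi ->
  bounded_support (fun r => phi (r - s)).
Proof.
move=> [mphi [M phiM phi0]]; split.
  apply: (measurableT_comp mphi); apply: measurable_fun_matrix => i j.
  under eq_fun do rewrite !mxE.
  by apply: measurable_funD => //; exact: measurable_entry.
exists (M + `|s|) => [r|r Ms].
  by apply: le_trans (phiM _) _; rewrite lerDl.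
apply: phi0; rewrite -(ltrD2r `|s|); apply: lt_le_trans Ms _.
by rewrite -{1}(subrK s r) (le_trans (ler_normD _ _)).
Qed.

Lemma conv_integrable f phi r : Lsq mu f -> bounded_support phi ->
  mu.-integrable setT (fun s => (f s * phi (r - s))%:E).
Proof.
move=> Lf bphi; apply: integrable_Lsq_mul => //; apply: bounded_support_Lsq.
exact: bounded_support_reflect.
Qed.

Lemma measurable_conv f phi : measurable_fun setT f -> measurable_fun setT phi ->
  measurable_fun setT (conv f phi).
Proof.
move=> mf mphi; apply: (measurable_Rintegral1 mu
  (f := fun p : V * V => f p.2 * phi (p.1 - p.2))).
apply: measurable_funM.
  by apply: (measurableT_comp mf); exact: measurable_snd.
exact: (measurableT_comp mphi measurable_diff).
Qed.

Lemma convD f g phi r : Lsq mu f -> Lsq mu g -> bounded_support phi ->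
  conv (fun x => f x + g x) phi r = conv f phi r + conv g phi r.
Proof.
move=> Lf Lg bphi; rewrite /conv -RintegralD//; [|exact: conv_integrable|exact: conv_integrable].
by apply: eq_Rintegral => s _; rewrite mulrDl.
Qed.

Lemma convZ c f phi r : Lsq mu f -> bounded_support phi ->
  conv (fun x => c * f x) phi r = c * conv f phi r.
Proof.
move=> Lf bphi; rewrite /conv -RintegralZl//; last exact: conv_integrable.
by apply: eq_Rintegral => s _; rewrite mulrA.
Qed.

Lemma convB f g phi r : Lsq mu f -> Lsq mu g -> bounded_support phi ->
  conv (fun x => f x - g x) phi r = conv f phi r - conv g phi r.
Proof.
move=> Lf Lg bphi; rewrite /conv -RintegralB//; [|exact: conv_integrable|exact: conv_integrable].
by apply: eq_Rintegral => s _; rewrite mulrBl.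
Qed.

(** Evenness trades the reflection in a convolution for a translation, so that translation
    invariance of the measure is enough. *)
Definition mollifier (eta : V -> R) : Prop := [/\ bounded_support eta,
  (forall x, 0 <= eta x), (forall x, eta (- x) = eta x) & \int[mu]_x eta x = 1].

Lemma mollifier_int_reflect eta r : mollifier eta -> \int[mu]_s eta (r - s) = 1.
Proof.
move=> [[meta _] _ eta_even eta1].
under eq_Rintegral do rewrite -eta_even opprB.
by rewrite (Rintegral_preserving (lebesgue_rV_translation (- r)) meta).
Qed.

Lemma bounded_support_integrable phi : bounded_support phi ->
  mu.-integrable setT (EFin \o phi).
Proof.
move=> bphi; have [mphi [M phiM phi0]] := bphi.
have Li := Lsq_indic (measurable_cball M) (@subset_refl _ _).
have := integrable_Lsq_mul Li (bounded_support_Lsq bphi).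
apply: eq_integrable => // x _; rewrite /= indicE.
case: (boolP (x \in cball M)) => xM; first by rewrite mul1r.
rewrite phi0 ?mulr0//; move: xM; apply: contraR; rewrite -leNgt => xM.
by rewrite inE.
Qed.

Lemma mollifier_int_reflectE eta r : mollifier eta ->
  (\int[mu]_s (eta (r - s))%:E = 1)%E.
Proof.
move=> meta; have := mollifier_int_reflect r meta; rewrite /Rintegral => <-.
rewrite fineK//; apply: integrable_fin_num => //.
by apply: (bounded_support_integrable (phi := fun s => eta (r - s)));
  apply: bounded_support_reflect; case: meta.
Qed.

Lemma mollifier_int_shiftE eta s : mollifier eta ->
  (\int[mu]_r (eta (r - s))%:E = 1)%E.
Proof.
move=> meta; rewrite -(mollifier_int_reflectE s meta).
by apply: eq_integral => r _; case: meta => _ _ <- _; rewrite opprB.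
Qed.

(* Jensen's inequality, from the nonnegativity of [\int (f - c)^2 eta] where [c]
   is the mean of [f]. *)
Lemma conv_sqr_le f eta r : Lsq mu f -> mollifier eta ->
  (((conv f eta r) ^+ 2)%:E <= \int[mu]_s (f s ^+ 2 * eta (r - s))%:E)%E.
Proof.
move=> Lf meta; have [beta eta0 _ _] := meta; have [mf fi] := Lf.
pose c := conv f eta r.
have ber := bounded_support_reflect r beta.
have i1 := conv_integrable r Lf beta.
have i0 := bounded_support_integrable ber.
have i2 : mu.-integrable setT (fun s => (f s ^+ 2 * eta (r - s))%:E).
  have [mer [M erM _]] := ber.
  have if2 : mu.-integrable setT (fun s => (f s ^+ 2)%:E).
    apply/integrableP; split; first exact: measurable_sqE.
    by under eq_integral do rewrite gee0_abs ?lee_fin ?sqr_ge0//.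
  apply: le_integrable (integrableZl measurableT M if2) => //.
    by apply/measurable_EFinP; apply: measurable_funM => //; exact: measurable_funX.
  move=> s _; rewrite -EFinM /= lee_fin !normrM mulrC ler_wpM2r//.
  by apply: le_trans (erM s) _; exact: ler_norm.
rewrite -[leRHS]fineK; last exact: integrable_fin_num.
rewrite lee_fin.
have : 0 <= \int[mu]_s ((f s - c) ^+ 2 * eta (r - s)).
  by apply: Rintegral_ge0 => s _; rewrite mulr_ge0// sqr_ge0.
have -> : \int[mu]_s ((f s - c) ^+ 2 * eta (r - s)) =
    \int[mu]_s ((f s ^+ 2 * eta (r - s) - (2 * c) * (f s * eta (r - s))) +
     c ^+ 2 * eta (r - s)).
  by apply: eq_Rintegral => s _; ring.
rewrite RintegralD//; last 2 first.
- exact: (integrableB measurableT i2 (integrableZl measurableT (2 * c) i1)).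
- exact: (integrableZl measurableT (c ^+ 2) i0).
rewrite RintegralB//; last exact: (integrableZl measurableT (2 * c) i1).
rewrite RintegralZl// [X in _ + X]RintegralZl// mollifier_int_reflect//.
rewrite -/(conv f eta r) -/c.
by rewrite -/(Rintegral mu setT (fun s => f s ^+ 2 * eta (r - s))); nra.
Qed.

(** Jensen's inequality at each point, then Tonelli and the total mass 1 of the mollifier. *)
Lemma sqint_conv f eta : Lsq mu f -> mollifier eta ->
  (sqint mu (conv f eta) <= sqint mu f)%E.
Proof.
move=> Lf meta; have [[me _] eta0 _ _] := meta; have [mf fi] := Lf.
pose F (p : V * V) := ((f p.2) ^+ 2 * eta (p.1 - p.2))%:E.
have mF : measurable_fun setT F.
  apply/measurable_EFinP; apply: measurable_funM.
    by apply: measurable_funX; apply: (measurableT_comp mf); exact: measurable_snd.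
  exact: (measurableT_comp me measurable_diff).
have F0 p : (0 <= F p)%E by rewrite lee_fin mulr_ge0// sqr_ge0.
apply: (@le_trans _ _ (\int[mu]_r \int[mu]_s F (r, s))%E).
  apply: ge0_le_integral => //.
  - by move=> r _; rewrite lee_fin sqr_ge0.
  - by apply: measurable_sqE; exact: measurable_conv.
  - exact: (measurable_fun_fubini_tonelli_F F).
  - by move=> r _; exact: conv_sqr_le.
rewrite (fubini_tonelli F)// le_eqVlt; apply/orP; left; apply/eqP.
apply: eq_integral => s _; rewrite /F /=.
under eq_integral do rewrite EFinM.
rewrite ge0_integralZl_EFin//.
- by rewrite mollifier_int_shiftE// mule1.
- by move=> x _; rewrite lee_fin.
- apply/measurable_EFinP; apply: (measurableT_comp me).
  by apply: measurable_fun_matrix => i j; under eq_fun do rewrite !mxE; apply: measurable_funD => //; exact: measurable_entry.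
- exact: sqr_ge0.
Qed.


Variable eta : nat -> V -> R.
Hypothesis meta : forall k, mollifier (eta k).
Hypothesis eta_supp : forall k x, k.+1%:R^-1 < `|x| -> eta k x = 0.

Lemma eta_supp1 k x : 1 < `|x| -> eta k x = 0.
Proof.
move=> x1; apply: eta_supp; apply: le_lt_trans x1.
by rewrite invf_le1 ?ler1n// ltr0n.
Qed.

Let beta k : bounded_support (eta k). Proof. by case: (meta k). Qed.

(** The functions whose mollifications converge to them in L^2. The class is linear and closed in
    L^2; it is enlarged from continuous functions of bounded support to boxes, bounded measurable
    sets, simple functions, and finally all of L^2. *)
Definition approximable f : Prop := Lsq mu f /\
  ecvg0 (fun k => sqint mu (fun r => conv f (eta k) r - f r)).

Let mconv f k : Lsq mu f -> measurable_fun setT (conv f (eta k)).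
Proof. by move=> [mf _]; apply: measurable_conv => //; exact: (beta k).1. Qed.

Lemma approximableD f g : approximable f -> approximable g ->
  approximable (fun x => f x + g x).
Proof.
move=> [Lf cf] [Lg cg]; split; first exact: LsqD.
have h : ecvg0 (fun k => 2%:E * (sqint mu (fun r => conv f (eta k) r - f r)%R +
    sqint mu (fun r => conv g (eta k) r - g r)%R))%E.
  apply: ecvg0Z; last exact: ecvg0D.
  by move=> k; rewrite adde_ge0// sqint_ge0.
apply: ecvg0_le h => k; apply: le_trans (sqintD _ _ _).
- rewrite le_eqVlt; apply/orP; left; apply/eqP; congr sqint.
  by apply/funext => r; rewrite convD//; ring.
- by apply: measurable_funB; [exact: mconv|exact: Lf.1].
- by apply: measurable_funB; [exact: mconv|exact: Lg.1].
Qed.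

Lemma approximableZ c f : approximable f -> approximable (fun x => c * f x).
Proof.
move=> [Lf cf]; split; first exact: LsqZ.
have h : ecvg0 (fun k => (c ^+ 2)%:E * sqint mu (fun r => conv f (eta k) r - f r)%R)%E.
  by apply: ecvg0Z => // k; exact: sqint_ge0.
apply: ecvg0_le h => k; rewrite -sqintZ; last first.
  by apply: measurable_funB; [exact: mconv|exact: Lf.1].
rewrite le_eqVlt; apply/orP; left; apply/eqP; congr sqint.
by apply/funext => r; rewrite convZ//; ring.
Qed.

Lemma approximableB f g : approximable f -> approximable g ->
  approximable (fun x => f x - g x).
Proof.
move=> af /(approximableZ (-1)) ag.
have := approximableD af ag; congr approximable.
by apply/funext => x; rewrite mulN1r.
Qed.

Lemma approximable0 : approximable (fun=> 0).
Proof.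
split.
  split; first exact: measurable_cst.
  by rewrite /sqint expr0n /= integral0.
move=> e e0; exists 0%N => k _.
rewrite (_ : (fun _ => _) = fun=> 0); first by rewrite /sqint expr0n /= integral0 lee_fin ltW.
apply/funext => r; rewrite subr0 /conv.
under eq_Rintegral do rewrite mul0r.
by rewrite /Rintegral integral0.
Qed.

Lemma approximable_sum (I : Type) (s : seq I) (F : I -> V -> R) :
  (forall i, approximable (F i)) -> approximable (fun x => \sum_(i <- s) F i x).
Proof.
move=> aF; elim: s => [|i s ih].
  by under eq_fun do rewrite big_nil; exact: approximable0.
by under eq_fun do rewrite big_cons; exact: approximableD.
Qed.

Lemma approximable_limit f (g : nat -> V -> R) : Lsq mu f ->
  (forall j, approximable (g j)) -> ecvg0 (fun j => sqint mu (fun x => f x - g j x)) ->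
  approximable f.
Proof.
move=> Lf ag fg; split=> // e e0.
(* The splitting into three terms below costs 4 + 4 + 2 times this bound, mollification being a
   contraction. *)
have e8 : 0 < e / 16 by rewrite divr_gt0.
have [J hJ] := fg _ e8; have {hJ} hJ := hJ J (leqnn J).
have [Lg /(_ _ e8)[K hK]] := ag J.
exists K => k /hK hk.
have Lfg : Lsq mu (fun x => f x - g J x) by exact: LsqB.
have m1 : measurable_fun setT (conv (fun x => f x - g J x) (eta k)) by exact: mconv.
have m2 : measurable_fun setT (fun r => conv (g J) (eta k) r - g J r).
  by apply: measurable_funB; [exact: mconv|exact: Lg.1].
have E : (fun r => conv f (eta k) r - f r) = (fun r =>
   (conv (fun x => f x - g J x) (eta k) r + (conv (g J) (eta k) r - g J r)) -
   (f r - g J r)).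
  by apply/funext => r; rewrite convB//; ring.
rewrite E; apply: le_trans (sqintB _ _ _) _; [exact: measurable_funD|exact: Lfg.1|].
have h1 := sqint_conv Lfg (meta k).
have h2 := sqintD mu m1 m2.
move: hJ hk h1 h2.
move: (sqint_ge0 mu (fun x => f x - g J x)) (sqint_ge0 mu (fun r => conv (g J) (eta k) r - g J r)).
move: (sqint_ge0 mu (conv (fun x => f x - g J x) (eta k))).
move: (sqint_ge0 mu (fun x => conv (fun x => f x - g J x) (eta k) x + (conv (g J) (eta k) x - g J x))).
case: (sqint _ _) => [w| |]//; case: (sqint _ _) => [x| |]//;
case: (sqint _ _) => [y| |]//; case: (sqint _ _) => [z| |]//.
rewrite -!EFinD -!EFinM !lee_fin => *; lra.
Qed.

Lemma conv_cvg f r : continuous f -> Lsq mu f ->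
  (fun k => conv f (eta k) r) @ \oo --> f r.
Proof.
move=> cf Lf; apply/cvgrPdist_le => e e0.
have := cf r; move/cvgrPdist_le => /(_ e e0)/nbhs_ballP[d /= d0 df].
near=> k.
have hk : k.+1%:R^-1 < d :> R.
  near: k; have /cvgrPdist_lt/(_ d d0) := @cvg_harmonic R.
  by apply: filterS => k; rewrite sub0r normrN ger0_norm// invr_ge0.
have [_ eta0 _ _] := meta k.
have i0 := bounded_support_integrable (bounded_support_reflect r (beta k)).
have -> : f r - conv f (eta k) r = \int[mu]_s ((f r - f s) * eta k (r - s)).
  under eq_Rintegral do rewrite mulrBl.
  rewrite RintegralB//; [|exact: (integrableZl measurableT (f r) i0)|exact: conv_integrable].
  by rewrite RintegralZl// mollifier_int_reflect// mulr1.
have iB : mu.-integrable setT (fun s => ((f r - f s) * eta k (r - s))%:E).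
  have := integrableB measurableT (integrableZl measurableT (f r) i0) (conv_integrable r Lf (beta k)).
  by apply: eq_integrable => // s _; rewrite /= mulrBl.
apply: le_trans (le_normr_Rintegral _ iB) _ => //.
apply: (@le_trans _ _ (\int[mu]_s (e * eta k (r - s)))).
  apply: le_Rintegral => //.
  - exact: (integrable_norm iB).
  - exact: (integrableZl measurableT e i0).
  - move=> s _; rewrite normrM [X in _ * X]ger0_norm//.
    have [rs|rs] := leP `|r - s| k.+1%:R^-1; last by rewrite eta_supp// !mulr0.
    rewrite ler_wpM2r//; apply: df; rewrite -ball_normE /=.
    exact: le_lt_trans hk.
by rewrite RintegralZl// mollifier_int_reflect// mulr1.
Unshelve. all: by end_near. Qed.

(** Pointwise convergence is dominated by 2M on the ball of radius M + 1, because the mollifiers are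
    supported in the unit ball. *)
Lemma approximable_continuous f : continuous f -> bounded_support f -> approximable f.
Proof.
move=> cf bf; have [mf [M fM f0]] := bf.
have Lf := bounded_support_Lsq bf; split=> //.
have M0 : 0 <= M by apply: le_trans (fM 0).
have Lh : Lsq mu (fun x => (2 * M) * \1_(cball (M + 1)) x).
  by apply: LsqZ; apply: (Lsq_indic (M := M + 1)) => //; exact: measurable_cball.
have h := @sqint_dominated _ _ _ mu (fun k => conv f (eta k)) f _ (fun k => mconv k Lf) mf Lh.
have E k : sqint mu (fun r => conv f (eta k) r - f r) = sqint mu (fun r => f r - conv f (eta k) r).
  by rewrite -sqintN; congr sqint; apply/funext => r; rewrite opprB.
apply: ecvg0_le (h _ _) => [k|k x|x]; first by rewrite E.
- rewrite indicE; case: (boolP (x \in cball (M + 1))) => xM.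
    rewrite mulr1 (ger0_norm (mulr_ge0 _ M0))// (le_trans (ler_normB _ _))//.
    rewrite mulrDl !mul1r lerD//.
    have i1 := conv_integrable x Lf (beta k).
    have i0 := bounded_support_integrable (bounded_support_reflect x (beta k)).
    have [_ eta0 _ _] := meta k.
    apply: le_trans (le_normr_Rintegral _ i1) _ => //.
    apply: (@le_trans _ _ (\int[mu]_s (M * eta k (x - s)))).
      apply: le_Rintegral => //.
      + exact: (integrable_norm i1).
      + exact: (integrableZl measurableT M i0).
      + by move=> s _; rewrite normrM [X in _ * X]ger0_norm// ler_wpM2r.
    by rewrite RintegralZl// mollifier_int_reflect// mulr1.
  have {}xM : M + 1 < `|x| by rewrite ltNge; apply: contra xM => xM; rewrite inE.
  rewrite f0 ?(lt_trans _ xM) ?ltrDl// sub0r normrN.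
  suff -> : conv f (eta k) x = 0 by rewrite normr0.
  rewrite /conv (_ : (fun s => _) = fun=> 0) ?/Rintegral ?integral0//.
  apply/funext => s; have [sM|sM] := leP `|s| M; last by rewrite f0// mul0r.
  rewrite eta_supp1 ?mulr0// -(ltrD2r M) addrC; apply: lt_le_trans xM _.
  by rewrite -{1}(subrK s x) (le_trans (ler_normD _ _))// lerD2l.
- exact: conv_cvg.
Qed.

Let c := @mx_coord R 1 N.

Lemma approximable_obox a b : approximable (\1_(obox c a b)).
Proof.
have [k0 hk0] := @obox_mx_cball R 1 N a b.
have mo : measurable (obox c a b) by apply: measurable_obox; exact: measurable_mx_coord.
have Li : Lsq mu (\1_(obox c a b)) by apply: Lsq_indic hk0.
have mb k : measurable_fun setT (bump c a b k).
  by apply: measurable_bump; exact: measurable_mx_coord.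
have bz k x : ~ obox c a b x -> bump c a b k x = 0 by exact: bump_eq0.
apply: (@approximable_limit _ (bump c a b)) => // [k|].
  apply: approximable_continuous.
    by apply: theta_class_continuous; apply: theta_class_bump; exact: affine_mx_coord.
  split=> //; exists (k0%:R + 1) => x.
    rewrite ger0_norm ?bump_ge0// (le_trans (bump_le1 _ _ _ _ _))//.
    by rewrite lerDr.
  move=> xk; apply: bz => /hk0 /= xk0.
  by have := lt_le_trans xk xk0; rewrite ltNge lerDl ler01.
apply: (@sqint_dominated _ _ _ mu (bump c a b) _ (\1_(obox c a b))) => //.
- move=> k x; rewrite indicE; case: (boolP (x \in obox c a b)) => xo.
    rewrite normr1 ger0_norm ?subr_ge0 ?bump_le1//.
    by rewrite lerBlDr lerDl bump_ge0.
  by rewrite bz ?subrr// => h; move: xo; rewrite mem_set.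
- by move=> x; exact: cvg_bump.
Qed.

(** A Dynkin argument inside a fixed box, which keeps all indicators square integrable, including
    that of the whole space. *)
Lemma approximable_indic (A : set V) (n : nat) : measurable A ->
  approximable (\1_(A `&` obox c (fun=> - n%:R) (fun=> n%:R))).
Proof.
set Q := obox _ _ _.
have mQ : measurable Q by apply: measurable_obox; exact: measurable_mx_coord.
have [k0 hk0] := @obox_mx_cball R 1 N (fun=> - n%:R) (fun=> n%:R).
have LQ B : measurable B -> B `<=` Q -> Lsq mu (\1_B).
  by move=> mB BQ; apply: Lsq_indic (k0%:R) mB _ => x /BQ; exact: hk0.
pose G := [set obox c ab.1 ab.2 | ab in [set: (_ -> R) * (_ -> R)]].
have EG : @measurable _ V = <<s G >>.
  by apply: measurable_obox_gen; [exact: measurable_mx_coord|exact: mx_coord_gen].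
rewrite EG; move: A.
apply: (@dynkin_induction _ _ G (fun A => approximable (\1_(A `&` Q)))) => //.
- by move=> _ _ [ab _ <-] [ab' _ <-]; rewrite oboxI; eexists (_, _).
- by rewrite setTI; exact: approximable_obox.
- by move=> _ [ab _ <-]; rewrite oboxI; exact: approximable_obox.
- move=> S mS aS; have := approximableB (approximable_obox (fun=> - n%:R) (fun=> n%:R)) aS.
  congr approximable; apply/funext => x; rewrite -/Q !indicE !in_setI in_setC.
  by case: (x \in Q); case: (x \in S); rewrite /= ?subrr ?subr0.
- move=> F mF tF aF.
  apply: (@approximable_limit _ (fun j x => \sum_(i < j) \1_(F i `&` Q) x)).
  + by apply: LQ => [|x []//]; apply: measurableI => //; exact: bigcupT_measurable.
  + by move=> j; apply: (approximable_sum (index_enum _) (fun i : 'I_j => aF i)).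
  have E j x : \sum_(i < j) \1_(F i `&` Q) x = \1_(\big[setU/set0]_(i < j) F i `&` Q) x :> R.
    elim: j => [|j ih]; first by rewrite !big_ord0 set0I indic0.
    rewrite !big_ord_recr /= ih !indicE !in_setI in_setU.
    case: (x \in Q); rewrite ?andbF ?addr0// !andbT.
    case: (boolP (x \in F j)) => xj; rewrite ?orbF ?addr0// orbT.
    suff -> : (x \in \big[setU/set0]_(i < j) F i) = false by rewrite add0r.
    apply/negbTE/negP; rewrite inE -bigcup_mkord => -[i /= ij Fi].
    move/trivIsetP : tF => /(_ i j Logic.I Logic.I); rewrite ltn_eqF// => /(_ isT).
    by move/seteqP => -[/(_ x) h _]; apply: h; split=> //; rewrite inE in xj.
  apply: (@sqint_dominated _ _ _ mu _ _ (\1_Q)).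
  + move=> j; apply: measurable_sum => i.
    by apply: measurable_indic; exact: measurableI.
  + by apply: measurable_indic; apply: measurableI => //; exact: bigcupT_measurable.
  + exact: LQ.
  + move=> j x; rewrite E !indicE !in_setI; case: (x \in Q); rewrite ?andbF ?subrr ?normr0//.
    by rewrite !andbT normr1; case: (_ \in _); case: (_ \in _); rewrite ?subrr ?subr0 ?sub0r ?normrN ?normr1 ?normr0.
  + move=> x; under eq_fun do rewrite E.
    have [xQ|xQ] := boolP (x \in Q); last first.
      rewrite indicE in_setI (negbTE xQ) andbF.
      by under eq_fun do rewrite indicE in_setI (negbTE xQ) andbF; exact: cvg_cst.
    have [[i _ Fi]|nF] := pselect ((\bigcup_k F k) x); last first.
      rewrite indicE in_setI (_ : (x \in \bigcup_k F k) = false); last by apply/negbTE/negP; rewrite inE.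
      rewrite (_ : (fun _ => _) = cst 0); first exact: cvg_cst.
      apply/funext => j; rewrite indicE in_setI (_ : (x \in \big[setU/set0]_(i < j) F i) = false)//.
      by apply/negbTE/negP; rewrite inE -bigcup_mkord => -[i _ Fi]; apply: nF; exists i.
    apply: cvg_near_cst; near=> j.
    rewrite !indicE !in_setI xQ !andbT; congr (nat_of_bool _)%:R.
    transitivity true; last by apply/esym/mem_set; exists i.
    apply/mem_set; rewrite -bigcup_mkord; exists i => //=; near: j; exact: nbhs_infty_gt.
Unshelve. all: by end_near. Qed.


Import HBNNSimple.

Lemma approximable_ge0 f : Lsq mu f -> (forall x, 0 <= f x) -> approximable f.
Proof.
move=> Lf f0; have [mf _] := Lf.
pose Q (n : nat) := obox c (fun=> - n%:R) (fun=> n%:R).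
have mQ n : measurable (Q n) by apply: measurable_obox; exact: measurable_mx_coord.
have mfe : measurable_fun setT (EFin \o f) by exact/measurable_EFinP.
pose g := nnsfun_approx measurableT mfe.
have gcvg x : (fun j => g j x) @ \oo --> f x.
  have := @cvg_nnsfun_approx _ _ _ setT measurableT (EFin \o f) mfe _ x Logic.I.
  by move=> H; apply: (fine_cvg (H _)) => y _; rewrite lee_fin.
have gf j x : g j x <= f x.
  rewrite -(cvg_lim _ (gcvg x))//; apply: nondecreasing_cvgn_le; last exact: cvgP (gcvg x).
  by move=> a b ab; apply/lefP; exact: nd_nnsfun_approx.
(* Cutting to the growing boxes [Q j] makes each simple function a combination of the indicators of
   [approximable_indic]. *)
apply: (@approximable_limit _ (fun j x => g j x * \1_(Q j) x)) => // [j|].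
  rewrite (_ : (fun _ => _) = (fun x => \sum_(y <- finmap.enum_fset (fset_set (range (g j))))
     y * \1_((g j @^-1` [set y]) `&` Q j) x)).
    apply: approximable_sum => y; apply: approximableZ.
    by apply: approximable_indic; exact: measurable_sfunP.
  apply/funext => x; rewrite fimfunE fsbig_finite//= mulr_suml.
  apply: eq_bigr => y _; rewrite -mulrA; congr (_ * _).
  by rewrite !indicE in_setI; case: (_ \in _); case: (_ \in _); rewrite /= ?mulr0 ?mul0r ?mulr1.
apply: (@sqint_dominated _ _ _ mu _ _ f) => //.
- by move=> j; apply: measurable_funM => //; exact: measurable_indic.
- move=> j x; rewrite (ger0_norm (f0 x)) indicE; have := gf j x.
  have g0 : 0 <= g j x by [].
  case: (_ \in _); rewrite ?mulr1 ?mulr0 ?subr0 => gfx; last by rewrite ger0_norm.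
  by rewrite ger0_norm ?subr_ge0// lerBlDr lerDl.
- move=> x; have [k0 _ xk0] : (\bigcup_k Q k) x by rewrite (@obox_cover _ V R _ c).
  apply: cvg_trans (gcvg x); apply: near_eq_cvg; near=> j.
  rewrite indicE mem_set ?mulr1// => ij.
  have k0j : k0%:R <= j%:R :> R by rewrite ler_nat; near: j; exact: nbhs_infty_ge.
  by have /andP[h1 h2] := xk0 ij; apply/andP; split; [apply: le_lt_trans h1; rewrite lerN2|exact: lt_le_trans h2 _].
Unshelve. all: by end_near. Qed.

Lemma Lsq_approximable f : Lsq mu f -> approximable f.
Proof.
move=> Lf; have [mf _] := Lf.
have L1 : Lsq mu (f^\+) by apply: le_Lsq Lf => [|x]; [exact: measurable_funrpos|
  rewrite /funrpos ger0_norm ?le_max ?lexx ?orbT// ge_max ler_norm normr_ge0].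
have L2 : Lsq mu (f^\-) by apply: le_Lsq Lf => [|x]; [exact: measurable_funrneg|
  rewrite /funrneg ger0_norm ?le_max ?lexx ?orbT// ge_max -normrN ler_norm normr_ge0].
rewrite (_ : f = fun x => f^\+ x - f^\- x); last first.
  by apply/funext => x; rewrite /funrpos /funrneg; case: (leP (f x) 0) => fx; case: (leP (- f x) 0) => fx'; lra.
by apply: approximableB; exact: approximable_ge0.
Qed.

End convolution.

Section kernel_convolution.
Context d (Z : measurableType d) (R : realType) (N : nat).
Local Notation V := 'rV[R]_N.
Local Notation mu := (lebesgue_rV R N).
Variable m : {sigma_finite_measure set Z -> \bar R}.
Implicit Types (a b : Z * V -> R) (phi : V -> R).
Local Notation mm := (m \x mu)%E.

Definition kconv a phi : Z * V -> R := fun p => conv (fun s => a (p.1, s)) phi p.2.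

Lemma measurable_kconv a phi : measurable_fun setT a -> measurable_fun setT phi ->
  measurable_fun setT (kconv a phi).
Proof.
move=> ma mphi; apply: (measurable_Rintegral1 mu
  (f := fun q : (Z * V) * V => a (q.1.1, q.2) * phi (q.1.2 - q.2))).
apply: measurable_funM.
  apply: (measurableT_comp ma); apply: measurable_fun_pair.
    exact: (measurableT_comp measurable_fst measurable_fst).
  exact: measurable_snd.
apply: (measurableT_comp mphi).
apply: (measurableT_comp (@measurable_diff R N) (g := fun q : (Z * V) * V => (q.1.2, q.2))).
apply: measurable_fun_pair; last exact: measurable_snd.
exact: (measurableT_comp measurable_snd measurable_fst).
Qed.

Lemma sqint_kconv a eta : Lsq mm a -> mollifier eta ->
  (sqint mm (kconv a eta) <= sqint mm a)%E.
Proof.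
move=> La meta; have [[me _] _ _ _] := meta; have [ma ai] := La.
have mk := measurable_kconv ma me.
rewrite (sqint_prod1 _ _ mk) (sqint_prod1 _ _ ma); apply: ae_ge0_le_integral.
- exact: measurableT.
- by move=> x _; exact: sqint_ge0.
- exact: (measurable_sqint1 mu mk).
- by move=> x _; exact: sqint_ge0.
- exact: (measurable_sqint1 mu ma).
- apply: filterS (ae_Lsq1 La) => z Lz _.
  exact: (@sqint_conv R N (fun s => a (z, s)) eta Lz meta).
Qed.

Lemma Lsq_kconv a eta : Lsq mm a -> mollifier eta -> Lsq mm (kconv a eta).
Proof.
move=> La meta; split; last exact: le_lt_trans (sqint_kconv La meta) La.2.
by apply: measurable_kconv; [exact: La.1|case: meta => -[]].
Qed.

Variable eta : nat -> V -> R.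
Hypothesis meta : forall k, mollifier (eta k).
Hypothesis eta_supp : forall k x, k.+1%:R^-1 < `|x| -> eta k x = 0.

(** Convergence on almost every section, dominated by four times the squared norm of the section: a
    factor 2 from [sqintB], and another because mollification is a contraction. *)
Lemma kconv_cvg a : Lsq mm a ->
  ecvg0 (fun k => sqint mm (fun p => kconv a (eta k) p - a p)).
Proof.
move=> La; have [ma ai] := La.
have mk k : measurable_fun setT (kconv a (eta k)).
  by apply: measurable_kconv => //; case: (meta k) => -[].
have mka k : measurable_fun setT (fun p => kconv a (eta k) p - a p) by exact: measurable_funB.
pose u k z := sqint mu (fun s => kconv a (eta k) (z, s) - a (z, s)).
have mu_ k : measurable_fun setT (u k) by exact: (measurable_sqint1 mu (mka k)).
pose w z := (4%:E * sqint mu (fun s => a (z, s)))%E.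
have mw : measurable_fun setT w by apply: measurable_funeM; exact: measurable_sqint1.
apply: ecvg0_cvg.
have [] := @dominated_convergence _ _ _ m setT measurableT u (cst 0%E) w.
- by [].
- exact: measurable_cst.
- apply: filterS (ae_Lsq1 La) => z Lz _; apply: cvg_ecvg0; first by move=> k; exact: sqint_ge0.
  exact: (@Lsq_approximable R N eta meta eta_supp _ Lz).2.
- apply/integrableP; split => //.
  rewrite (eq_integral w); last first.
    by move=> z _; rewrite gee0_abs// /w mule_ge0 ?sqint_ge0.
  rewrite ge0_integralZl_EFin//; [|by move=> z _; exact: sqint_ge0|exact: measurable_sqint1].
  by rewrite -sqint_prod1// lte_mul_pinfty.
- apply: filterS (ae_Lsq1 La) => z Lz k _; rewrite gee0_abs ?sqint_ge0//.
  have h1 := @sqint_conv R N (fun s => a (z, s)) (eta k) Lz (meta k).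
  have h2 := sqintB mu (measurable_section1 z (mk k)) Lz.1.
  apply: (le_trans h2); rewrite /w.
  have -> : (4%:E * sqint mu (fun s => a (z, s)) = 2%:E * (sqint mu (fun s => a (z, s)) + sqint mu (fun s => a (z, s))))%E.
    have : sqint mu (fun s => a (z, s)) \is a fin_num by rewrite ge0_fin_numE ?sqint_ge0//; exact: Lz.2.
    by move: (sqint _ _) => [r| |]// _; rewrite -EFinD -!EFinM; congr EFin; ring.
  by rewrite lee_pmul2l// leeD2r.
move=> _ _; rewrite integral0 => h; apply: cvg_trans h; apply: near_eq_cvg.
by apply: nearW => k; rewrite sqint_prod1.
Qed.

(** Truncation of the second variable only: square integrability of all truncations is membership in
    L^2(Z x V_loc). *)
Definition cut a (M : R) : Z * V -> R := fun p => a p * \1_(cball M) p.2.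

Lemma measurable_cut a M : measurable_fun setT a -> measurable_fun setT (cut a M).
Proof.
move=> ma; apply: measurable_funM => //.
apply: (measurableT_comp (f := (\1_(cball M) : V -> R)) _ measurable_snd).
by apply: measurable_indic; exact: measurable_cball.
Qed.

Lemma cut_le a M p : `|cut a M p| <= `|a p|.
Proof.
rewrite /cut normrM indicE; case: (_ \in _); first by rewrite normr1 mulr1.
by rewrite normr0 mulr0.
Qed.

(** The mollifiers live in the unit ball, so on the ball of radius [M] a convolution sees the kernel
    on the ball of radius [M + 1] only. *)
Lemma kconv_cut a M k p : cball M p.2 -> kconv a (eta k) p = kconv (cut a (M + 1)) (eta k) p.
Proof.
move=> pM; apply: eq_Rintegral => s _; rewrite /cut /= indicE.
case: (boolP (s \in _)) => sM; rewrite ?mulr1// mulr0 mul0r.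
rewrite (eta_supp1 eta_supp) ?mulr0//.
have {}sM : M + 1 < `|s| by rewrite ltNge; apply: contra sM => sM; rewrite inE.
rewrite -(ltrD2l M); apply: (lt_le_trans sM).
rewrite -{1}(subrK p.2 s) (le_trans (ler_normD _ _))// addrC lerD// distrC//.
Qed.

Lemma kconv_cut_cvg a : (forall M, Lsq mm (cut a M)) -> forall M,
  ecvg0 (fun k => sqint mm (fun p => cut (kconv a (eta k)) M p - cut a M p)).
Proof.
move=> La M.
have h := kconv_cvg (La (M + 1)).
apply: ecvg0_le h => k.
have E : (fun p => cut (kconv a (eta k)) M p - cut a M p) =
    cut (fun p => kconv (cut a (M + 1)) (eta k) p - cut a (M + 1) p) M.
  apply/funext => p; rewrite /cut indicE; case: (boolP (p.2 \in _)) => pM; last by rewrite !mulr0 subrr.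
  rewrite !mulr1 -(@kconv_cut _ M); last by rewrite inE in pM.
  rewrite indicE mem_set ?mulr1//; move: pM; rewrite inE /cball /= => /le_trans; apply.
  by rewrite lerDl.
have mB : measurable_fun setT (fun p => kconv (cut a (M + 1)) (eta k) p - cut a (M + 1) p).
  apply: measurable_funB; last exact: (La _).1.
  by apply: measurable_kconv; [exact: (La _).1|case: (meta k) => -[]].
rewrite E; apply: le_sqint => //; first exact: measurable_cut.
by move=> p; exact: cut_le.
Qed.

Lemma Lsq_cut_kconv a k M : (forall M, Lsq mm (cut a M)) -> measurable_fun setT a ->
  Lsq mm (cut (kconv a (eta k)) M).
Proof.
move=> La ma.
apply: (@le_Lsq _ _ _ _ _ (kconv (cut a (M + 1)) (eta k))).
- by apply: measurable_cut; apply: measurable_kconv => //; case: (meta k) => -[].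
- move=> p; rewrite {1}/cut indicE; case: (boolP (p.2 \in _)) => pM; last by rewrite mulr0 normr0.
  by rewrite mulr1 (@kconv_cut _ M)//; rewrite inE in pM.
- exact: Lsq_kconv.
Qed.

End kernel_convolution.

(** * Test functions and integration by parts *)

Section test_functions.
Variables (R : realType) (V : normedModType R).
Implicit Types (phi : V -> R) (v x : V).

Lemma smooth_continuous phi : smooth phi -> continuous phi.
Proof. by move=> sp; have [] := sp [::]. Qed.

Lemma smooth_derivable phi x v : smooth phi -> derivable phi x v.
Proof. by move=> sp; have [_] := sp [::]; exact. Qed.

Lemma smooth_derive phi v : smooth phi -> smooth ('D_v phi).
Proof. by move=> sp s; have := sp (rcons s v); rewrite foldr_rcons. Qed.

Lemma derive_support phi v : [set x | 'D_v phi x != 0] `<=` closure [set x | phi x != 0].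
Proof.
move=> x /= /eqP; apply: contra_notP => nx; apply/eqP/negPn/negP => /eqP Dx.
apply: Dx.
have : (~` closure [set x | phi x != 0]) x by [].
have oC : open (~` closure [set x | phi x != 0]) by apply: closed_openC; exact: closed_closure.
move=> Cx; have nC := open_nbhs_nbhs (conj oC Cx).
rewrite -(@near_eq_derive _ _ _ (cst 0) phi x v); first exact: derive_cst.
apply: filterS nC => y /= ny; apply/esym/eqP/negPn/negP => phiy; apply: ny.
exact: subset_closure.
Qed.

Lemma test_function_derive phi v : test_function phi -> test_function ('D_v phi).
Proof.
move=> [sp cp]; split; first exact: smooth_derive.
apply: (subclosed_compact _ cp); first exact: closed_closure.
have : closed (closure [set x | phi x != 0]) by exact: closed_closure.
by move/closure_id => ->; apply: closure_subset; exact: derive_support.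
Qed.

Lemma test_function_bounded phi : test_function phi ->
  exists2 M : R, (forall x, `|phi x| <= M) & (forall x, M < `|x| -> phi x = 0).
Proof.
move=> [sp cp]; pose K := closure [set x | phi x != 0].
have cphi := smooth_continuous sp.
have [k1 hk1] := compact_sub_cball cp.
have cK : compact (phi @` K) by apply: continuous_compact => //; exact: continuous_subspaceT.
have [k2 hk2] := compact_sub_cball cK.
have supp x : phi x != 0 -> K x by move=> px; exact: subset_closure.
exists (k1%:R + k2%:R) => x.
  have [->|px] := eqVneq (phi x) 0; first by rewrite normr0 addr_ge0.
  by apply: le_trans (hk2 (phi x) _) _; [exists x => //; exact: supp|rewrite lerDr].
move=> xk; apply/eqP/negPn/negP => /supp/hk1 /= xk1.
by have := le_lt_trans xk1 (le_lt_trans _ xk); rewrite ltxx lerDl => /(_ (ler0n _ _)).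
Qed.

End test_functions.

Lemma RintegralN d (T : measurableType d) (R : realType)
    (m : {measure set T -> \bar R}) (f : T -> R) :
  \int[m]_x (- f x) = - \int[m]_x f x.
Proof.
rewrite /Rintegral (integralE _ _ (fun x => (- f x)%:E)) (integralE _ _ (fun x => (f x)%:E)).
have E1 : (\int[m]_x (fun x => (- f x)%:E)^\+ x = \int[m]_x (fun x => (f x)%:E)^\- x)%E.
  by apply: eq_integral => x _; rewrite funeposE funenegE.
have E2 : (\int[m]_x (fun x => (- f x)%:E)^\- x = \int[m]_x (fun x => (f x)%:E)^\+ x)%E.
  by apply: eq_integral => x _; rewrite funeposE funenegE /= opprK.
rewrite E1 E2.
by case: (\int[m]_x _)%E => [a| |]; case: (\int[m]_x _)%E => [b| |] //=; rewrite ?oppr0 ?opprB.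
Qed.

Section derivative_integral.
Variables (R : realType) (N : nat).
Local Notation V := 'rV[R]_N.
Local Notation mu := (lebesgue_rV R N).
Implicit Types (phi psi f : V -> R) (v r s : V).

(** The regularity consumed by integration by parts in one direction. Test functions and their
    slices have it, and it is stable under products and translations. *)
Definition C1_support v psi : Prop := [/\ continuous psi, bounded_support psi,
  (forall r, derivable psi r v) & continuous ('D_v psi) /\ bounded_support ('D_v psi)].

Lemma is_derive_along psi v r (t : R) : (forall r, derivable psi r v) ->
  is_derive t 1 (fun t : R => psi (t *: v + r)) ('D_v psi (t *: v + r)).
Proof.
move=> dpsi; apply/is_derive_line.
rewrite (_ : (fun h => _) = (fun h : R => psi (h *: v + (t *: v + r)))); last first.
  apply/funext => h; have -> : h *: (1 : R) = h by exact: mulr1.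
  by rewrite scalerDl addrA.
by apply/is_derive_line; split.
Qed.

(* Translation invariance makes the integrals of the difference quotients
   vanish; they are uniformly bounded by the mean value theorem. *)
Lemma Rintegral_derive v psi : C1_support v psi -> \int[mu]_r 'D_v psi r = 0.
Proof.
move=> [cpsi bpsi dpsi [cD bD]].
have [mpsi [M psiM psi0]] := bpsi; have [mD [C DC _]] := bD.
(* Steps of length at most 1, so that all difference quotients are supported in the ball of radius M
   + |v|. *)
pose h (l : nat) : R := l.+1%:R^-1.
have h0 l : 0 < h l by rewrite invr_gt0.
have h1 l : h l <= 1 by rewrite invf_le1 ?ler1n// ltr0n.
pose q l r := (h l)^-1 * (psi (r + h l *: v) - psi r).
have msh l : measurable_fun setT (fun r : V => psi (r + h l *: v)).
  exact: (measurableT_comp mpsi (lebesgue_rV_translation (h l *: v)).1).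
have mq l : measurable_fun setT (q l) by apply: measurable_funM => //; exact: measurable_funB.
have C0 : 0 <= C by apply: le_trans (DC 0).
have M0 : 0 <= M by apply: le_trans (psiM 0).
have qb l r : `|q l r| <= `|C * \1_(cball (M + `|v|)) r|.
  rewrite [X in _ <= `|_ * X|]indicE.
  case: (boolP (r \in cball (M + `|v|))) => rM; last first.
    have {}rM : M + `|v| < `|r| by rewrite ltNge; apply: contra rM => rM; rewrite inE.
    have hv : `|h l *: v| <= `|v|.
      by rewrite normrZ (ger0_norm (ltW (h0 l))) ler_piMl.
    rewrite /q psi0; last first.
      rewrite -(ltrD2r `|v|); apply: (lt_le_trans rM).
      have {1}-> : r = (r + h l *: v) - h l *: v by rewrite addrK.
      by rewrite (le_trans (ler_normB _ _))// lerD2l.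
    rewrite psi0 ?subrr ?mulr0 ?normr0//.
    by apply: le_lt_trans rM; rewrite lerDl.
  rewrite mulr1 (ger0_norm C0).
  have [t tI] : exists2 t, t \in `]0, h l[ & psi (h l *: v + r) - psi (0 *: v + r) =
      'D_v psi (t *: v + r) * (h l - 0).
    apply: (@MVT R (fun t => psi (t *: v + r)) (fun t => 'D_v psi (t *: v + r))) => //.
    - by move=> t _; exact: is_derive_along.
    - apply: continuous_subspaceT => t; apply: differentiable_continuous; apply/derivable1_diffP.
      by case: (@is_derive_along psi v r t dpsi).
  rewrite scale0r add0r subr0 [h l *: v + r]addrC => E.
  by rewrite /q E mulrC -mulrA divff ?gt_eqF// mulr1.
have q0 l : \int[mu]_r q l r = 0.
  have i1 := bounded_support_integrable bpsi.
  have i2 : mu.-integrable setT (fun r => (psi (r + h l *: v))%:E).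
    have := bounded_support_integrable (bounded_support_shift (- (h l *: v)) bpsi).
    by apply: eq_integrable => // r _; rewrite /= opprK.
  have iB : mu.-integrable setT (fun r => (psi (r + h l *: v) - psi r)%:E).
    exact: (integrableB measurableT i2 i1).
  rewrite /q RintegralZl// RintegralB//.
  by rewrite (Rintegral_preserving (lebesgue_rV_translation (h l *: v)) mpsi) subrr mulr0.
have qcvg r : q ^~ r @ \oo --> 'D_v psi r.
  have hcvg : h @ \oo --> (0 : R)^'.
    move=> A [e /= e0 eA].
    have /cvgrPdist_lt/(_ e e0) := @cvg_harmonic R.
    apply: filterS => l hl; apply: eA; last by rewrite gt_eqF.
    by rewrite /ball /= in hl *.
  have D : (t^-1 *: ((psi \o shift r) (t *: v) - psi r)) @[t --> 0^'] --> 'D_v psi r.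
    exact: dpsi.
  rewrite (_ : q ^~ r = (fun t => t^-1 *: ((psi \o shift r) (t *: v) - psi r)) \o h).
    exact: (cvg_comp _ _ hcvg D).
  by apply/funext => l; rewrite /q /= [r + _]addrC.
have iD := bounded_support_integrable bD.
have Lb : bounded_support (\1_(cball (M + `|v|)) : V -> R).
  split; first by apply: measurable_indic; exact: measurable_cball.
  exists (1 + (M + `|v|)) => r.
    rewrite indicE; case: (_ \in _); rewrite ?normr1 ?normr0 ?lerDl ?addr_ge0//.
  move=> rM; rewrite indicE memNset// => /= rM'.
  by have := le_lt_trans rM' (lt_trans _ rM); rewrite ltxx ltrDr => /(_ ltr01).
have Li : mu.-integrable setT (fun r => (C * \1_(cball (M + `|v|)) r)%:E).
  exact: (integrableZl measurableT C (bounded_support_integrable Lb)).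
have [] := @dominated_convergence _ _ _ mu setT measurableT (fun l r => (q l r)%:E)
  (fun r => ('D_v psi r)%:E) (fun r => (C * \1_(cball (M + `|v|)) r)%:E).
- by move=> l; apply/measurable_EFinP.
- by apply/measurable_EFinP.
- by apply: aeW => r _; apply: cvg_EFin; [exact: nearW|exact: qcvg].
- exact: Li.
- apply: aeW => r l _; rewrite lee_fin; apply: le_trans (qb l r) _.
  rewrite ger0_norm// mulr_ge0// indicE; exact: ler0n.
move=> _ _; rewrite /= [X in X @ _ --> _](_ : _ = cst 0%E); last first.
  apply/funext => l /=; have := q0 l; rewrite /Rintegral => ql0.
  rewrite -[LHS]fineK ?ql0//; apply: integrable_fin_num => //.
  apply: le_integrable Li => //; first exact/measurable_EFinP.
  by move=> r _; rewrite /= lee_fin.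
move/(cvg_unique (@ereal_hausdorff R)) => /(_ _ (@cvg_cst _ (0%E : \bar R) _ _ _)).
by rewrite /Rintegral => ->.
Qed.

Lemma test_function_bounded_support phi : test_function phi -> bounded_support phi.
Proof.
move=> tphi; split; last exact: test_function_bounded.
by apply: continuous_measurable_mx; apply: smooth_continuous; case: tphi.
Qed.

Lemma test_function_C1 phi v : test_function phi -> C1_support v phi.
Proof.
move=> tphi; have tD := test_function_derive v tphi.
split; [|exact: test_function_bounded_support| |split; [|exact: test_function_bounded_support]].
- by apply: smooth_continuous; case: tphi.
- by move=> r; apply: smooth_derivable; case: tphi.
- by apply: smooth_continuous; case: tD.
Qed.

Lemma continuous_shift s : continuous (fun r : V => r - s).
Proof. move=> r A /nbhs_ballP[e /= e0 eA]; apply/nbhs_ballP; exists e => //= r' rr'.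
apply: eA; move: rr'; rewrite -ball_normE /ball_ /=.
by have -> : r - s - (r' - s) = r - r' by rewrite opprB addrA subrK. Qed.

Lemma is_derive_shift psi v r s d : is_derive (r - s) v psi d ->
  is_derive r v (fun r => psi (r - s)) d.
Proof.
move=> /is_derive_line D; apply/is_derive_line; move: D; congr is_derive.
by apply/funext => h; rewrite addrA.
Qed.

Lemma C1_support_shift psi v s : C1_support v psi -> C1_support v (fun r => psi (r - s)) /\
  'D_v (fun r => psi (r - s)) = (fun r => 'D_v psi (r - s)).
Proof.
move=> [cpsi bpsi dpsi [cD bD]].
have dr r : is_derive r v (fun r => psi (r - s)) ('D_v psi (r - s)).
  by apply: is_derive_shift; split => //; exact: dpsi.
have E : 'D_v (fun r => psi (r - s)) = (fun r => 'D_v psi (r - s)).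
  by apply/funext => r; exact: (derive_val (is_derive := dr r)).
split; last exact: E.
split; [|exact: (bounded_support_shift s bpsi)|by move=> r; case: (dr r)|].
- move=> r; apply: (@continuous_comp _ _ _ (fun r : V => r - s) psi); [exact: continuous_shift|exact: cpsi].
- rewrite E; split; last exact: (bounded_support_shift s bD).
  move=> r; apply: (@continuous_comp _ _ _ (fun r : V => r - s) ('D_v psi)); [exact: continuous_shift|exact: cD].
Qed.

Lemma bounded_supportM phi psi : bounded_support phi -> bounded_support psi ->
  bounded_support (fun x => phi x * psi x).
Proof.
move=> [mphi [M phiM phi0]] [mpsi [M' psiM psi0]]; split.
  exact: measurable_funM.
have M0 : 0 <= M by apply: le_trans (phiM 0).
have M'0 : 0 <= M' by apply: le_trans (psiM 0).
exists (M * M' + M) => x.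
  by rewrite normrM (le_trans (ler_pM _ _ (phiM x) (psiM x)))// lerDl.
move=> Mx; rewrite phi0 ?mul0r//; apply: le_lt_trans Mx.
by rewrite lerDr mulr_ge0.
Qed.

Lemma bounded_supportD phi psi : bounded_support phi -> bounded_support psi ->
  bounded_support (fun x => phi x + psi x).
Proof.
move=> bphi [mpsi [M psiM psi0]].
have : bounded_support (fun x => - psi x).
  split; first exact: measurable_funN.
  by exists M => x; [rewrite normrN|move=> /psi0 ->; rewrite oppr0].
move/(bounded_supportB bphi); congr bounded_support.
by apply/funext => x; rewrite opprK.
Qed.

Lemma C1_supportM phi psi v : C1_support v phi -> C1_support v psi ->
  C1_support v (fun r => phi r * psi r) /\
  'D_v (fun r => phi r * psi r) = (fun r => phi r * 'D_v psi r + psi r * 'D_v phi r).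
Proof.
move=> [c1 b1 d1 [cD1 bD1]] [c2 b2 d2 [cD2 bD2]].
have dr r : is_derive r v (fun r => phi r * psi r) (phi r * 'D_v psi r + psi r * 'D_v phi r).
  exact: (is_deriveM (DeriveDef (d1 r) erefl) (DeriveDef (d2 r) erefl)).
have E : 'D_v (fun r => phi r * psi r) = (fun r => phi r * 'D_v psi r + psi r * 'D_v phi r).
  by apply/funext => r; exact: (derive_val (is_derive := dr r)).
split; last exact: E.
split; [|exact: (bounded_supportM b1 b2)|by move=> r; case: (dr r)|].
- by move=> r; exact: cvgM (c1 r) (c2 r).
- rewrite E; split; last exact: (bounded_supportD (bounded_supportM b1 bD2) (bounded_supportM b2 bD1)).
  by move=> r; exact: cvgD (cvgM (c1 r) (cD2 r)) (cvgM (c2 r) (cD1 r)).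
Qed.

(** The derivative of the product has integral 0 by [Rintegral_derive]. *)
Lemma Rintegral_by_parts v phi psi dphi : C1_support v phi -> C1_support v psi ->
  'D_v phi = dphi ->
  \int[mu]_r (phi r * 'D_v psi r) = - \int[mu]_r (dphi r * psi r).
Proof.
move=> C1 C2 <-; have [C12 E] := C1_supportM C1 C2.
have := Rintegral_derive C12; rewrite E.
case: C1 => c1 b1 d1 [cD1 bD1]; case: C2 => c2 b2 d2 [cD2 bD2].
rewrite RintegralD//; last 2 first.
- exact: (bounded_support_integrable (bounded_supportM b1 bD2)).
- exact: (bounded_support_integrable (bounded_supportM b2 bD1)).
under [X in _ + X]eq_Rintegral do rewrite mulrC.
by move/eqP; rewrite addr_eq0 => /eqP.
Qed.

Lemma sqint_tensor d1 d2 (T1 : measurableType d1) (T2 : measurableType d2)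
    (m1 : {sigma_finite_measure set T1 -> \bar R})
    (m2 : {sigma_finite_measure set T2 -> \bar R}) (f : T1 -> R) (g : T2 -> R) :
  measurable_fun setT f -> measurable_fun setT g -> (sqint m2 g < +oo)%E ->
  (sqint (m1 \x m2)%E (fun p => (f p.1 * g p.2)%R) = sqint m1 f * sqint m2 g)%E.
Proof.
move=> mf mg gi.
have mfg : measurable_fun setT (fun p : T1 * T2 => f p.1 * g p.2).
  apply: measurable_funM.
    exact: (measurableT_comp mf measurable_fst).
  exact: (measurableT_comp mg measurable_snd).
rewrite (sqint_prod1 _ _ mfg).
under eq_integral => x _ do rewrite /= (sqintZ _ _ mg).
have G : sqint m2 g = (fine (sqint m2 g))%:E by rewrite fineK// ge0_fin_numE// sqint_ge0.
rewrite G ge0_integralZr//.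
- exact: measurable_sqE.
- by move=> x _; rewrite lee_fin sqr_ge0.
- by rewrite lee_fin fine_ge0// sqint_ge0.
Qed.

Lemma Lsq_tensor d1 d2 (T1 : measurableType d1) (T2 : measurableType d2)
    (m1 : {sigma_finite_measure set T1 -> \bar R})
    (m2 : {sigma_finite_measure set T2 -> \bar R}) (f : T1 -> R) (g : T2 -> R) :
  Lsq m1 f -> Lsq m2 g -> Lsq (m1 \x m2)%E (fun p => f p.1 * g p.2).
Proof.
move=> [mf fi] [mg gi]; split.
  apply: measurable_funM.
    exact: (measurableT_comp mf measurable_fst).
  exact: (measurableT_comp mg measurable_snd).
by rewrite sqint_tensor// lte_mul_pinfty// ?sqint_ge0// ge0_fin_numE// sqint_ge0.
Qed.

(** The supports confine r to radius M' and s to radius M + M', where the integrand is dominated by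
    a product of two square integrable tensors. *)
Lemma conv_mul_integrable f phi psi : Lsq mu f -> bounded_support phi -> bounded_support psi ->
  (mu \x mu)%E.-integrable setT (fun p => (f p.2 * phi (p.1 - p.2) * psi p.1)%:E).
Proof.
move=> Lf bphi bpsi; have [mphi [M phiM phi0]] := bphi; have [mpsi [M' psiM psi0]] := bpsi.
have M0 : 0 <= M by apply: le_trans (phiM 0).
have M'0 : 0 <= M' by apply: le_trans (psiM 0).
have Li K : Lsq mu (\1_(cball K)) by apply: (Lsq_indic (M := K)) => //; exact: measurable_cball.
have L1 := Lsq_tensor (Li M') Lf.
have L2 := Lsq_tensor (bounded_support_Lsq bpsi) (Li (M + M')).
have := integrableZl measurableT M (integrable_Lsq_mul L1 L2).
apply: le_integrable => //.
  apply/measurable_EFinP; apply: measurable_funM; last exact: (measurableT_comp mpsi measurable_fst).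
  apply: measurable_funM; first exact: (measurableT_comp Lf.1 measurable_snd).
  exact: (measurableT_comp mphi (@measurable_diff R N)).
move=> [r s] _; rewrite -EFinM /= lee_fin.
have [rM|rM] := leP `|r| M'; last by rewrite psi0// mulr0 normr0.
have [sM|sM] := leP `|s| (M + M'); last first.
  rewrite phi0 ?mulr0 ?mul0r ?normr0//.
  rewrite -(ltrD2r M'); apply: (lt_le_trans sM).
  have {1}-> : s = - (r - s) + r by rewrite opprB subrK.
  by rewrite (le_trans (ler_normD _ _))// normrN lerD2l.
rewrite !indicE !mem_set// mul1r mulr1 !normrM (ger0_norm M0).
rewrite [leLHS]mulrAC [leRHS]mulrC ler_wpM2l// mulr_ge0//.
Qed.

(** Fubini puts the integral over [r] inside; for fixed [s], integration by parts moves the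
    derivative from [phi] to the translate of [eta]. No derivative falls on [f]. *)
Lemma conv_by_parts v f eta phi : Lsq mu f -> C1_support v eta -> C1_support v phi ->
  \int[mu]_r (conv f eta r * 'D_v phi r) = - \int[mu]_r (conv f ('D_v eta) r * phi r).
Proof.
move=> Lf Ce Cphi; have [ce be de [cDe bDe]] := Ce; have [cp bp dp [cDp bDp]] := Cphi.
have key psi chi : bounded_support psi -> bounded_support chi ->
    \int[mu]_r (conv f psi r * chi r) = \int[mu]_s (f s * \int[mu]_r (psi (r - s) * chi r)).
  move=> bpsi bchi; have I := conv_mul_integrable Lf bpsi bchi.
  transitivity (\int[mu]_r \int[mu]_s (f s * psi (r - s) * chi r)).
    apply: eq_Rintegral => r _; rewrite RintegralZr//; exact: conv_integrable.
  rewrite (Rintegral_prod1 I) -(Rintegral_prod2 I).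
  apply: eq_Rintegral => s _ /=; rewrite -RintegralZl//.
    by apply: eq_Rintegral => r _; rewrite mulrA.
  apply: (bounded_support_integrable (phi := fun r => psi (r - s) * chi r)).
  by apply: bounded_supportM => //; exact: bounded_support_shift.
rewrite key// key// -RintegralN; apply: eq_Rintegral => s _.
have [Cs Es] := C1_support_shift s Ce.
have P := Rintegral_by_parts Cs Cphi Es.
exact: (etrans (congr1 (fun z => f s * z) P) (mulrN _ _)).
Qed.

End derivative_integral.

Section standard_mollifier.
Variables (R : realType) (N : nat).
Local Notation V := 'rV[R]_N.
Local Notation mu := (lebesgue_rV R N).

(** The sharpness index of the bump stays 0; only the cube shrinks with [k]. *)
Definition raw_mollifier (k : nat) : V -> R :=
  bump (@mx_coord R 1 N) (fun=> - k.+1%:R^-1) (fun=> k.+1%:R^-1) 0.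

Definition std_mollifier (k : nat) : V -> R :=
  fun x => (\int[mu]_y raw_mollifier k y)^-1 * raw_mollifier k x.

Lemma raw_mollifier_eq0 k x : k.+1%:R^-1 < `|x| -> raw_mollifier k x = 0.
Proof.
move=> kx; apply: bump_eq0 => xo.
suff : `|x| <= k.+1%:R^-1 by rewrite leNgt kx.
apply: mx_norm_leP => [|i j]; first by rewrite invr_ge0.
by apply/ltW; rewrite ltr_norml; exact: (xo (i, j)).
Qed.

Lemma raw_mollifier_test k : test_function (raw_mollifier k).
Proof.
apply: (@theta_class_test _ _ _ [set x | `|x| <= k.+1%:R^-1]).
- by apply: theta_class_bump; exact: affine_mx_coord.
- exact: compact_cball_mx.
- by move=> x /= /negP; rewrite -ltNge; exact: raw_mollifier_eq0.
Qed.

(** If the integral were 0, the function would vanish almost everywhere, while it is positive on a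
    cube of positive measure. *)
Lemma raw_mollifier_int_gt0 k : 0 < \int[mu]_y raw_mollifier k y.
Proof.
have b := test_function_bounded_support (raw_mollifier_test k).
have i := bounded_support_integrable b.
have r0 x : 0 <= raw_mollifier k x by exact: bump_ge0.
rewrite lt_neqAle Rintegral_ge0// andbT eq_sym; apply/negP => /eqP h.
have : (\int[mu]_x `|(EFin \o raw_mollifier k) x| = 0)%E.
  rewrite (_ : 0%E = (\int[mu]_x raw_mollifier k x)%:E); last by rewrite h.
  rewrite fineK; last exact: integrable_fin_num.
  by apply: eq_integral => x _; rewrite gee0_abs// lee_fin.
have mr : measurable_fun setT (EFin \o raw_mollifier k) by apply/measurable_EFinP; exact: b.1.
move/(ae_eq_integral_abs mu measurableT mr) => -[A [mA A0 hA]].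
have e0 : 0 < k.+1%:R^-1 :> R by rewrite invr_gt0.
have /andP[+ _] := @lebesgue_rV_cube R N _ e0.
rewrite lt0e => /andP[/eqP + _]; apply.
apply/eqP; rewrite eq_le measure_ge0 andbT -A0; apply: le_measure; rewrite ?inE//.
  exact: measurable_cube.
move=> x xc; apply: hA => /= /(_ Logic.I).
move=> [] /eqP; apply/negP; rewrite gt_eqF// /raw_mollifier /bump prodr_gt0// => -[i' j] _.
rewrite mul1r opprK; have := xc i' j; rewrite ltr_norml => /andP[h1 h2].
by rewrite mul1r mulr_gt0// theta_gt0// ?subr_gt0// /mx_coord /= -ltrBlDr sub0r.
Qed.

Lemma std_mollifierP k : mollifier (std_mollifier k).
Proof.
have b := test_function_bounded_support (raw_mollifier_test k).
have i := bounded_support_integrable b.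
have c0 := raw_mollifier_int_gt0 k.
split.
- have [mr [M rM r0]] := b.
  have M0 : 0 <= M by apply: le_trans (rM 0).
  split; first exact: measurable_funM.
  pose c := (\int[mu]_y raw_mollifier k y)^-1.
  have c'0 : 0 < c by rewrite invr_gt0.
  exists (c * M + M) => x.
    by rewrite normrM (ger0_norm (ltW c'0)) (@le_trans _ _ (c * M))// ?ler_wpM2l ?lerDl// ltW.
  move=> Mx; rewrite /std_mollifier r0 ?mulr0//.
  by apply: le_lt_trans Mx; rewrite lerDr mulr_ge0// ltW.
- by move=> x; rewrite /std_mollifier mulr_ge0 ?invr_ge0 ?(ltW c0)//; exact: bump_ge0.
(* Reflection exchanges the two factors belonging to each coordinate. *)
- move=> x; rewrite /std_mollifier; congr (_ * _); apply: eq_bigr => j _.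
  rewrite mulrC /mx_coord mxE !opprK.
  by congr (theta 0 _ * theta 0 _); ring.
- by rewrite RintegralZl// mulVf// gt_eqF.
Qed.

Lemma std_mollifier_eq0 k x : k.+1%:R^-1 < `|x| -> std_mollifier k x = 0.
Proof. by move=> kx; rewrite /std_mollifier raw_mollifier_eq0// mulr0. Qed.

Lemma std_mollifier_theta k : theta_class (std_mollifier k).
Proof.
apply: theta_classM; first exact: theta_class_cst.
by apply: theta_class_bump; exact: affine_mx_coord.
Qed.

Lemma std_mollifier_test k : test_function (std_mollifier k).
Proof.
apply: (@theta_class_test _ _ _ [set x | `|x| <= k.+1%:R^-1]).
- exact: std_mollifier_theta.
- exact: compact_cball_mx.
- by move=> x /= /negP; rewrite -ltNge; exact: std_mollifier_eq0.
Qed.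

End standard_mollifier.

(** * Local completeness of the space of square integrable functions *)

Section L2_completeness.
Context d (T : measurableType d) (R : realType) (m : {measure set T -> \bar R}).
Variables (A : nat -> set T) (u : nat -> T -> R).
Hypothesis mA : forall n, measurable (A n).
Hypothesis ndA : forall n p, (n <= p)%N -> A n `<=` A p.
Hypothesis AT : \bigcup_n A n = setT.
Hypothesis mu : forall k, measurable_fun setT (u k).
Hypothesis Lu : forall k n, Lsq m (fun x => u k x * \1_(A n) x).
Hypothesis cauchy_u : forall n (e : R), 0 < e -> exists K, forall k l,
  (K <= k)%N -> (K <= l)%N ->
  (sqint m (fun x => (u k x - u l x) * \1_(A n) x)%R <= e%:E)%E.

(* The subsequence satisfies [\sum_j 4^j * |u (s j.+1) - u (s j)|^2 < oo] almost
   everywhere, hence converges pointwise; Fatou's lemma does the rest. *)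
Lemma locally_L2_complete : exists (f : T -> R) (s : nat -> nat),
  [/\ measurable_fun setT f, forall k, (k <= s k)%N,
      forall n, Lsq m (fun x => f x * \1_(A n) x) &
      forall n, ecvg0 (fun k => sqint m (fun x => (u (s k) x - f x) * \1_(A n) x)%R)].
Proof.
(* Against the weights 4^j these bounds leave the summable 2^(-j). *)
have e0 j : 0 < (8^-1) ^+ j :> R by rewrite exprn_gt0// invr_gt0.
have /choice[K hK] : forall j, exists K, forall k l, (K <= k)%N -> (K <= l)%N ->
    (sqint m (fun x => (u k x - u l x) * \1_(A j) x)%R <= ((8^-1) ^+ j)%:E)%E.
  by move=> j; exact: cauchy_u.
(* Dominates [j] and every [K i] with [i <= j], without first making [K] monotone. *)
pose s j := (j + \sum_(i < j.+1) K i)%N.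
have js j : (j <= s j)%N by rewrite leq_addr.
have Ks j l : (j <= l)%N -> (K j <= s l)%N.
  move=> jl; rewrite /s (bigD1 (Ordinal (jl : (j < l.+1)%N)))//= addnC -addnA.
  exact: leq_addr.
pose dd j x := (u (s j.+1) x - u (s j) x) * \1_(A j) x.
have mdd j : measurable_fun setT (dd j).
  by apply: measurable_funM; [exact: measurable_funB|exact: measurable_indic].
have dle j : (sqint m (dd j) <= ((8^-1) ^+ j)%:E)%E by apply: hK; apply: Ks.
pose h x := (\sum_(j <oo) ((4 ^+ j) * (dd j x) ^+ 2)%:E)%E.
have h0 x : (0 <= h x)%E.
  by apply: nneseries_ge0 => j _ _; rewrite lee_fin mulr_ge0 ?sqr_ge0// exprn_ge0.
have mh : measurable_fun setT h.
  apply: ge0_emeasurable_sum.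
    by move=> j x _ _; rewrite lee_fin mulr_ge0 ?sqr_ge0// exprn_ge0.
  by move=> j _; apply/measurable_EFinP; apply: measurable_funM => //; exact: measurable_funX.
have ih : (\int[m]_x h x < +oo)%E.
  rewrite integral_nneseries//; last 2 first.
  - by move=> j; apply/measurable_EFinP; apply: measurable_funM => //; exact: measurable_funX.
  - by move=> j x _; rewrite lee_fin mulr_ge0 ?sqr_ge0// exprn_ge0.
  apply: (@le_lt_trans _ _ (\sum_(j <oo) ((2^-1) ^+ j)%:E)%E).
    apply: lee_nneseries => j _.
      by move=> _; apply: integral_ge0 => x _; rewrite lee_fin mulr_ge0 ?sqr_ge0// exprn_ge0.
    under eq_integral do rewrite EFinM.
    rewrite ge0_integralZl_EFin//; last 2 first.
    - by move=> x _; rewrite lee_fin sqr_ge0.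
    - exact: measurable_sqE.
    apply: (@le_trans _ _ ((4 ^+ j)%:E * ((8^-1) ^+ j)%:E)%E).
      by apply: lee_wpmul2l; [rewrite lee_fin exprn_ge0|exact: dle].
    rewrite -EFinM lee_fin -exprMn.
    have -> : 4 * 8^-1 = 2^-1 :> R by field.
    by [].
  rewrite (@eq_eseriesr _ _ (fun j => (2 / (2 ^ (j + 1))%:R)%:E)).
    by rewrite (cvg_lim _ (@cvg_geometric_eseries_half R 2 0))// ltry.
  move=> j _; congr EFin.
  by rewrite natrX exprD expr1 exprVn; field; rewrite expf_neq0.
pose good x := (h x < +oo)%E.
have aegood : {ae m, forall x, good x}.
  have : m.-integrable setT h.
    apply/integrableP; split=> //.
    by under eq_integral do rewrite gee0_abs//.
  move/(integrable_ae measurableT); apply: filterS => x /(_ Logic.I).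
  by rewrite ge0_fin_numE.
have ucvg x : good x -> cvgn (fun j => u (s j) x).
  move=> gx; pose H := fine (h x).
  have hH : h x = H%:E by rewrite fineK// ge0_fin_numE.
  have H0 : 0 <= H by exact: fine_ge0.
  have dH j : 4 ^+ j * dd j x ^+ 2 <= H.
    rewrite -lee_fin -hH.
    have P i : (0 <= ((4 ^+ i) * (dd i x) ^+ 2)%:E)%E.
      by rewrite lee_fin mulr_ge0 ?sqr_ge0// exprn_ge0.
    have := @nneseries_lim_ge R (fun i => ((4 ^+ i) * (dd i x) ^+ 2)%:E) xpredT 0 j.+1 (fun i _ _ => P i).
    apply: le_trans; rewrite big_nat_recr//= leeDr//.
    by apply: sume_ge0 => i _; exact: P.
  (* The bound on squares gives sqrt(H) 2^(-j); the cruder 1 + H avoids the root. *)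
  have dH2 j : `|dd j x| <= (1 + H) * (2^-1) ^+ j.
    have P2 : 0 < 2 ^+ j :> R by rewrite exprn_gt0.
    rewrite exprVn ler_pdivlMr// -(ger0_norm (ltW P2)) -normrM.
    rewrite -(@ler_pXn2r _ 2) ?nnegrE ?addr_ge0// real_normK ?num_real//.
    rewrite exprMn -exprM mulnC exprM (_ : 2 ^+ 2 = 4 :> R); last by ring.
    rewrite mulrC; apply: le_trans (dH j) _.
    by have := sqr_ge0 H; nra.
  have [n0 _ An0] : (\bigcup_n A n) x by rewrite AT.
  (* From the index [n0] on, the indicators in [dd] equal 1 at [x], so [dd] is the increment of
     [v]. *)
  pose v j := u (s (j + n0)%N) x.
  suff : cvgn v by move/cvg_ex => [l vl]; apply/cvg_ex; exists l; move: vl; rewrite (cvg_shiftn n0 (fun j => u (s j) x)).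
  have vd j : `|v j.+1 - v j| <= (1 + H) * (2^-1) ^+ j.
    have -> : v j.+1 - v j = dd (j + n0)%N x.
      rewrite /dd indicE mem_set ?mulr1 /v ?addSn//.
      by apply: ndA An0; exact: leq_addl.
    apply: le_trans (dH2 _) _; rewrite ler_wpM2l ?addr_ge0//.
    rewrite exprD ler_piMr ?exprn_ge0 ?invr_ge0//.
    by rewrite exprn_ile1 ?invr_ge0// invf_le1// ler1n.
  have cs : cvgn (series (telescope v)).
    apply: normed_cvg; apply: (@series_le_cvg _ _ (geometric (1 + H) 2^-1)) => //.
    - by move=> j /=.
    - by move=> j /=; rewrite mulr_ge0 ?addr_ge0// exprn_ge0 ?invr_ge0.
    - by apply: is_cvg_geometric_series; rewrite ger0_norm ?invr_ge0// invf_lt1// ltr1n.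
  rewrite (_ : v = fun j => v 0%N + series (telescope v) j); last first.
    by apply/funext => j; exact: eq_sum_telescope.
  by apply: is_cvgD => //; exact: is_cvg_cst.
(* The limit superior is defined and measurable everywhere, and is the limit at every good point. *)
pose f x := fine (limn_esup (fun j => (u (s j) x)%:E)).
have mf : measurable_fun setT f.
  apply: measurableT_comp => //; apply: measurable_fun_limn_esup => j.
  by apply/measurable_EFinP.
have fcvg x : good x -> (fun j => u (s j) x) @ \oo --> f x.
  move=> /ucvg ux; rewrite /f.
  have H : (fun j => (u (s j) x)%:E) @ \oo --> (limn (fun j => u (s j) x))%:E.
    by apply: cvg_EFin; [exact: nearW|exact: ux].
  by rewrite (cvg_limn_einf_sup H).2.
(* Fatou's lemma in the second index of the Cauchy bound; since [A n] is contained in [A k], the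
   bound at stage [k] applies on [A n]. *)
have key n k : (n <= k)%N ->
  (sqint m (fun x => (u (s k) x - f x) * \1_(A n) x)%R <= ((8^-1) ^+ k)%:E)%E.
  move=> nk; pose g l x := (((u (s k) x - u (s (l + k)%N) x) * \1_(A n) x) ^+ 2)%:E.
  have mg l : measurable_fun setT (g l).
    apply: measurable_sqE; apply: measurable_funM; first exact: measurable_funB.
    exact: measurable_indic.
  have g0 l x : setT x -> (0 <= g l x)%E by move=> _; rewrite lee_fin sqr_ge0.
  apply: (@le_trans _ _ (\int[m]_x limn_einf (g ^~ x))%E).
    rewrite le_eqVlt; apply/orP; left; apply/eqP; apply: ge0_ae_eq_integral => //.
    - apply: measurable_sqE; apply: measurable_funM; first exact: measurable_funB.
      exact: measurable_indic.
    - rewrite /limn_einf; apply/measurableT_comp => //; apply: measurable_fun_limn_esup => l.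
      by apply/measurableT_comp => //; exact: mg.
    - by move=> x _; rewrite lee_fin sqr_ge0.
    - move=> x _; rewrite limn_einf_lim; apply: lime_ge; first exact: is_cvg_einfs.
      by apply: nearW => k0; apply: le_ereal_inf_tmp => _ [l _ <-]; exact: g0.
    apply: filterS aegood => x gx _.
    have H : g ^~ x @ \oo --> (((u (s k) x - f x) * \1_(A n) x) ^+ 2)%:E.
      apply: cvg_EFin; first exact: nearW.
      have h1 : (fun l => (u (s k) x - u (s (l + k)%N) x) * \1_(A n) x) @ \oo -->
          ((u (s k) x - f x) * \1_(A n) x).
        apply: cvgMl; apply: cvgB; first exact: cvg_cst.
        by have := fcvg x gx; rewrite -(cvg_shiftn k (fun j => u (s j) x)).
      rewrite expr2 (_ : fine \o _ = (fun l => (u (s k) x - u (s (l + k)%N) x) * \1_(A n) x) \*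
        (fun l => (u (s k) x - u (s (l + k)%N) x) * \1_(A n) x)); first exact: cvgM.
      by apply/funext => l /=; rewrite expr2.
    by rewrite (cvg_limn_einf_sup H).1.
  apply: le_trans (fatou m measurableT mg g0) _.
  have gle l : (\int[m]_x g l x <= ((8^-1) ^+ k)%:E)%E.
    apply: le_trans (hK k (s k) (s (l + k)%N) _ _); [|exact: Ks|by apply: Ks; rewrite leq_addl].
    apply: le_sqint.
    - by apply: measurable_funM; [exact: measurable_funB|exact: measurable_indic].
    - by apply: measurable_funM; [exact: measurable_funB|exact: measurable_indic].
    move=> x; rewrite !normrM ler_wpM2l// !indicE.
    have [xn|xn] := boolP (x \in A n); last by rewrite normr0.
    by rewrite mem_set//; apply: ndA nk _ _; rewrite inE in xn.
  rewrite limn_einf_lim; apply: lime_le; first exact: is_cvg_einfs.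
  apply: nearW => l; apply: le_trans (gle l).
  by apply: ereal_inf_lbound; exists l => /=.
exists f, s; split => //.
- move=> n; have -> : (fun x => f x * \1_(A n) x) = (fun x => u (s n) x * \1_(A n) x -
     (u (s n) x - f x) * \1_(A n) x) by apply/funext => x; ring.
  apply: LsqB; first exact: Lu.
  split; first by apply: measurable_funM; [exact: measurable_funB|exact: measurable_indic].
  by apply: le_lt_trans (key n n (leqnn n)) _; exact: ltry.
- move=> n e e_gt0.
  have G : (fun k => (8^-1 : R) ^+ k) @ \oo --> (0 : R).
    by apply: cvg_expr; rewrite ger0_norm ?invr_ge0// invf_lt1// ltr1n.
  have /cvgrPdist_le/(_ e e_gt0)[N0 _ hN0] := G.
  exists (maxn n N0) => k; rewrite geq_max => /andP[nk Nk].
  apply: le_trans (key n k nk) _; rewrite lee_fin.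
  by have := hN0 k Nk; rewrite sub0r normrN ger0_norm// exprn_ge0// invr_ge0.
Qed.

End L2_completeness.

(** * Gram forms of kernels *)

Section product_sigma_finite.
Context d1 d2 (T1 : measurableType d1) (T2 : measurableType d2) (R : realType).
Variables (m1 : {sigma_finite_measure set T1 -> \bar R})
  (m2 : {sigma_finite_measure set T2 -> \bar R}).

Lemma product_sigma_finite : sigma_finite setT (m1 \x m2)%E.
Proof.
have /sigma_finiteP[F [FT ndF Foo]] := sigma_finiteT m1.
have /sigma_finiteP[G [GT ndG Goo]] := sigma_finiteT m2.
exists (fun n => F n `*` G n).
  apply/esym; rewrite -subTset => -[x y] _.
  have [i _ Fix] : (\bigcup_i F i) x by rewrite -FT.
  have [j _ Gjy] : (\bigcup_i G i) y by rewrite -GT.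
  exists (maxn i j) => //; split.
    by have /subsetPset := ndF i (maxn i j) (leq_maxl _ _); exact.
  by have /subsetPset := ndG j (maxn i j) (leq_maxr _ _); exact.
move=> n; have [? ?] := Foo n; have [? ?] := Goo n; split; first exact: measurableX.
by rewrite product_measure1E// lte_mul_pinfty// ge0_fin_numE.
Qed.

(* Bundled by hand: the canonical sigma-finite structure keyed on [\x] is the one
   of products of subprobabilities. *)
Definition sigma_finite_prod : {sigma_finite_measure set (T1 * T2)%type -> \bar R} :=
  HB.pack (m1 \x m2)%E (Measure_isSigmaFinite.Build _ _ _ (m1 \x m2)%E product_sigma_finite).

End product_sigma_finite.

Notation "m1 \xs m2" := (sigma_finite_prod m1 m2) (at level 40, m2 at level 39).

Definition sigma_finite_count (R : realType) : {sigma_finite_measure set nat -> \bar R} :=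
  HB.pack (@counting nat R) (Measure_isSigmaFinite.Build _ _ _ (@counting nat R) (sigma_finite_counting R)).

Section swap.
Context d1 d2 (T1 : measurableType d1) (T2 : measurableType d2) (R : realType).
Variables (m1 : {sigma_finite_measure set T1 -> \bar R})
  (m2 : {sigma_finite_measure set T2 -> \bar R}).
Implicit Type f : T1 * T2 -> R.

Let measurable_comp_swap f : measurable_fun setT f ->
  measurable_fun setT (fun p : T2 * T1 => f (p.2, p.1)).
Proof.
move=> mf; apply: (measurableT_comp mf); apply/measurable_fun_pairP; split.
  exact: measurable_snd.
exact: measurable_fst.
Qed.

Lemma sqint_swap f : measurable_fun setT f ->
  sqint (m2 \x m1)%E (fun p => f (p.2, p.1)) = sqint (m1 \x m2)%E f.
Proof.
move=> mf; have mf' : measurable_fun setT (fun p : T2 * T1 => f (p.2, p.1)).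
  exact: measurable_comp_swap.
by rewrite (sqint_prod1 _ _ mf') (sqint_prod2 _ _ mf).
Qed.

Lemma Lsq_swap f : Lsq (m1 \x m2)%E f -> Lsq (m2 \x m1)%E (fun p => f (p.2, p.1)).
Proof.
move=> [mf fi]; split; last by rewrite sqint_swap.
exact: measurable_comp_swap.
Qed.

Lemma Rintegral_swap_Lsq f g : Lsq (m1 \x m2)%E f -> Lsq (m1 \x m2)%E g ->
  \int[(m2 \x m1)%E]_p (f (p.2, p.1) * g (p.2, p.1)) = \int[(m1 \x m2)%E]_p (f p * g p).
Proof.
move=> Lf Lg; have I := integrable_Lsq_mul (Lsq_swap Lf) (Lsq_swap Lg).
have J := integrable_Lsq_mul Lf Lg.
by rewrite -(Rintegral_prod1 I) -(Rintegral_prod2 J).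
Qed.

Lemma integrable_Rintegral2 f : (m1 \x m2)%E.-integrable setT (EFin \o f) ->
  m2.-integrable setT (fun y => (\int[m1]_x f (x, y))%:E).
Proof.
move=> fi; have mf : measurable_fun setT f by apply/measurable_EFinP; exact: measurable_int fi.
have mR : measurable_fun setT (fun y => \int[m1]_x f (x, y)) by exact: measurable_Rintegral2.
apply/integrableP; split; first exact/measurable_EFinP.
rewrite (@ae_eq_integral _ _ _ _ _ (abse \o fubini_G m1 (EFin \o f)))//.
- have /integrableP[mF iF] := fi.
  have mA : measurable_fun setT (fun p : T1 * T2 => `|(f p)%:E|%E) by exact: measurableT_comp.
  rewrite (fubini_tonelli2 (fun p => `|(f p)%:E|%E)) in iF; [|exact: mA|by []].
  apply: le_lt_trans iF; apply: ge0_le_integral => //.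
  + by move=> y _; exact: abse_ge0.
  + by apply: measurableT_comp => //; exact: measurable_fubini_G fi.
  + exact: (measurable_fun_fubini_tonelli_G (fun p => `|(f p)%:E|%E)).
  + move=> y _; apply: le_abse_integral => //.
    by apply/measurable_EFinP; exact: measurable_section2.
- by apply: measurableT_comp => //; exact/measurable_EFinP.
- by apply: measurableT_comp => //; exact: measurable_fubini_G fi.
- apply: filterS (ae_EFin_Rintegral2 fi) => x fx _; rewrite /fubini_G [RHS]/=.
  by rewrite -[in RHS]fx abse_EFin.
Qed.

End swap.

Lemma eq_ae_Rintegral d (T : measurableType d) (R : realType)
    (m : {measure set T -> \bar R}) (f g : T -> R) :
  measurable_fun setT f -> measurable_fun setT g ->
  {ae m, forall x, f x = g x} -> \int[m]_x f x = \int[m]_x g x.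
Proof.
move=> mf mg fg; congr fine; apply: ae_eq_integral => //; try exact/measurable_EFinP.
by apply: filterS fg => x ->.
Qed.

Section gram.
Context d (Z : measurableType d) (R : realType) (N : nat).
Local Notation V := 'rV[R]_N.
Local Notation mu := (lebesgue_rV R N).
Variable m : {sigma_finite_measure set Z -> \bar R}.
Implicit Types (a b : Z * V -> R) (phi psi : V -> R).
Local Notation mm := (m \x mu)%E.
Local Notation m3 := (m \x (mu \xs mu))%E.

(** The integral operator with kernel [a]. Applied to a reflected translate it gives the
    convolution, so Gram identities for [kint] are identities for [kconv] at every point. *)
Definition kint a phi (z : Z) : R := \int[mu]_s (a (z, s) * phi s).

Lemma kconvE a phi z r : kconv a phi (z, r) = kint a (fun s => phi (r - s)) z.
Proof. by []. Qed.

Lemma measurable_kint a phi : measurable_fun setT a -> measurable_fun setT phi ->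
  measurable_fun setT (kint a phi).
Proof.
move=> ma mphi; apply: (measurable_Rintegral1 mu (f := fun p => a p * phi p.2)).
by apply: measurable_funM => //; exact: (measurableT_comp mphi measurable_snd).
Qed.

Lemma measurable_fst_section a : measurable_fun setT a ->
  measurable_fun setT (fun p : Z * (V * V) => a (p.1, p.2.1)).
Proof.
move=> ma; apply: (measurableT_comp ma); apply/measurable_fun_pairP; split => /=.
  exact: measurable_fst.
exact: (measurableT_comp measurable_fst measurable_snd).
Qed.

Lemma measurable_snd_section a : measurable_fun setT a ->
  measurable_fun setT (fun p : Z * (V * V) => a (p.1, p.2.2)).
Proof.
move=> ma; apply: (measurableT_comp ma); apply/measurable_fun_pairP; split => /=.
  exact: measurable_fst.
exact: (measurableT_comp measurable_snd measurable_snd).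
Qed.

Lemma sqint_section (a : Z * V -> R) psi (F : Z * (V * V) -> R) :
  Lsq mm a -> Lsq mu psi -> measurable_fun setT F ->
  (forall z, Lsq mu (fun s => a (z, s)) ->
     sqint (mu \xs mu) (fun q => F (z, q)) = (sqint mu (fun s => a (z, s))%R * sqint mu psi)%E) ->
  Lsq m3 F.
Proof.
move=> La Lpsi mF hF; split => //.
have G : sqint mu psi = (fine (sqint mu psi))%:E.
  by rewrite fineK// ge0_fin_numE ?sqint_ge0//; case: Lpsi.
rewrite (sqint_prod1 _ _ mF).
rewrite (ge0_ae_eq_integral (g := fun z => sqint mu (fun s => a (z, s))%R * (fine (sqint mu psi))%:E)%E)//.
- rewrite ge0_integralZr//.
  + rewrite -(sqint_prod1 _ _ La.1) lte_mul_pinfty ?sqint_ge0//; last by rewrite ltry.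
    by rewrite ge0_fin_numE ?sqint_ge0//; case: La.
  + by apply: (measurable_sqint1 mu La.1).
  + by move=> x _; exact: sqint_ge0.
  + by rewrite lee_fin fine_ge0// sqint_ge0.
- by apply: (measurable_sqint1 (mu \xs mu) mF).
- by apply: emeasurable_funM => //; apply: (measurable_sqint1 mu La.1).
- by move=> x _; exact: sqint_ge0.
- by move=> x _; rewrite mule_ge0 ?sqint_ge0// lee_fin fine_ge0// sqint_ge0.
- by apply: filterS (ae_Lsq1 La) => z Lz _; rewrite hF// -G.
Qed.

Lemma Lsq_section_left a psi : Lsq mm a -> Lsq mu psi ->
  Lsq m3 (fun p => a (p.1, p.2.1) * psi p.2.2).
Proof.
move=> La Lpsi; apply: (sqint_section La Lpsi).
  apply: measurable_funM; first exact: (measurable_fst_section La.1).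
  by apply: (measurableT_comp Lpsi.1); exact: (measurableT_comp measurable_snd measurable_snd).
by move=> z Lz; exact: (@sqint_tensor R _ _ _ _ mu mu (fun s => a (z, s)) psi Lz.1 Lpsi.1 Lpsi.2).
Qed.

Lemma Lsq_section_right b phi : Lsq mm b -> Lsq mu phi ->
  Lsq m3 (fun p => phi p.2.1 * b (p.1, p.2.2)).
Proof.
move=> Lb Lphi; apply: (sqint_section Lb Lphi).
  apply: measurable_funM; last exact: (measurable_snd_section Lb.1).
  by apply: (measurableT_comp Lphi.1); exact: (measurableT_comp measurable_fst measurable_snd).
move=> z Lz; rewrite muleC.
exact: (@sqint_tensor R _ _ _ _ mu mu phi (fun s => b (z, s)) Lphi.1 Lz.1 Lz.2).
Qed.

(** This grouping matters: each of the two factors is square integrable in all three variables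
    together, so their product is integrable and Fubini applies. *)
Let F a b phi psi (p : Z * (V * V)) :=
  (a (p.1, p.2.1) * psi p.2.2) * (phi p.2.1 * b (p.1, p.2.2)).

Let intF a b phi psi : Lsq mm a -> Lsq mm b -> Lsq mu phi -> Lsq mu psi ->
  m3.-integrable setT (EFin \o F a b phi psi).
Proof.
move=> La Lb Lphi Lpsi.
exact: (integrable_Lsq_mul (Lsq_section_left La Lpsi) (Lsq_section_right Lb Lphi)).
Qed.

Let sectF a b phi psi : Lsq mm a -> Lsq mm b -> Lsq mu phi -> Lsq mu psi ->
  {ae m, forall z, \int[(mu \xs mu)]_q F a b phi psi (z, q) = kint a phi z * kint b psi z}.
Proof.
move=> La Lb Lphi Lpsi.
apply: filterS2 (filterI (ae_Lsq1 La) (ae_Lsq1 Lb)) (filterI (ae_Lsq1 (Lsq_section_left La Lpsi))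
  (ae_Lsq1 (Lsq_section_right Lb Lphi))) => z [Lza Lzb] [L1 L2].
have I := integrable_Lsq_mul L1 L2.
rewrite -(Rintegral_prod1 I) /kint -RintegralZr//; last exact: (integrable_Lsq_mul Lza Lphi).
apply: eq_Rintegral => r _; rewrite -RintegralZl//; last exact: (integrable_Lsq_mul Lzb Lpsi).
by apply: eq_Rintegral => s _ /=; ring.
Qed.

Let measurable_sectF a b phi psi : Lsq mm a -> Lsq mm b -> Lsq mu phi -> Lsq mu psi ->
  measurable_fun setT (fun z => \int[(mu \xs mu)]_q F a b phi psi (z, q)).
Proof.
move=> La Lb Lphi Lpsi; apply: (measurable_Rintegral1 (mu \xs mu)).
by have /integrableP[/measurable_EFinP] := intF La Lb Lphi Lpsi.
Qed.

(** A square integrable kernel acts boundedly; here the square of [kint a phi] is, almost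
    everywhere, the section integral of the integrable [F a a phi phi]. *)
Lemma Lsq_kint a phi : Lsq mm a -> Lsq mu phi -> Lsq m (kint a phi).
Proof.
move=> La Lphi; have mk := measurable_kint La.1 Lphi.1; split=> //.
have /integrableP[mG iG] := integrable_Rintegral1 (intF La La Lphi Lphi).
rewrite /sqint (ge0_ae_eq_integral
  (g := fun z => `|(\int[(mu \xs mu)]_q F a a phi phi (z, q))%:E|%E))//.
- exact: measurable_sqE.
- by apply: measurableT_comp.
- by move=> x _; rewrite lee_fin sqr_ge0.
- apply: filterS (sectF La La Lphi Lphi) => z hz _.
  by rewrite hz abse_EFin ger0_norm ?expr2// -expr2 sqr_ge0.
Qed.

Let gram a b phi psi (q : V * V) := \int[m]_z (a (z, q.1) * b (z, q.2)) * (phi q.1 * psi q.2).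

Let measurable_gram a b phi psi : Lsq mm a -> Lsq mm b -> Lsq mu phi -> Lsq mu psi ->
  measurable_fun setT (gram a b phi psi).
Proof.
move=> La Lb Lphi Lpsi; apply: measurable_funM.
  apply: (measurable_Rintegral2 m (f := fun p : Z * (V * V) => a (p.1, p.2.1) * b (p.1, p.2.2))).
  by apply: measurable_funM; [exact: (measurable_fst_section La.1)|exact: (measurable_snd_section Lb.1)].
apply: measurable_funM.
  exact: (measurableT_comp Lphi.1 measurable_fst).
exact: (measurableT_comp Lpsi.1 measurable_snd).
Qed.

Let gram_ae a b phi psi : Lsq mm a -> Lsq mm b -> Lsq mu phi -> Lsq mu psi ->
  {ae (mu \xs mu), forall q, \int[m]_z F a b phi psi (z, q) = gram a b phi psi q}.
Proof.
move=> La Lb Lphi Lpsi; have I := intF La Lb Lphi Lpsi.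
apply: filterS (ae_integrable2 I) => -[r s] Iq; rewrite /gram /=.
(* Where this factor vanishes both sides are 0; elsewhere dividing by it yields the integrability
   required to pull it out of the integral. *)
have [c0|c0] := eqVneq (phi r * psi s) 0.
  rewrite c0 mulr0 (_ : (fun x => _) = cst 0) ?Rintegral_cst//.
    by rewrite mul0r.
  apply/funext => z; rewrite /F/=.
  transitivity (a (z, r) * b (z, s) * (phi r * psi s)); first by ring.
  by rewrite c0 mulr0.
rewrite -RintegralZr//; first by apply: eq_Rintegral => z _; rewrite /F/=; ring.
have := integrableZr measurableT (phi r * psi s)^-1 Iq.
apply: eq_integrable => // z _; rewrite /F/= -EFinM; congr EFin.
transitivity (a (z, r) * b (z, s) * (phi r * psi s) / (phi r * psi s)); first by congr (_ / _); ring.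
by rewrite mulfK.
Qed.

(** By Fubini the Gram form is an integral against the composed kernel, so it depends on that kernel
    only up to a null set of pairs. *)
Lemma kint_gram a b phi psi : Lsq mm a -> Lsq mm b -> Lsq mu phi -> Lsq mu psi ->
  \int[m]_z (kint a phi z * kint b psi z) =
  \int[(mu \xs mu)]_q (\int[m]_z (a (z, q.1) * b (z, q.2)) * (phi q.1 * psi q.2)).
Proof.
move=> La Lb Lphi Lpsi; have I := intF La Lb Lphi Lpsi.
rewrite -(@eq_ae_Rintegral _ _ _ _ (fun z => \int[(mu \xs mu)]_q F a b phi psi (z, q)))//; last 3 first.
- exact: measurable_sectF.
- exact: (measurable_funM (measurable_kint La.1 Lphi.1) (measurable_kint Lb.1 Lpsi.1)).
- exact: sectF.
rewrite (Rintegral_prod1 I) -(Rintegral_prod2 I); apply: eq_ae_Rintegral.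
- by apply: (measurable_Rintegral2 m); have /integrableP[/measurable_EFinP] := I.
- exact: (measurable_gram La Lb Lphi Lpsi).
- exact: gram_ae.
Qed.

Lemma integrable_gram a b phi psi : Lsq mm a -> Lsq mm b -> Lsq mu phi -> Lsq mu psi ->
  (mu \xs mu).-integrable setT
    (EFin \o (fun q => \int[m]_z (a (z, q.1) * b (z, q.2)) * (phi q.1 * psi q.2))).
Proof.
move=> La Lb Lphi Lpsi; have I := integrable_Rintegral2 (intF La Lb Lphi Lpsi).
have mg := measurable_gram La Lb Lphi Lpsi.
apply/integrableP; split; first exact/measurable_EFinP.
have [mI iI] := integrableP _ _ _ I; apply: le_lt_trans iI.
rewrite le_eqVlt; apply/orP; left; apply/eqP; apply: ae_eq_integral => //.
- by apply: measurableT_comp => //; exact/measurable_EFinP.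
- by apply: measurableT_comp.
- by apply: filterS (gram_ae La Lb Lphi Lpsi) => q E _; rewrite /= E.
Qed.

(** The exceptional [z] are those whose section is not square integrable, so the null set is the
    same for all [r]. *)
Lemma kconvB a phi psi : Lsq mm a -> bounded_support phi -> bounded_support psi ->
  {ae m, forall z, forall r, kconv a (fun x => phi x - psi x) (z, r) =
     kconv a phi (z, r) - kconv a psi (z, r)}.
Proof.
move=> La bphi bpsi; apply: filterS (ae_Lsq1 La) => z Lz r.
rewrite /kconv /conv/= -RintegralB//; [|exact: conv_integrable..].
by apply: eq_Rintegral => s _; rewrite mulrBr.
Qed.

End gram.

Section derivative_transfer.
Context dZ (Z : measurableType dZ) dW (W : measurableType dW) (R : realType) (N : nat).
Local Notation V := 'rV[R]_N.
Local Notation mu := (lebesgue_rV R N).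
Variables (m : {sigma_finite_measure set Z -> \bar R})
  (w : {sigma_finite_measure set W -> \bar R}).
Local Notation mm := (m \x mu)%E.
Local Notation ww := (w \x mu)%E.
Variables (a1 a2 : Z * V -> R) (b1 b2 : W * V -> R).
Hypotheses (La1 : Lsq mm a1) (La2 : Lsq mm a2) (Lb1 : Lsq ww b1) (Lb2 : Lsq ww b2).
Hypothesis gramE : forall phi psi, bounded_support phi -> bounded_support psi ->
  \int[m]_z (kint a1 phi z * kint a1 psi z) + \int[m]_z (kint a2 phi z * kint a2 psi z) =
  \int[w]_x (kint b1 phi x * kint b1 psi x) + \int[w]_x (kint b2 phi x * kint b2 psi x).

Let sqint_kint_sum phi : bounded_support phi ->
  (sqint m (kint a1 phi) + sqint m (kint a2 phi) =
   sqint w (kint b1 phi) + sqint w (kint b2 phi))%E.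
Proof.
move=> bphi; have Lphi := bounded_support_Lsq bphi.
rewrite (sqint_Rintegral (Lsq_kint La1 Lphi)) (sqint_Rintegral (Lsq_kint La2 Lphi)).
rewrite (sqint_Rintegral (Lsq_kint Lb1 Lphi)) (sqint_Rintegral (Lsq_kint Lb2 Lphi)).
by rewrite -!EFinD gramE.
Qed.

Let sqint_cut_kconv d (T : measurableType d) (q : {sigma_finite_measure set T -> \bar R})
    (a : T * V -> R) psi M : measurable_fun setT a -> measurable_fun setT psi ->
  sqint (q \x mu)%E (cut (kconv a psi) M) =
  (\int[mu]_r ((\1_(cball M) r ^+ 2)%:E * sqint q (kint a (fun s => psi (r - s))%R)))%E.
Proof.
move=> ma mpsi; have mk := measurable_kconv ma mpsi.
rewrite (sqint_prod2 _ _ (measurable_cut _ mk)); apply: eq_integral => r _.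
have -> : (fun x : T => cut (kconv a psi) M (x, r)) =
    (fun x => \1_(cball M) r * kint a (fun s => psi (r - s)) x).
  by apply/funext => x; rewrite /cut mulrC.
rewrite sqintZ//; apply: measurable_kint => //.
exact: (measurableT_comp mpsi (measurable_reflect r)).
Qed.

Let measurable_cut_kint d (T : measurableType d) (q : {sigma_finite_measure set T -> \bar R})
    (a : T * V -> R) psi M : measurable_fun setT a -> measurable_fun setT psi ->
  measurable_fun setT (fun r => ((\1_(cball M) r ^+ 2)%:E *
     sqint q (kint a (fun s => psi (r - s)%R)))%E : \bar R).
Proof.
move=> ma mpsi; apply: emeasurable_funM.
  apply/measurable_EFinP; apply: measurable_funX; apply: measurable_indic.
  exact: measurable_cball.
exact: (measurable_sqint2 q (measurable_kconv ma mpsi)).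
Qed.

Let cut_ge0 d (T : measurableType d) (q : {sigma_finite_measure set T -> \bar R})
    (a : T * V -> R) psi M r : (0 <= (\1_(cball M) r ^+ 2)%:E *
     sqint q (kint a (fun s => psi (r - s)%R)))%E.
Proof. by rewrite mule_ge0 ?sqint_ge0// lee_fin sqr_ge0. Qed.

(** The Gram identity for reflected translates is integrated over [r] in the ball. Only sums over
    real and imaginary parts agree, so the two components are controlled together. *)
Let sqint_cut_sum psi M : bounded_support psi ->
  (sqint mm (cut (kconv a1 psi) M) + sqint mm (cut (kconv a2 psi) M) =
   sqint ww (cut (kconv b1 psi) M) + sqint ww (cut (kconv b2 psi) M))%E.
Proof.
move=> bpsi; have [mpsi _] := bpsi.
rewrite (sqint_cut_kconv m M La1.1 mpsi) (sqint_cut_kconv m M La2.1 mpsi).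
rewrite (sqint_cut_kconv w M Lb1.1 mpsi) (sqint_cut_kconv w M Lb2.1 mpsi).
rewrite -(@ge0_integralD _ _ _ mu _ measurableT _ _ (fun r _ => cut_ge0 m a1 psi M r)
  (measurable_cut_kint m M La1.1 mpsi) (fun r _ => cut_ge0 m a2 psi M r)
  (measurable_cut_kint m M La2.1 mpsi)).
rewrite -(@ge0_integralD _ _ _ mu _ measurableT _ _ (fun r _ => cut_ge0 w b1 psi M r)
  (measurable_cut_kint w M Lb1.1 mpsi) (fun r _ => cut_ge0 w b2 psi M r)
  (measurable_cut_kint w M Lb2.1 mpsi)).
apply: eq_integral => r _.
have S := sqint_kint_sum (bounded_support_reflect r bpsi).
rewrite -[LHS]ge0_muleDr ?sqint_ge0// -[RHS]ge0_muleDr ?sqint_ge0//.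
exact: (congr1 (fun x => _ * x)%E S).
Qed.

Variable zeta : nat -> V -> R.
Hypothesis bzeta : forall k, bounded_support (zeta k).

Let cut_kconvB d (T : measurableType d) (q : {sigma_finite_measure set T -> \bar R})
    (a : T * V -> R) k l M : Lsq (q \x mu)%E a ->
  sqint (q \x mu)%E (fun p => cut (kconv a (zeta k)) M p - cut (kconv a (zeta l)) M p)%R =
  sqint (q \x mu)%E (cut (kconv a (fun x => zeta k x - zeta l x)) M).
Proof.
move=> La; have [mk _] := bzeta k; have [ml _] := bzeta l.
have mf : measurable_fun setT (fun p => cut (kconv a (zeta k)) M p - cut (kconv a (zeta l)) M p).
  by apply: measurable_funB; apply: measurable_cut; apply: measurable_kconv => //; case: La.
have mg : measurable_fun setT (cut (kconv a (fun x => zeta k x - zeta l x)) M).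
  by apply: measurable_cut; apply: measurable_kconv; [case: La|exact: measurable_funB].
apply: ae_eq_sqint => //; apply: ae_eq_prod1 => //.
apply: filterS (kconvB La (bzeta k) (bzeta l)) => z hz; apply/aeW => r.
by rewrite /cut hz mulrBl.
Qed.

Variables da1 da2 : Z * V -> R.
Hypotheses (mda1 : measurable_fun setT da1) (mda2 : measurable_fun setT da2).
Hypothesis Lc1 : forall k M, Lsq mm (cut (kconv a1 (zeta k)) M).
Hypothesis Lc2 : forall k M, Lsq mm (cut (kconv a2 (zeta k)) M).
Hypothesis cvg1 : forall M, ecvg0 (fun k => sqint mm (fun p => cut (kconv a1 (zeta k)) M p - cut da1 M p)%R).
Hypothesis cvg2 : forall M, ecvg0 (fun k => sqint mm (fun p => cut (kconv a2 (zeta k)) M p - cut da2 M p)%R).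

Let measurable_cut_zeta d (T : measurableType d) (a : T * V -> R) k M :
  measurable_fun setT a -> measurable_fun setT (cut (kconv a (zeta k)) M).
Proof.
by move=> ma; apply: measurable_cut; apply: measurable_kconv => //; case: (bzeta k).
Qed.

Let cauchy_a a da M (e : R) : 0 < e -> measurable_fun setT a -> measurable_fun setT da ->
  ecvg0 (fun k => sqint mm (fun p => cut (kconv a (zeta k)) M p - cut da M p)%R) ->
  exists K, forall k l, (K <= k)%N -> (K <= l)%N ->
  (sqint mm (fun p => cut (kconv a (zeta k)) M p - cut (kconv a (zeta l)) M p)%R <= e%:E)%E.
Proof.
move=> e0 ma mda ca; have e4 : 0 < e / 4 by rewrite divr_gt0.
have [K hK] := ca _ e4; exists K => k l Kk Kl.
have mB j : measurable_fun setT (fun p => cut (kconv a (zeta j)) M p - cut da M p).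
  by apply: measurable_funB; [exact: measurable_cut_zeta|exact: measurable_cut].
rewrite (_ : (fun p => _) = (fun p => (cut (kconv a (zeta k)) M p - cut da M p) -
    (cut (kconv a (zeta l)) M p - cut da M p))); last by apply/funext => p; ring.
apply: le_trans (sqintB mm (mB k) (mB l)) _.
apply: (@le_trans _ _ (2%:E * ((e / 4)%:E + (e / 4)%:E))%E).
  by apply: lee_wpmul2l => //; apply: leeD; exact: hK.
by rewrite -EFinD -EFinM lee_fin; lra.
Qed.

Let cauchy_sum M (e : R) : 0 < e -> exists K, forall k l, (K <= k)%N -> (K <= l)%N ->
  (sqint ww (fun p => cut (kconv b1 (zeta k)) M p - cut (kconv b1 (zeta l)) M p)%R +
   sqint ww (fun p => cut (kconv b2 (zeta k)) M p - cut (kconv b2 (zeta l)) M p)%R <= e%:E)%E.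
Proof.
move=> e0; have e2 : 0 < e / 2 by rewrite divr_gt0.
have [K1 h1] := cauchy_a e2 La1.1 mda1 (@cvg1 M).
have [K2 h2] := cauchy_a e2 La2.1 mda2 (@cvg2 M).
exists (maxn K1 K2) => k l; rewrite !geq_max => /andP[k1 k2] /andP[l1 l2].
rewrite (cut_kconvB _ _ _ Lb1) (cut_kconvB _ _ _ Lb2) -sqint_cut_sum; last exact: bounded_supportB.
rewrite -(cut_kconvB _ _ _ La1) -(cut_kconvB _ _ _ La2).
apply: le_trans (leeD (h1 k l k1 l1) (h2 k l k2 l2)) _.
by rewrite -EFinD lee_fin; lra.
Qed.

Let Lsq_b k M : Lsq ww (cut (kconv b1 (zeta k)) M) /\ Lsq ww (cut (kconv b2 (zeta k)) M).
Proof.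
have S : (sqint ww (cut (kconv b1 (zeta k)) M) + sqint ww (cut (kconv b2 (zeta k)) M) < +oo)%E.
  by rewrite -sqint_cut_sum//; apply: lte_add_pinfty; [case: (Lc1 k M)|case: (Lc2 k M)].
split; split.
- exact: (measurable_cut_zeta k M Lb1.1).
- by refine (le_lt_trans _ S); rewrite leeDl// sqint_ge0.
- exact: (measurable_cut_zeta k M Lb2.1).
- by refine (le_lt_trans _ S); rewrite leeDr// sqint_ge0.
Qed.

Let strip (n : nat) : set (W * V) := setT `*` cball n%:R.

Let strip_cut (b : W * V -> R) n : (fun p => b p * \1_(strip n) p) = cut b n%:R.
Proof.
apply/funext => p; rewrite /cut !indicE; congr (_ * (nat_of_bool _)%:R).
by apply/idP/idP; rewrite !inE /strip /=; tauto.
Qed.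

(** A given subsequence [s] is refined, so that [b1] and [b2] can be made to converge along a common
    one. *)
Let complete (b : W * V -> R) (s : nat -> nat) : measurable_fun setT b ->
  (forall k, (k <= s k)%N) -> (forall k M, Lsq ww (cut (kconv b (zeta k)) M)) ->
  (forall M (e : R), 0 < e -> exists K, forall k l, (K <= k)%N -> (K <= l)%N ->
    (sqint ww (fun p => cut (kconv b (zeta k)) M p - cut (kconv b (zeta l)) M p)%R <= e%:E)%E) ->
  exists db (t : nat -> nat), [/\ measurable_fun setT db, forall k, (k <= t k)%N,
    forall n : nat, Lsq ww (cut db n%:R) &
    forall n : nat, ecvg0 (fun k => sqint ww (fun p =>
      cut (kconv b (zeta (s (t k)))) n%:R p - cut db n%:R p)%R)].
Proof.
move=> mb ks Lb cb.
have [| | | | | |f [t [mf kt Lf cf]]] := @locally_L2_complete _ (W * V)%type R ww strip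
    (fun k => kconv b (zeta (s k))).
- by move=> n; apply: measurableX => //; exact: measurable_cball.
- move=> n p np [x r] [_ /= rn]; split => //.
  by rewrite /cball /= in rn *; apply: le_trans rn _; rewrite ler_nat.
- rewrite -subTset => -[x r] _; exists (Num.bound `|r|) => //; split => //=.
  by rewrite /cball /=; apply/ltW/archi_boundP.
- by move=> k; apply: measurable_kconv => //; case: (bzeta (s k)).
- by move=> k n; rewrite strip_cut.
- move=> n e e0; have [K hK] := cb n%:R e e0; exists K => k l Kk Kl.
  rewrite (_ : (fun p => _) = (fun p => cut (kconv b (zeta (s k))) n%:R p -
      cut (kconv b (zeta (s l))) n%:R p)).
    by apply: hK; [exact: leq_trans Kk (ks k)|exact: leq_trans Kl (ks l)].
  by apply/funext => p; rewrite -!strip_cut mulrBl.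
exists f, t; split => //.
- by move=> n; rewrite -strip_cut.
- move=> n; apply: ecvg0_le (cf n) => k.
  rewrite (_ : (fun p => _) = (fun x => (kconv b (zeta (s (t k))) x - f x) * \1_(strip n) x))//.
  by apply/funext => p; rewrite -!strip_cut mulrBl.
Qed.

(* By [gramE], the squared norms of [kint a phi] and [kint b phi] agree, so the
   Cauchy property of [kconv a (zeta k)] passes to [kconv b (zeta k)]. *)
Lemma derivative_transfer : exists db1 db2 (s : nat -> nat),
  [/\ measurable_fun setT db1, measurable_fun setT db2, forall k, (k <= s k)%N,
    forall n : nat, Lsq ww (cut db1 n%:R) /\ Lsq ww (cut db2 n%:R) &
    forall n : nat,
      ecvg0 (fun k => sqint ww (fun p => cut (kconv b1 (zeta (s k))) n%:R p - cut db1 n%:R p)%R) /\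
      ecvg0 (fun k => sqint ww (fun p => cut (kconv b2 (zeta (s k))) n%:R p - cut db2 n%:R p)%R)].
Proof.
have [| | | |db1 [s1 [m1 ks1 L1 c1]]] := @complete b1 id.
- by case: Lb1.
- by [].
- move=> k M; exact: (Lsq_b k M).1.
- move=> M e e0; have [K hK] := cauchy_sum M e0; exists K => k l Kk Kl.
  by apply: le_trans (hK k l Kk Kl); rewrite leeDl// sqint_ge0.
have [| | | |db2 [s2 [m2 ks2 L2 c2]]] := @complete b2 s1.
- by case: Lb2.
- by [].
- move=> k M; exact: (Lsq_b k M).2.
- move=> M e e0; have [K hK] := cauchy_sum M e0; exists K => k l Kk Kl.
  by apply: le_trans (hK k l Kk Kl); rewrite leeDr// sqint_ge0.
exists db1, db2, (s1 \o s2); split => //.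
- by move=> k; apply: leq_trans (ks2 k) (ks1 _).
- by move=> n; split; [exact: (ecvg0_sub ks2 (c1 n))|exact: c2].
Qed.

Lemma Lsq_cut_transfer k M :
  Lsq ww (cut (kconv b1 (zeta k)) M) /\ Lsq ww (cut (kconv b2 (zeta k)) M).
Proof. exact: Lsq_b. Qed.

End derivative_transfer.

Section cut_convergence.
Context d (Z : measurableType d) (R : realType) (N : nat).
Local Notation V := 'rV[R]_N.
Local Notation mu := (lebesgue_rV R N).
Variable m : {sigma_finite_measure set Z -> \bar R}.
Local Notation mm := (m \x mu)%E.

(** Convergence in L^2(Z x V_loc); balls of integer radius suffice because they exhaust V. *)
Definition cut_cvg (u : nat -> Z * V -> R) (f : Z * V -> R) : Prop := forall n : nat,
  [/\ forall k, Lsq mm (cut (u k) n%:R), Lsq mm (cut f n%:R) &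
    ecvg0 (fun k => sqint mm (fun p => cut (u k) n%:R p - cut f n%:R p)%R)].

Lemma cut_cvg_sub u f (s : nat -> nat) : (forall k, (k <= s k)%N) ->
  cut_cvg u f -> cut_cvg (u \o s) f.
Proof.
by move=> ks uf n; have [h1 h2 h3] := uf n; split => //=; exact: (ecvg0_sub ks h3).
Qed.

Lemma cut_in (u : Z * V -> R) M z r : cball M r -> cut u M (z, r) = u (z, r).
Proof. by move=> Mr; rewrite /cut indicE mem_set// mulr1. Qed.

Lemma cut_out (u : Z * V -> R) M z r : ~ cball M r -> cut u M (z, r) = 0.
Proof. by move=> Mr; rewrite /cut indicE memNset// mulr0. Qed.

Lemma kconv_cut_cvg_self a (eta : nat -> V -> R) : (forall k, mollifier (eta k)) ->
  (forall k x, k.+1%:R^-1 < `|x| -> eta k x = 0) -> measurable_fun setT a ->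
  (forall M, Lsq mm (cut a M)) -> cut_cvg (fun k => kconv a (eta k)) a.
Proof.
move=> me e0 ma La n; split=> // [k|]; first exact: Lsq_cut_kconv.
exact: kconv_cut_cvg.
Qed.

Lemma Lsq_cut a M : Lsq mm a -> Lsq mm (cut a M).
Proof.
move=> La; have [ma _] := La; apply: le_Lsq La => [|p]; last exact: cut_le.
exact: measurable_cut.
Qed.

Lemma cut_cvg_ae (u u' : nat -> Z * V -> R) f : cut_cvg u f ->
  (forall k, measurable_fun setT (u' k)) ->
  (forall k, {ae mm, forall p, u k p = u' k p}) -> cut_cvg u' f.
Proof.
move=> uf mu' uu' n; have [h1 h2 h3] := uf n; split => // [k|].
  split; first exact: measurable_cut.
  rewrite -(@ae_eq_sqint _ _ _ _ (cut (u k) n%:R)); first by case: (h1 k).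
  - by case: (h1 k).
  - exact: measurable_cut.
  - by apply: filterS (uu' k) => p; rewrite /cut => ->.
apply: ecvg0_le h3 => k.
rewrite -(@ae_eq_sqint _ _ _ _ (fun p => cut (u k) n%:R p - cut f n%:R p)) => //.
- by apply: measurable_funB; [case: (h1 k)|case: h2].
- by apply: measurable_funB; [exact: measurable_cut|case: h2].
- by apply: filterS (uu' k) => p; rewrite /cut => ->.
Qed.

Lemma inner_cut_cvg (u v : nat -> Z * V -> R) f g (n : nat) : cut_cvg u f -> cut_cvg v g ->
  L1cvg mu (fun k r => \int[m]_z (cut (u k) n%:R (z, r) * cut (v k) n%:R (z, r)))
    (fun r => \int[m]_z (cut f n%:R (z, r) * cut g n%:R (z, r))).
Proof.
move=> /(_ n)[Lu Lf uf] /(_ n)[Lv Lg vg]; exact: (inner_L1cvg Lu Lv Lf Lg uf vg).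
Qed.

Lemma measurable_inner_cut (u v : Z * V -> R) M : Lsq mm (cut u M) -> Lsq mm (cut v M) ->
  measurable_fun setT (fun r => \int[m]_z (cut u M (z, r) * cut v M (z, r))).
Proof.
move=> Lu Lv; apply: (measurable_Rintegral2 m (f := fun p => cut u M p * cut v M p)).
by apply: measurable_funM; [case: Lu|case: Lv].
Qed.

End cut_convergence.

Section diagonal_identity.
Context dZ (Z : measurableType dZ) dW (W : measurableType dW) (R : realType) (N : nat).
Local Notation V := 'rV[R]_N.
Local Notation mu := (lebesgue_rV R N).
Variables (m : {sigma_finite_measure set Z -> \bar R})
  (w : {sigma_finite_measure set W -> \bar R}).

(* The mollified identities hold for every [r] and pass to the limit in [L^1_loc]. *)
Lemma diagonal_identity (u1 v1 u2 v2 : nat -> Z * V -> R) (f1 g1 f2 g2 : Z * V -> R)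
    (x1 y1 x2 y2 : nat -> W * V -> R) (h1 k1 h2 k2 : W * V -> R) :
  cut_cvg m u1 f1 -> cut_cvg m v1 g1 -> cut_cvg m u2 f2 -> cut_cvg m v2 g2 ->
  cut_cvg w x1 h1 -> cut_cvg w y1 k1 -> cut_cvg w x2 h2 -> cut_cvg w y2 k2 ->
  (forall k r, \int[m]_z (u1 k (z, r) * v1 k (z, r)) + \int[m]_z (u2 k (z, r) * v2 k (z, r)) =
    \int[w]_z (x1 k (z, r) * y1 k (z, r)) + \int[w]_z (x2 k (z, r) * y2 k (z, r))) ->
  {ae mu, forall r, \int[m]_z (f1 (z, r) * g1 (z, r)) + \int[m]_z (f2 (z, r) * g2 (z, r)) =
    \int[w]_z (h1 (z, r) * k1 (z, r)) + \int[w]_z (h2 (z, r) * k2 (z, r))}.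
Proof.
move=> uf1 vg1 uf2 vg2 xh1 yk1 xh2 yk2 E.
have L d (T : measurableType d) (q : {sigma_finite_measure set T -> \bar R})
    (u : nat -> T * V -> R) f (n : nat) : cut_cvg q u f ->
    (forall k, Lsq (q \x mu)%E (cut (u k) n%:R)) /\ Lsq (q \x mu)%E (cut f n%:R).
  by move=> /(_ n)[].
have S d (T : measurableType d) (q : {measure set T -> \bar R}) (u v : T * V -> R) (n : nat) r :
    cball n%:R r ->
    \int[q]_z (cut u n%:R (z, r) * cut v n%:R (z, r)) = \int[q]_z (u (z, r) * v (z, r)).
  by move=> nr; apply: eq_Rintegral => z _; rewrite !cut_in.
suff H (n : nat) : {ae mu, forall r,
    \int[m]_z (cut f1 n%:R (z, r) * cut g1 n%:R (z, r)) +
    \int[m]_z (cut f2 n%:R (z, r) * cut g2 n%:R (z, r)) =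
    \int[w]_z (cut h1 n%:R (z, r) * cut k1 n%:R (z, r)) +
    \int[w]_z (cut h2 n%:R (z, r) * cut k2 n%:R (z, r))}.
  apply: filterS (ae_foralln H) => r Hr.
  have nr : cball (Num.bound `|r|)%:R r by rewrite /cball /=; apply/ltW/archi_boundP.
  by have := Hr (Num.bound `|r|); rewrite !S.
have I1 := inner_cut_cvg n uf1 vg1; have I2 := inner_cut_cvg n uf2 vg2.
have J1 := inner_cut_cvg n xh1 yk1; have J2 := inner_cut_cvg n xh2 yk2.
have [[a1 b1] [a2 b2]] := (L _ _ _ _ _ n uf1, L _ _ _ _ _ n vg1).
have [[a3 b3] [a4 b4]] := (L _ _ _ _ _ n uf2, L _ _ _ _ _ n vg2).
have [[c1 d1] [c2 d2]] := (L _ _ _ _ _ n xh1, L _ _ _ _ _ n yk1).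
have [[c3 d3] [c4 d4]] := (L _ _ _ _ _ n xh2, L _ _ _ _ _ n yk2).
have M1 k := measurable_inner_cut (a1 k) (a2 k).
have M2 k := measurable_inner_cut (a3 k) (a4 k).
have M3 k := measurable_inner_cut (c1 k) (c2 k).
have M4 k := measurable_inner_cut (c3 k) (c4 k).
have N1 := measurable_inner_cut b1 b2; have N2 := measurable_inner_cut b3 b4.
have N3 := measurable_inner_cut d1 d2; have N4 := measurable_inner_cut d3 d4.
apply: (L1cvg_unique (fun k => measurable_funD (M1 k) (M2 k))
  (fun k => measurable_funD (M3 k) (M4 k)) (measurable_funD N1 N2) (measurable_funD N3 N4)
  _ (L1cvgD M1 M2 N1 N2 I1 I2) (L1cvgD M3 M4 N3 N4 J1 J2)) => k.
apply: aeW => r; have [rn|rn] := pselect (cball n%:R r).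
  by rewrite /= !S.
have S0 d (T : measurableType d) (q : {measure set T -> \bar R}) (u v : T * V -> R) :
    \int[q]_z (cut u n%:R (z, r) * cut v n%:R (z, r)) = \int[q]_z (0 : R).
  by apply: eq_Rintegral => z _; rewrite !cut_out// mulr0.
by rewrite /= !S0 !Rintegral_cst//= !mul0r.
Qed.

End diagonal_identity.

(** * Weak derivatives as limits of convolutions, and slices of the ensemble *)

Section weak_limits.
Context d (X : measurableType d) (R : realType) (N : nat).
Local Notation V := 'rV[R]_N.
Local Notation mu := (lebesgue_rV R N).
Variable x : {sigma_finite_measure set X -> \bar R}.
Local Notation xx := (x \x mu)%E.

Lemma L1cvg_Rintegral_unique d' (T : measurableType d') (m : {measure set T -> \bar R})
    (u v : nat -> T -> R) f g :
  (forall k, m.-integrable setT (EFin \o u k)) -> (forall k, m.-integrable setT (EFin \o v k)) ->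
  m.-integrable setT (EFin \o f) -> m.-integrable setT (EFin \o g) ->
  L1cvg m u f -> L1cvg m v g -> (forall k, \int[m]_t u k t = \int[m]_t v k t) ->
  \int[m]_t f t = \int[m]_t g t.
Proof.
move=> iu iv If Ig uf vg E.
have key (h : nat -> T -> R) (l : T -> R) k (e : R) :
    m.-integrable setT (EFin \o h k) -> m.-integrable setT (EFin \o l) ->
    (\int[m]_t (`|h k t - l t|)%:E <= e%:E)%E -> `|\int[m]_t h k t - \int[m]_t l t| <= e.
  move=> ih il; rewrite -lee_fin; apply: le_trans; rewrite -RintegralB//.
  have I : m.-integrable setT (EFin \o (fun t => h k t - l t)).
    by have := integrableB measurableT ih il; apply: eq_integrable.
  by rewrite EFin_normr_Rintegral//; apply: le_abse_integral => //; case/integrableP: I.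
apply/eqP; rewrite -subr_eq0 -normr_le0; apply/ler_addgt0Pr => e e0; rewrite add0r.
have e2 : 0 < e / 2 by rewrite divr_gt0.
have [K1 h1] := uf _ e2; have [K2 h2] := vg _ e2; pose k := maxn K1 K2.
have a1 := key u f k _ (iu k) If (h1 k (leq_maxl _ _)).
have a2 := key v g k _ (iv k) Ig (h2 k (leq_maxr _ _)).
rewrite (_ : _ - _ = (\int[m]_t v k t - \int[m]_t g t) - (\int[m]_t u k t - \int[m]_t f t)).
  apply: le_trans (ler_normB _ _) _; lra.
by rewrite E; ring.
Qed.

(** For the mollified kernel the identity holds on almost every section by [conv_by_parts]. Both
    sides pass to the limit, since [phi] and [dphi] vanish outside a ball on which the convergence
    takes place. *)
Lemma weak_derivative_limit v (f df : X * V -> R) (eta : nat -> V -> R) (n : nat)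
    (phi dphi : X * V -> R) :
  Lsq xx f -> (forall k, C1_support v (eta k)) ->
  cut_cvg x (fun k => kconv f (eta k)) f ->
  cut_cvg x (fun k => kconv f ('D_v (eta k))) df ->
  Lsq xx phi -> Lsq xx dphi ->
  (forall y r, ~ cball n%:R r -> phi (y, r) = 0) ->
  (forall y r, ~ cball n%:R r -> dphi (y, r) = 0) ->
  (forall y, C1_support v (fun r => phi (y, r)) /\
     'D_v (fun r => phi (y, r)) = (fun r => dphi (y, r))) ->
  \int[xx]_p (f p * dphi p) = - \int[xx]_p (df p * phi p).
Proof.
move=> Lf Ceta /(_ n)[Le Lcf cf] /(_ n)[Lde Lcdf cdf] Lphi Ldphi phi0 dphi0 Cphi.
have cutM (h g : X * V -> R) : (forall y r, ~ cball n%:R r -> g (y, r) = 0) ->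
    (fun p => h p * g p) = (fun p => cut h n%:R p * g p).
  move=> g0; apply/funext => -[y r]; have [rn|rn] := pselect (cball n%:R r).
    by rewrite cut_in.
  by rewrite g0// !mulr0.
rewrite (cutM f _ dphi0) (cutM df _ phi0) -RintegralN.
have c0 (h : X * V -> R) : ecvg0 (fun k : nat => sqint xx (fun p => h p - h p)).
  move=> e e0; exists 0%N => k _; rewrite (_ : (fun p => _) = cst 0).
    rewrite /sqint (eq_integral (cst 0%E)) ?integral0 ?lee_fin ?ltW// => p _.
    by rewrite /= expr0n.
  by apply/funext => p; rewrite subrr.
have U1 := Lsq_mul_cvg (fun k => (Le k).1) (fun=> Ldphi.1) Lcf Ldphi cf (c0 dphi).
have U2 := Lsq_mul_cvg (fun k => (Lde k).1) (fun=> Lphi.1) Lcdf Lphi cdf (c0 phi).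
have iN (h : X * V -> R) : xx.-integrable setT (EFin \o h) ->
    xx.-integrable setT (EFin \o (fun p => - h p)).
  by move=> /integrableN; apply: eq_integrable.
have iU k := integrable_Lsq_mul (Le k) Ldphi.
have iV k := integrable_Lsq_mul (Lde k) Lphi.
apply: (L1cvg_Rintegral_unique iU (fun k => iN _ (iV k)) (integrable_Lsq_mul Lcf Ldphi)
  (iN _ (integrable_Lsq_mul Lcdf Lphi)) U1 (L1cvgN U2)) => k.
rewrite RintegralN -(Rintegral_prod1 (iU k)) -(Rintegral_prod1 (iV k)) -RintegralN.
have mI1 := integrable_Rintegral1 (iU k); have mI2 := integrable_Rintegral1 (iV k).
apply: eq_ae_Rintegral.
- by case/integrableP : mI1 => /measurable_EFinP.
- apply: measurable_funN.
  by case/integrableP : mI2 => /measurable_EFinP.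
apply: filterS (ae_Lsq1 Lf) => y Ly; have [Cy Dy] := Cphi y.
have P := conv_by_parts Ly (Ceta k) Cy.
transitivity (\int[mu]_r (conv (fun r => f (y, r)) (eta k) r * 'D_v (fun r => phi (y, r)) r)).
  apply: eq_Rintegral => r _; have /= -> := congr1 (fun h => h r) Dy.
  exact: (esym (congr1 (fun h => h (y, r)) (cutM (kconv f (eta k)) _ dphi0))).
rewrite P; congr (- _).
by apply: eq_Rintegral => r _; exact: (congr1 (fun h => h (y, r)) (cutM (kconv f ('D_v (eta k))) _ phi0)).
Qed.

End weak_limits.

Section countable_slices.
Context d (X : measurableType d) (R : realType) (N : nat).
Local Notation V := 'rV[R]_N.
Local Notation mu := (lebesgue_rV R N).
Variable x : {sigma_finite_measure set X -> \bar R}.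
Local Notation w := (sigma_finite_count R \xs x).

Lemma sqint_slices (F : (nat * X) * V -> R) : measurable_fun setT F ->
  sqint (w \x mu)%E F =
  (\sum_(i <oo) sqint (x \x mu)%E (fun p => F ((i, p.1), p.2)))%E.
Proof.
move=> mF; have mi i : measurable_fun setT (fun p : X * V => F ((i, p.1), p.2)).
  apply: (measurableT_comp mF); apply/measurable_fun_pairP; split; last exact: measurable_snd.
  by apply/measurable_fun_pairP; split; [exact: measurable_cst|exact: measurable_fst].
rewrite (sqint_prod1 _ _ mF).
have S := measurable_sqint1 mu mF.
rewrite -[LHS]/(\int[(sigma_finite_count R \x x)%E]_y sqint mu (fun r => F (y, r)))%E.
rewrite (fubini_tonelli1 (m1 := sigma_finite_count R) (m2 := x) (fun y => sqint mu (fun r => F (y, r))))//; last first.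
  by move=> y; exact: sqint_ge0.
rewrite -[LHS]/(\int[counting]_i fubini_F x (fun y => sqint mu (fun r => F (y, r))) i)%E.
rewrite ge0_integral_count; last by move=> i; apply: integral_ge0 => y _; exact: sqint_ge0.
by apply: eq_eseriesr => i _; rewrite (sqint_prod1 _ _ (mi i)).
Qed.

Lemma sqint_slice_le (F : (nat * X) * V -> R) i : measurable_fun setT F ->
  (sqint (x \x mu)%E (fun p => F ((i, p.1), p.2))%R <= sqint (w \x mu)%E F)%E.
Proof.
move=> mF; rewrite sqint_slices//.
have := @nneseries_lim_ge R (fun i => sqint (x \x mu)%E (fun p => F ((i, p.1), p.2))%R)
  xpredT 0 i.+1 (fun i _ _ => sqint_ge0 _ _).
by apply: le_trans; rewrite big_nat_recr//= leeDr//; apply: sume_ge0 => j _; exact: sqint_ge0.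
Qed.

Lemma measurable_slice (F : (nat * X) * V -> R) i : measurable_fun setT F ->
  measurable_fun setT (fun p : X * V => F ((i, p.1), p.2)).
Proof.
move=> mF; apply: (measurableT_comp mF); apply/measurable_fun_pairP; split; last exact: measurable_snd.
by apply/measurable_fun_pairP; split; [exact: measurable_cst|exact: measurable_fst].
Qed.

Lemma Lsq_slice (F : (nat * X) * V -> R) i : Lsq (w \x mu)%E F ->
  Lsq (x \x mu)%E (fun p => F ((i, p.1), p.2)).
Proof.
move=> [mF iF]; split; first exact: (measurable_slice i mF).
exact: le_lt_trans (sqint_slice_le i mF) iF.
Qed.

(** The squared norm of the whole family is a series over [i] that dominates each of its terms; this
    leads back from the ensemble to the single wavefunction. *)
Lemma cut_cvg_slice (u : nat -> (nat * X) * V -> R) f i : cut_cvg w u f ->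
  cut_cvg x (fun k p => u k ((i, p.1), p.2)) (fun p => f ((i, p.1), p.2)).
Proof.
move=> uf n; have [h1 h2 h3] := uf n; split => [k||].
- exact: (Lsq_slice i (h1 k)).
- exact: (Lsq_slice i h2).
- apply: ecvg0_le h3 => k.
  by apply: (@sqint_slice_le (fun p => cut (u k) n%:R p - cut f n%:R p) i); apply: measurable_funB; [case: (h1 k)|case: h2].
Qed.

End countable_slices.

(** * Weak derivatives of kernels *)

Section slice_derivatives.
Variables (R : realType) (V W : normedModType R).
Implicit Types (phi : V * W -> R).

Lemma is_derive_slice1 phi v r y d :
  is_derive (r, y) (v, 0) phi d <-> is_derive r v (fun r => phi (r, y)) d.
Proof.
have E : (fun h : R => phi (h *: (v, 0) + (r, y))) = (fun h => phi (h *: v + r, y)).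
  by apply/funext => h; congr (phi (_, _)); rewrite /= scaler0 add0r.
split => /is_derive_line H; apply/is_derive_line; last by rewrite E.
by rewrite -E.
Qed.

Lemma is_derive_slice2 phi v r y d :
  is_derive (r, y) (0, v) phi d <-> is_derive y v (fun y => phi (r, y)) d.
Proof.
have E : (fun h : R => phi (h *: (0, v) + (r, y))) = (fun h => phi (r, h *: v + y)).
  by apply/funext => h; congr (phi (_, _)); rewrite /= scaler0 add0r.
split => /is_derive_line H; apply/is_derive_line; last by rewrite E.
by rewrite -E.
Qed.

Lemma is_derive_reflect (f : W -> R) v r s d :
  is_derive (r - s) v f d -> is_derive s v (fun s => f (r - s)) (- d).
Proof.
move=> /is_derive_line fd; apply/is_derive_line.
have -> : (fun h : R => f (r - (h *: v + s))) =
    (fun h => (fun h => f (h *: v + (r - s))) (- h)).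
  by apply/funext => h; congr f; rewrite opprD addrA addrAC scaleNr addrC.
rewrite -mulN1r.
apply: (@is_derive_affine_comp R R (fun h => f (h *: v + (r - s))) -%R 0 1 (-1) d).
  by move=> x h; rewrite opprD mulrN1 [h *: 1]mulr1.
by rewrite oppr0.
Qed.

Lemma continuous_slice1 phi y : continuous phi -> continuous (fun r => phi (r, y)).
Proof.
move=> cphi r; apply: (continuous_comp (f := fun r => (r, y)) (g := phi)); last exact: cphi.
by apply: (cvg_pair (f := id) (g := fun=> y)); [exact: cvg_id|exact: cvg_cst].
Qed.

End slice_derivatives.

Section transferred_weak_derivative.
Variables (R : realType) (N p q : nat).
Local Notation V := 'rV[R]_N.
Local Notation X := 'M[R]_(p, q).
Local Notation mu := (lebesgue_rV R N).
Variable x : {sigma_finite_measure set X -> \bar R}.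
Hypothesis x_ball : forall M : R, (x [set A : X | (`|A| <= M)%R] < +oo)%E.

Lemma slice_C1_support (phi : V * X -> R) v y : test_function phi ->
  C1_support v (fun r => phi (r, y)) /\
  'D_v (fun r => phi (r, y)) = (fun r => 'D_(v, 0) phi (r, y)).
Proof.
move=> tphi; have [sphi _] := tphi; have tD := test_function_derive (v, 0) tphi.
have dphi r : is_derive r v (fun r => phi (r, y)) ('D_(v, 0) phi (r, y)).
  by apply/is_derive_slice1; apply: derivableP; exact: smooth_derivable.
have E : 'D_v (fun r => phi (r, y)) = (fun r => 'D_(v, 0) phi (r, y)).
  by apply/funext => r; exact: derive_val.
have bs (psi : V * X -> R) : test_function psi -> bounded_support (fun r => psi (r, y)).
  move=> tpsi; have cpsi := smooth_continuous tpsi.1.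
  split; first exact: continuous_measurable_mx (continuous_slice1 cpsi).
  have [M bM zM] := test_function_bounded tpsi; exists M => r; first exact: bM.
  move=> Mr; apply: zM; apply: (lt_le_trans Mr).
  by rewrite [leRHS]prod_normE/= le_max lexx.
split => //; split.
- exact: continuous_slice1 (smooth_continuous sphi).
- exact: bs.
- by move=> r; exact: ex_derive.
- by rewrite E; split; [exact: continuous_slice1 (smooth_continuous tD.1)|exact: (bs _ tD)].
Qed.

Lemma Lsq_test_function (phi : V * X -> R) : test_function phi ->
  Lsq (x \x mu)%E (fun z => phi (z.2, z.1)).
Proof.
move=> tphi; have [M bM zM] := test_function_bounded tphi.
have mphi := continuous_measurable_prod (smooth_continuous tphi.1).
have mphi' : measurable_fun setT (fun z : X * V => phi (z.2, z.1)).
  apply: (measurableT_comp mphi); apply/measurable_fun_pairP; split.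
    exact: measurable_snd.
  exact: measurable_fst.
have L1 : Lsq x (\1_[set A : X | `|A| <= M]).
  split; first by apply: measurable_indic; exact: measurable_cball_mx.
  rewrite /sqint (eq_integral (fun A => (\1_[set A : X | `|A| <= M] A)%:E)); last first.
    by move=> A _; rewrite indicE; case: (_ \in _); rewrite ?expr1n ?expr0n.
  by rewrite integral_indic ?setIT//; [exact: x_ball|exact: measurable_cball_mx].
have L2 : Lsq mu (\1_(@cball R N M)) by apply: (Lsq_indic (M := M)) => //; exact: measurable_cball.
have L3 := LsqZ M (Lsq_tensor L1 L2).
apply: (le_Lsq mphi' _ L3) => -[A r] /=; rewrite !indicE.
have [Ain|Ain] := boolP (A \in _); last first.
  rewrite zM ?normr0//; rewrite notin_setE /= in Ain.
  have : M < `|A| by rewrite ltNge; apply/negP.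
  by move=> /lt_le_trans; apply; rewrite [leRHS]prod_normE/= le_max lexx orbT.
have [rin|rin] := boolP (r \in _); last first.
  rewrite zM ?normr0//; rewrite notin_setE /= in rin.
  have : M < `|r| by rewrite ltNge; apply/negP.
  by move=> /lt_le_trans; apply; rewrite [leRHS]prod_normE/= le_max lexx.
by rewrite !mulr1; apply: le_trans (bM _) (ler_norm _).
Qed.

(** Kernels carry the differentiated variable second and wavefunctions carry it first, hence the
    exchanged coordinates. The radius [n] covers the supports of [phi] and of its derivative. *)
Lemma transferred_weak_derivative v (f df : X * V -> R) (eta : nat -> V -> R) :
  Lsq (x \x mu)%E f -> (forall k, C1_support v (eta k)) ->
  cut_cvg x (fun k => kconv f (eta k)) f ->
  cut_cvg x (fun k => kconv f ('D_v (eta k))) df ->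
  forall phi : V * X -> R, test_function phi ->
  \int[(mu \x x)%E]_z (f (z.2, z.1) * 'D_(v, 0) phi z) =
  - \int[(mu \x x)%E]_z (df (z.2, z.1) * phi z).
Proof.
move=> Lf Ce cf cdf phi tphi; have tD := test_function_derive (v, 0) tphi.
have L1 := Lsq_test_function tphi; have L2 := Lsq_test_function tD.
have [M bM zM] := test_function_bounded tphi; have [M' bM' zM'] := test_function_bounded tD.
pose n := maxn (Num.bound `|M|) (Num.bound `|M'|).
have nM : M <= n%:R.
  apply: (@le_trans _ _ (Num.bound `|M|)%:R); last by rewrite ler_nat leq_maxl.
  by apply: le_trans (ler_norm _) _; apply/ltW; exact: archi_boundP.
have nM' : M' <= n%:R.
  apply: (@le_trans _ _ (Num.bound `|M'|)%:R); last by rewrite ler_nat leq_maxr.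
  by apply: le_trans (ler_norm _) _; apply/ltW; exact: archi_boundP.
have P := @weak_derivative_limit _ X R N x v f df eta n (fun z => phi (z.2, z.1))
  (fun z => 'D_(v, 0) phi (z.2, z.1)) Lf Ce cf cdf L1 L2.
have z0 (psi : V * X -> R) K : (forall z, K < `|z| -> psi z = 0) -> K <= n%:R ->
    forall (y : X) (r : V), ~ cball n%:R r -> psi (r, y) = 0.
  move=> h Kn y r nr; apply: h; apply: (le_lt_trans Kn).
  apply: (@lt_le_trans _ _ `|r|); last by rewrite [leRHS]prod_normE/= le_max lexx.
  by rewrite ltNge; apply/negP.
have {P} := P (z0 _ _ zM nM) (z0 _ _ zM' nM') (fun y => slice_C1_support v y tphi).
have [_ Lcdf _] := cdf n.
(* Exchanging the variables requires square integrability, which [df] has only after truncation. *)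
have cutM : (fun z : X * V => df z * phi (z.2, z.1)) = (fun z => cut df n%:R z * phi (z.2, z.1)).
  apply/funext => -[y r]; have [rn|rn] := pselect (cball n%:R r).
    by rewrite cut_in.
  by rewrite (z0 _ _ zM nM)// !mulr0.
have cutM' : (fun z : V * X => df (z.2, z.1) * phi z) = (fun z => cut df n%:R (z.2, z.1) * phi z).
  apply/funext => -[r y]; exact: (congr1 (fun h => h (y, r)) cutM).
rewrite cutM cutM'.
rewrite -(Rintegral_swap_Lsq Lf L2) -(Rintegral_swap_Lsq Lcdf L1).
have E (g h : V * X -> R) : \int[(mu \x x)%E]_z (g z * h (z.1, z.2)) = \int[(mu \x x)%E]_z (g z * h z).
  by apply: eq_Rintegral => -[].
by rewrite (E (fun z => f (z.2, z.1)) ('D_(v, 0) phi)) (E (fun z => cut df n%:R (z.2, z.1)) phi).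
Qed.

End transferred_weak_derivative.

Section weak_derivative_convolution.
Variables (R : realType) (N : nat).
Local Notation V := 'rV[R]_N.
Local Notation mu := (lebesgue_rV R N).
Local Notation mm := (mu \x mu)%E.
Local Notation c := (@mx_coord R 1 N).

Lemma Lsq_integrable_obox (g : V -> R) a b : Lsq mu g ->
  mu.-integrable (obox c a b) (EFin \o g).
Proof.
move=> Lg; have mo : measurable (obox c a b).
  by apply: measurable_obox; exact: measurable_mx_coord.
have [k hk] := obox_mx_cball a b.
have L1 : Lsq mu (\1_(obox c a b)) by exact: (Lsq_indic mo hk).
rewrite integrable_mkcond//.
have := integrable_Lsq_mul Lg L1; apply: eq_integrable => // r _.
by rewrite patchE indicE; case: ifP => _; rewrite ?mulr1 ?mulr0.
Qed.

Variables (a da : V * V -> R) (v : V).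
Hypotheses (La : Lsq mm a) (mda : measurable_fun setT da)
  (Lda : forall M, Lsq mm (cut da M)).
Hypothesis ada : forall phi : V * V -> R, test_function phi ->
  \int[mm]_z (a z * 'D_(0, v) phi z) = - \int[mm]_z (da z * phi z).

Let chi A B k (u : V) : R := bump c A B k u.

Let test_tensor A B k j (r : V) :
  test_function (fun z : V * V => chi A B k z.1 * @std_mollifier R N j (r - z.2)).
Proof.
have [m hm] := obox_mx_cball A B.
apply: (@theta_class_test _ _ _ [set z : V * V | `|z.1| <= m%:R + (1 + `|r|) /\ `|z.2| <= m%:R + (1 + `|r|)]).
- apply: theta_classM.
    have ac i : affine_form (fun z : V * V => c i z.1).
      exact: (@affine_form_fst R V V (c i) (@affine_mx_coord R 1 N i)).
    exact: (theta_class_bump A B k ac).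
  apply: theta_classM; first exact: theta_class_cst.
  have ac i : affine_form (fun z : V * V => c i (r - z.2)).
    have -> : (fun z : V * V => c i (r - z.2)) = (fun z => (-1) * c i z.2 + c i r).
      by apply/funext => z; rewrite /mx_coord !mxE; ring.
    exact: (affine_form_comp (-1) (c i r) (@affine_form_snd R V V (c i) (@affine_mx_coord R 1 N i))).
  exact: (theta_class_bump _ _ _ ac).
- exact: compact_cbox.
- move=> z nz; apply/eqP; rewrite mulf_eq0; apply/negP => /negP; rewrite negb_or => /andP[c0 e0].
  apply: nz; split.
    apply: (@le_trans _ _ m%:R); last by rewrite lerDl addr_ge0.
    by apply: hm; apply: contrapT => no; rewrite /chi bump_eq0 ?eqxx in c0.
  have : `|r - z.2| <= 1.
    rewrite leNgt; apply/negP => h; rewrite std_mollifier_eq0 ?eqxx// in e0.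
    by apply: le_lt_trans h; rewrite invf_le1// ler1n.
  move=> h; rewrite (_ : z.2 = r - (r - z.2)); last by rewrite opprB addrC subrK.
  apply: le_trans (ler_normB _ _) _.
  by rewrite addrC -[leLHS]add0r; apply: lerD => //; rewrite lerD2r.
Qed.

(** For fixed [r], the weak derivative is tested on chi(u) eta(r - s); the sign produced by the
    reflection cancels that of integration by parts. Varying the bump chi identifies the two
    convolutions for almost every [u]. *)
Lemma weak_derivative_kconv j r :
  {ae mu, forall u, kconv a ('D_v (@std_mollifier R N j)) (u, r) = kconv da (@std_mollifier R N j) (u, r)}.
Proof.
pose eta := @std_mollifier R N j; have teta : test_function eta by exact: std_mollifier_test.
have [_ beta _ [_ bDeta]] := test_function_C1 v teta.
(* The mollifier at [r] sees only points of norm at most |r| + 1, so [da] may be replaced by a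
   square integrable truncation. *)
pose M : R := `|r| + 1.
have eM s : ~ cball M s -> eta (r - s) = 0.
  move=> ns; apply: std_mollifier_eq0; apply: (@le_lt_trans _ _ 1).
    by rewrite invf_le1// ler1n.
  have : M < `|s| by rewrite ltNge; apply/negP.
  have := ler_normB r (r - s); rewrite opprB addrCA subrr addr0 /M; lra.
have b1 := bounded_support_reflect r bDeta; have b2 := bounded_support_reflect r beta.
have L1 := bounded_support_Lsq b1; have L2 := bounded_support_Lsq b2.
have K1 := Lsq_kint La L1; have K2 := Lsq_kint (Lda M) L2.
have E2 u : kconv da eta (u, r) = kint (cut da M) (fun s => eta (r - s)) u.
  rewrite kconvE /kint; apply: eq_Rintegral => s _.
  have [Ms|Ms] := pselect (cball M s); first by rewrite cut_in.
  by rewrite eM// !mulr0.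
have LB := LsqB K1 K2.
suff : {ae mu, forall u, kint a (fun s => 'D_v eta (r - s)) u -
    kint (cut da M) (fun s => eta (r - s)) u = 0}.
  by apply: filterS => u /eqP; rewrite subr_eq0 => /eqP H; rewrite E2 -H.
apply: (@ae_eq0_bump _ V R mu _ c (@measurable_mx_coord R 1 N) (@mx_coord_gen R 1 N)).
- exact: LB.1.
- by move=> A B; exact: Lsq_integrable_obox.
move=> A B k.
have Lchi : Lsq mu (chi A B k).
  have [m hm] := obox_mx_cball A B.
  apply: bounded_support_Lsq; split.
    by apply: measurable_bump; exact: measurable_mx_coord.
  exists (1 + m%:R) => u.
    by rewrite ger0_norm ?bump_ge0//; apply: le_trans (bump_le1 _ _ _ _ _) _; rewrite lerDl.
  move=> mu'; apply: bump_eq0 => /hm /= um.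
  by have := lt_le_trans mu' um; rewrite addrC gtrDl ltr10.
have fub (h psi : _) (g : V * V -> R) : Lsq mm g -> Lsq mu psi ->
    h = (fun s => psi (r - s)) -> Lsq mu h ->
    \int[mm]_z (g z * (chi A B k z.1 * psi (r - z.2))) = \int[mu]_u (kint g h u * chi A B k u).
  move=> Lg _ -> Lh; have I := integrable_Lsq_mul Lg (Lsq_tensor Lchi Lh).
  rewrite -(Rintegral_prod1 I); apply: eq_ae_Rintegral.
  - by case/integrableP : (integrable_Rintegral1 I) => /measurable_EFinP.
  - exact: measurable_funM (measurable_kint Lg.1 Lh.1) Lchi.1.
  apply: filterS (ae_Lsq1 Lg) => u Lu.
  rewrite /kint -RintegralZr//; last exact: (integrable_Lsq_mul Lu Lh).
  by apply: eq_Rintegral => s _ /=; ring.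
have T := ada (test_tensor A B k j r).
have D (z : V * V) : 'D_(0, v) (fun z : V * V => chi A B k z.1 * eta (r - z.2)) z =
    - (chi A B k z.1 * 'D_v eta (r - z.2)).
  case: z => u s; apply: (@derive_val _ _ _ (u, s) (0, v)).
  apply/is_derive_slice2 => /=; rewrite -mulrN.
  apply: (@is_deriveZ _ _ _ (fun s => eta (r - s))).
  by apply: is_derive_reflect; apply: derivableP; exact: smooth_derivable teta.1.
have T' : \int[mm]_z (a z * (chi A B k z.1 * 'D_v eta (r - z.2))) =
    \int[mm]_z (cut da M z * (chi A B k z.1 * eta (r - z.2))).
  apply: oppr_inj; rewrite -RintegralN; transitivity (\int[mm]_z (a z *
      'D_(0, v) (fun z : V * V => chi A B k z.1 * eta (r - z.2)) z)).
    by apply: eq_Rintegral => z _; rewrite D mulrN.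
  rewrite T; congr (- _); apply: eq_Rintegral => -[u s] _.
  have [Ms|Ms] := pselect (cball M s); first by rewrite cut_in.
  have e0 : @std_mollifier R N j (r - s) = 0 := eM s Ms.
  by rewrite /= /eta e0 !mulr0.
rewrite (fub _ _ _ La (bounded_support_Lsq bDeta) erefl L1) in T'.
rewrite (fub _ _ _ (Lda M) (bounded_support_Lsq beta) erefl L2) in T'.
have S := RintegralB measurableT (integrable_Lsq_mul K1 Lchi) (integrable_Lsq_mul K2 Lchi).
rewrite T' subrr in S; rewrite -[RHS]S.
by apply: eq_Rintegral => u _; rewrite -mulrBl.
Qed.

End weak_derivative_convolution.

Section kernel_transfer.
Context (R : realType) (N p q : nat).
Local Notation V := 'rV[R]_N.
Local Notation X := 'M[R]_(p, q).
Local Notation mu := (lebesgue_rV R N).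
Variable x : {sigma_finite_measure set X -> \bar R}.
Hypothesis x_ball : forall M : R, (x [set A : X | (`|A| <= M)%R] < +oo)%E.
Local Notation W := (nat * X)%type.
Local Notation w := (sigma_finite_count R \xs x).
Local Notation mm := (mu \x mu)%E.
Local Notation ww := (w \x mu)%E.

(** Two products on each side: this shape covers both the real and the imaginary part of a complex
    Gram identity. *)
Lemma gram_transfer (a a' c c' : V * V -> R) (b b' d d' : W * V -> R) phi psi :
  Lsq mm a -> Lsq mm a' -> Lsq mm c -> Lsq mm c' ->
  Lsq ww b -> Lsq ww b' -> Lsq ww d -> Lsq ww d' ->
  {ae (mu \xs mu), forall z,
    \int[mu]_u (a (u, z.1) * a' (u, z.2)) + \int[mu]_u (c (u, z.1) * c' (u, z.2)) =
    \int[w]_u (b (u, z.1) * b' (u, z.2)) + \int[w]_u (d (u, z.1) * d' (u, z.2))} ->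
  Lsq mu phi -> Lsq mu psi ->
  \int[mu]_z (kint a phi z * kint a' psi z) + \int[mu]_z (kint c phi z * kint c' psi z) =
  \int[w]_z (kint b phi z * kint b' psi z) + \int[w]_z (kint d phi z * kint d' psi z).
Proof.
move=> La La' Lc Lc' Lb Lb' Ld Ld' E Lphi Lpsi.
rewrite (kint_gram La La' Lphi Lpsi) (kint_gram Lc Lc' Lphi Lpsi).
rewrite (kint_gram Lb Lb' Lphi Lpsi) (kint_gram Ld Ld' Lphi Lpsi).
have I1 := integrable_gram La La' Lphi Lpsi; have I2 := integrable_gram Lc Lc' Lphi Lpsi.
have I3 := integrable_gram Lb Lb' Lphi Lpsi; have I4 := integrable_gram Ld Ld' Lphi Lpsi.
rewrite -(RintegralD measurableT I1 I2) -(RintegralD measurableT I3 I4).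
apply: eq_ae_Rintegral.
- by apply: measurable_funD; [case/integrableP : I1|case/integrableP : I2] => /measurable_EFinP.
- by apply: measurable_funD; [case/integrableP : I3|case/integrableP : I4] => /measurable_EFinP.
- by apply: filterS E => z E; rewrite -!mulrDl E.
Qed.

Variables (a1 a2 : V * V -> R) (b1 b2 : W * V -> R).
Hypotheses (La1 : Lsq mm a1) (La2 : Lsq mm a2) (Lb1 : Lsq ww b1) (Lb2 : Lsq ww b2).
(** The real part, and with [gram_im] the imaginary part, of the equality of composed kernels, where
    a1 + i a2 is G and b1 + i b2 is H. *)
Hypothesis gram_re : {ae (mu \xs mu), forall z,
  \int[mu]_u (a1 (u, z.1) * a1 (u, z.2)) + \int[mu]_u (a2 (u, z.1) * a2 (u, z.2)) =
  \int[w]_u (b1 (u, z.1) * b1 (u, z.2)) + \int[w]_u (b2 (u, z.1) * b2 (u, z.2))}.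
Hypothesis gram_im : {ae (mu \xs mu), forall z,
  \int[mu]_u (a1 (u, z.1) * a2 (u, z.2)) + \int[mu]_u (- a2 (u, z.1) * a1 (u, z.2)) =
  \int[w]_u (b1 (u, z.1) * b2 (u, z.2)) + \int[w]_u (- b2 (u, z.1) * b1 (u, z.2))}.

Let eta k := @std_mollifier R N k.

Let bounded_eta k : bounded_support (eta k).
Proof. by case: (@std_mollifierP R N k). Qed.

Let kconv_eta d (T : measurableType d) (t : {sigma_finite_measure set T -> \bar R})
    (a : T * V -> R) : measurable_fun setT a -> (forall M, Lsq (t \x mu)%E (cut a M)) ->
  cut_cvg t (fun k => kconv a (eta k)) a.
Proof.
move=> ma La; apply: kconv_cut_cvg_self => //; first exact: std_mollifierP.
exact: std_mollifier_eq0.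
Qed.

Let kconv_eta_Lsq d (T : measurableType d) (t : {sigma_finite_measure set T -> \bar R})
    (a : T * V -> R) : Lsq (t \x mu)%E a -> cut_cvg t (fun k => kconv a (eta k)) a.
Proof. by move=> La; apply: kconv_eta => [|M]; [case: La|exact: Lsq_cut]. Qed.

Let kconv_kint (a a' c c' : V * V -> R) (b b' d d' : W * V -> R) :
  (forall phi psi, Lsq mu phi -> Lsq mu psi ->
  \int[mu]_z (kint a phi z * kint a' psi z) + \int[mu]_z (kint c phi z * kint c' psi z) =
  \int[w]_z (kint b phi z * kint b' psi z) + \int[w]_z (kint d phi z * kint d' psi z)) ->
  forall phi psi r, bounded_support phi -> bounded_support psi ->
  \int[mu]_z (kconv a phi (z, r) * kconv a' psi (z, r)) +
  \int[mu]_z (kconv c phi (z, r) * kconv c' psi (z, r)) =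
  \int[w]_z (kconv b phi (z, r) * kconv b' psi (z, r)) +
  \int[w]_z (kconv d phi (z, r) * kconv d' psi (z, r)).
Proof.
move=> E phi psi r bphi bpsi.
exact: (E _ _ (bounded_support_Lsq (bounded_support_reflect r bphi))
  (bounded_support_Lsq (bounded_support_reflect r bpsi))).
Qed.

Let re phi psi r (bphi : bounded_support phi) (bpsi : bounded_support psi) :=
  kconv_kint (fun phi psi => gram_transfer La1 La1 La2 La2 Lb1 Lb1 Lb2 Lb2 gram_re)
    r bphi bpsi.

Lemma diagonal_transfer : {ae mu, forall r,
  \int[mu]_u (a1 (u, r) * a1 (u, r)) + \int[mu]_u (a2 (u, r) * a2 (u, r)) =
  \int[w]_u (b1 (u, r) * b1 (u, r)) + \int[w]_u (b2 (u, r) * b2 (u, r))}.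
Proof.
have A1 := kconv_eta_Lsq La1; have A2 := kconv_eta_Lsq La2.
have B1 := kconv_eta_Lsq Lb1; have B2 := kconv_eta_Lsq Lb2.
apply: (diagonal_identity A1 A1 A2 A2 B1 B1 B2 B2) => k r.
exact: (re r (bounded_eta k) (bounded_eta k)).
Qed.

Variables (v : V) (da1 da2 : V * V -> R).
Hypotheses (mda1 : measurable_fun setT da1) (Lda1 : forall M, Lsq mm (cut da1 M)).
Hypotheses (mda2 : measurable_fun setT da2) (Lda2 : forall M, Lsq mm (cut da2 M)).
Hypothesis ada1 : forall phi : V * V -> R, test_function phi ->
  \int[mm]_z (a1 z * 'D_(0, v) phi z) = - \int[mm]_z (da1 z * phi z).
Hypothesis ada2 : forall phi : V * V -> R, test_function phi ->
  \int[mm]_z (a2 z * 'D_(0, v) phi z) = - \int[mm]_z (da2 z * phi z).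

Let zeta k := 'D_v (eta k).

Let C1_eta k : C1_support v (eta k).
Proof. exact: test_function_C1 (@std_mollifier_test R N k). Qed.

Let bounded_zeta k : bounded_support (zeta k).
Proof. by case: (C1_eta k) => _ _ _ []. Qed.

(** Up to null sets, convolving [a] with the derivative of [eta k] is mollifying [da], and
    mollifications converge. *)
Let kconv_zeta (a da : V * V -> R) : Lsq mm a -> measurable_fun setT da ->
  (forall M, Lsq mm (cut da M)) ->
  (forall phi : V * V -> R, test_function phi ->
  \int[mm]_z (a z * 'D_(0, v) phi z) = - \int[mm]_z (da z * phi z)) ->
  cut_cvg mu (fun k => kconv a (zeta k)) da.
Proof.
move=> La mda Lda ada; have ma := La.1.
have mka k : measurable_fun setT (kconv a (zeta k)).
  by apply: measurable_kconv => //; case: (bounded_zeta k).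
apply: (cut_cvg_ae (kconv_eta mda Lda)) => // k; apply: ae_eq_prod2 => //.
  by apply: measurable_kconv => //; case: (bounded_eta k).
by apply: aeW => r; apply: filterS (weak_derivative_kconv La Lda ada k r) => u ->.
Qed.

(** The last three clauses are the real and imaginary parts of the diagonal of G^* times its
    derivative, obtained by pairing [eta] with [zeta], and the squared derivative, obtained by
    pairing [zeta] with itself. All limits run along the subsequence on which the convolutions of
    [b1] and [b2] converge. *)
Lemma derivative_kernel_transfer : exists db1 db2 : W * V -> R,
  [/\ [/\ measurable_fun setT db1, measurable_fun setT db2,
        forall n : nat, Lsq ww (cut db1 n%:R) & forall n : nat, Lsq ww (cut db2 n%:R)],
    forall i (phi : V * X -> R), test_function phi ->
      (\int[(mu \x x)%E]_z (b1 ((i, z.2), z.1) * 'D_(v, 0) phi z) =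
        - \int[(mu \x x)%E]_z (db1 ((i, z.2), z.1) * phi z)) /\
      \int[(mu \x x)%E]_z (b2 ((i, z.2), z.1) * 'D_(v, 0) phi z) =
        - \int[(mu \x x)%E]_z (db2 ((i, z.2), z.1) * phi z),
    {ae mu, forall r,
      \int[mu]_u (a1 (u, r) * da1 (u, r)) + \int[mu]_u (a2 (u, r) * da2 (u, r)) =
      \int[w]_u (b1 (u, r) * db1 (u, r)) + \int[w]_u (b2 (u, r) * db2 (u, r))},
    {ae mu, forall r,
      \int[mu]_u (a1 (u, r) * da2 (u, r)) + \int[mu]_u (- a2 (u, r) * da1 (u, r)) =
      \int[w]_u (b1 (u, r) * db2 (u, r)) + \int[w]_u (- b2 (u, r) * db1 (u, r))} &
    {ae mu, forall r,
      \int[mu]_u (da1 (u, r) * da1 (u, r)) + \int[mu]_u (da2 (u, r) * da2 (u, r)) =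
      \int[w]_u (db1 (u, r) * db1 (u, r)) + \int[w]_u (db2 (u, r) * db2 (u, r))}].
Proof.
have z1 := kconv_zeta La1 mda1 Lda1 ada1; have z2 := kconv_zeta La2 mda2 Lda2 ada2.
have gE phi psi (bphi : bounded_support phi) (bpsi : bounded_support psi) :=
  gram_transfer La1 La1 La2 La2 Lb1 Lb1 Lb2 Lb2 gram_re
    (bounded_support_Lsq bphi) (bounded_support_Lsq bpsi).
(* Passes from integer radii to an arbitrary real radius, by comparison with a larger integer. *)
have cutN d (T : measurableType d) (t : {sigma_finite_measure set T -> \bar R}) u
    (f : T * V -> R) : cut_cvg t u f -> forall M, (forall k, measurable_fun setT (u k)) ->
    measurable_fun setT f -> (forall k, Lsq (t \x mu)%E (cut (u k) M)) /\
    ecvg0 (fun k => sqint (t \x mu)%E (fun p => cut (u k) M p - cut f M p)%R).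
  move=> uf M mu' mf.
  have Mn : M <= (Num.bound `|M|)%:R.
    by apply: le_trans (ler_norm _) _; apply/ltW; exact: archi_boundP.
  have le (g : T * V -> R) z : `|cut g M z| <= `|cut g (Num.bound `|M|)%:R z|.
    rewrite /cut !normrM ler_wpM2l// !indicE.
    have [zM|zM] := boolP (z.2 \in cball M); last by rewrite normr0.
    rewrite mem_set//; move: zM; rewrite inE /cball /= => /le_trans; exact.
  have [h1 h2 h3] := uf (Num.bound `|M|).
  split => [k|].
    by apply: (le_Lsq _ (le (u k)) (h1 k)); exact: measurable_cut.
  apply: ecvg0_le h3 => k; apply: le_sqint.
  - by apply: measurable_funB; exact: measurable_cut.
  - by apply: measurable_funB; exact: measurable_cut.
  - have E M' z : cut (u k) M' z - cut f M' z = cut (fun z => u k z - f z) M' z.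
      by rewrite /cut mulrBl.
    by move=> z; rewrite !E.
have mz (a : V * V -> R) k : Lsq mm a -> measurable_fun setT (kconv a (zeta k)).
  by move=> [ma _]; apply: measurable_kconv => //; case: (bounded_zeta k).
have C1 M := cutN _ _ _ _ _ z1 M (fun k => mz _ k La1) mda1.
have C2 M := cutN _ _ _ _ _ z2 M (fun k => mz _ k La2) mda2.
have L1 k M : Lsq mm (cut (kconv a1 (zeta k)) M) by case: (C1 M).
have L2 k M : Lsq mm (cut (kconv a2 (zeta k)) M) by case: (C2 M).
have [db1 [db2 [s [mdb1 mdb2 ks Ldb cdb]]]] := derivative_transfer La1 La2 Lb1 Lb2 gE
  bounded_zeta mda1 mda2 L1 L2 (fun M => (C1 M).2) (fun M => (C2 M).2).
have Lz k M := Lsq_cut_transfer La1 La2 Lb1 Lb2 gE bounded_zeta L1 L2 k M.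
have y1 : cut_cvg w (fun k => kconv b1 (zeta (s k))) db1.
  by move=> n; split; [move=> k; exact: (Lz _ _).1|exact: (Ldb n).1|exact: (cdb n).1].
have y2 : cut_cvg w (fun k => kconv b2 (zeta (s k))) db2.
  by move=> n; split; [move=> k; exact: (Lz _ _).2|exact: (Ldb n).2|exact: (cdb n).2].
have x1 := cut_cvg_sub ks (kconv_eta_Lsq Lb1); have x2 := cut_cvg_sub ks (kconv_eta_Lsq Lb2).
have u1 := cut_cvg_sub ks (kconv_eta_Lsq La1); have u2 := cut_cvg_sub ks (kconv_eta_Lsq La2).
have u2N := cut_cvg_sub ks (kconv_eta_Lsq (LsqN La2)).
have x2N := cut_cvg_sub ks (kconv_eta_Lsq (LsqN Lb2)).
have v1 := cut_cvg_sub ks z1; have v2 := cut_cvg_sub ks z2.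
exists db1, db2; split.
- by split => // n; case: (Ldb n).
- move=> i phi tphi; split.
    exact: (transferred_weak_derivative x_ball (Lsq_slice i Lb1) (fun k => C1_eta (s k))
      (cut_cvg_slice i x1) (cut_cvg_slice i y1) tphi).
  exact: (transferred_weak_derivative x_ball (Lsq_slice i Lb2) (fun k => C1_eta (s k))
      (cut_cvg_slice i x2) (cut_cvg_slice i y2) tphi).
- apply: (diagonal_identity u1 v1 u2 v2 x1 y1 x2 y2) => k r.
  exact: (re r (bounded_eta (s k)) (bounded_zeta (s k))).
- apply: (diagonal_identity u1 v2 u2N v1 x1 y2 x2N y1) => k r.
  exact: (kconv_kint (fun phi psi => gram_transfer La1 La2 (LsqN La2) La1
    Lb1 Lb2 (LsqN Lb2) Lb1 gram_im) r (bounded_eta (s k)) (bounded_zeta (s k))).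
- apply: (diagonal_identity v1 v1 v2 v2 y1 y1 y2 y2) => k r.
  exact: (re r (bounded_zeta (s k)) (bounded_zeta (s k))).
Qed.

End kernel_transfer.

(** * Ensembles *)

Section limits_of_sequences.
Variable R : realType.

(** Nonnegative terms are handled by the extended real series; in general [a] is split as |a| - (|a|
    - a). *)
Lemma Rintegral_count (a : nat -> R) :
  (@counting nat R).-integrable setT (EFin \o a) ->
  series a @ \oo --> \int[@counting nat R]_i a i.
Proof.
have pos (b : nat -> R) : (forall i, 0 <= b i) ->
    (@counting nat R).-integrable setT (EFin \o b) ->
    series b @ \oo --> \int[@counting nat R]_i b i.
  move=> b0 ib; have S : (\int[@counting nat R]_i (b i)%:E)%E \is a fin_num.
    exact: integrable_fin_num ib.
  have E := @ge0_integral_count R (fun i => (b i)%:E) (fun i => b0 i).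
  have C : (fun n => (series b n)%:E) @ \oo --> (\int[@counting nat R]_i b i)%:E.
    rewrite /Rintegral fineK// E.
    rewrite (_ : (fun n => _) = (fun n => \sum_(0 <= k < n) (b k)%:E)%E).
      by apply: is_cvg_nneseries => n _ _; rewrite lee_fin.
    by apply/funext => n; rewrite /series/= -sumEFin.
  exact: (fine_cvg C).
move=> ia; have ib : (@counting nat R).-integrable setT (EFin \o (fun i => `|a i|)).
  by have := integrable_abse ia; apply: eq_integrable.
have ic : (@counting nat R).-integrable setT (EFin \o (fun i => `|a i| - a i)).
  by have := integrableB measurableT ib ia; apply: eq_integrable.
have -> : \int[@counting nat R]_i a i =
    \int[@counting nat R]_i `|a i| - \int[@counting nat R]_i (`|a i| - a i).
  by rewrite RintegralB//; ring.
have -> : series a = (fun n => series (fun i => `|a i|) n - series (fun i => `|a i| - a i) n).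
  by apply/funext => n; rewrite /series/= -sumrB; apply: eq_bigr => i _; ring.
by apply: cvgB; apply: pos => // i; rewrite subr_ge0 ler_norm.
Qed.

(* Where the sequence diverges, [limn] is the default point [0]. *)
Lemma measurable_limn d (T : measurableType d) (u : nat -> T -> R) :
  (forall k, measurable_fun setT (u k)) -> measurable_fun setT (fun t => limn (u ^~ t)).
Proof.
move=> mu; pose S t := limn_esup (fun k => (u k t)%:E); pose I t := limn_einf (fun k => (u k t)%:E).
have mS : measurable_fun setT S.
  by apply: measurable_fun_limn_esup => k; exact/measurable_EFinP.
have mI : measurable_fun setT I.
  rewrite /I /limn_einf; apply/measurableT_comp => //; apply: measurable_fun_limn_esup => k.
  by apply/measurableT_comp => //; exact/measurable_EFinP.
have -> : (fun t => limn (u ^~ t)) =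
    (fun t => if (S t == I t) && (S t == (fine (S t))%:E) then fine (S t) else 0).
  apply/funext => t; case: ifPn => [/andP[/eqP SI /eqP Sf]|nSI].
    apply/cvg_lim => //; apply: (@fine_cvg _ _ _ _ (fun k => (u k t)%:E)).
    rewrite -Sf; pose v k := (u k t)%:E.
    apply: (@squeeze_cvge _ _ _ _ (einfs v) v (esups v)).
    - apply: nearW => k; apply/andP; split.
        by apply: ereal_inf_lbound; exists k => /=.
      by apply: ereal_sup_ubound; exists k => /=.
    - by rewrite SI /I limn_einf_lim; exact: is_cvg_einfs.
    - by rewrite /S limn_esup_lim; exact: is_cvg_esups.
  apply: dvgP => /cvg_ex[l ul]; case/negP: nSI.
  have ulE : (fun k => (u k t)%:E) @ \oo --> l%:E.
    by apply: cvg_EFin; [exact: nearW|exact: ul].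
  by rewrite /S /I (cvg_limn_einf_sup ulE).1 (cvg_limn_einf_sup ulE).2/= !eqxx.
have mf : measurable_fun setT (fun t => fine (S t)) by exact: measurableT_comp.
apply: measurable_fun_ifT => //; apply: measurable_and; apply: measurable_fun_eqe => //.
exact/measurable_EFinP.
Qed.

End limits_of_sequences.

Section product_null_sets.
Context d1 d2 (T1 : measurableType d1) (T2 : measurableType d2) (R : realType).
Variables (m1 : {sigma_finite_measure set T1 -> \bar R})
  (m2 : {sigma_finite_measure set T2 -> \bar R}).

Lemma ae_fst (P : T1 -> Prop) : {ae m1, forall t, P t} -> {ae (m1 \x m2)%E, forall z, P z.1}.
Proof.
move=> [A [mA A0 hA]]; exists (A `*` setT); split; first exact: measurableX.
  transitivity (0 * m2 setT)%E; last by rewrite mul0e.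
  by rewrite product_measure1E//; congr (_ * _)%E; exact: A0.
by move=> -[t s] /= nP; split => //; exact: hA.
Qed.

Lemma ae_snd (P : T2 -> Prop) : {ae m2, forall t, P t} -> {ae (m1 \x m2)%E, forall z, P z.2}.
Proof.
move=> [A [mA A0 hA]]; exists (setT `*` A); split; first exact: measurableX.
  transitivity (m1 setT * 0)%E; last by rewrite mule0.
  by rewrite product_measure1E//; congr (_ * _)%E; exact: A0.
by move=> -[t s] /= nP; split => //; exact: hA.
Qed.

Lemma ae_prod2 (P : T1 * T2 -> Prop) : {ae (m1 \x m2)%E, forall p, P p} ->
  {ae m2, forall y, {ae m1, forall x, P (x, y)}}.
Proof.
move=> [A [mA A0 hA]]; pose f := (fun z : T1 * T2 => \1_A z : R).
have mf : measurable_fun setT f by exact: measurable_indic.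
have f0 : sqint (m1 \x m2)%E f = 0%E.
  rewrite /sqint (eq_integral (fun z => (\1_A z)%:E)).
    by rewrite integral_indic// setIT; exact: A0.
  by move=> z _; rewrite /f indicE; case: (_ \in _); rewrite ?expr1n ?expr0n.
rewrite (sqint_prod2 _ _ mf) in f0.
have : {ae m2, forall y, sqint m1 (fun t => f (t, y)) = 0%E}.
  have := (ae_eq_integral_abs m2 measurableT (measurable_sqint2 m1 mf)).1.
  move=> H; apply: filterS (H _) => [y /(_ Logic.I)//|].
  by rewrite -f0; apply: eq_integral => y _; rewrite gee0_abs// sqint_ge0.
apply: filterS => y /(sqint_eq0 (measurable_section2 y mf)); apply: filterS => t ft.
apply: contrapT => nP; move/eqP : ft; rewrite /f indicE mem_set ?oner_eq0//.
exact: hA.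
Qed.

End product_null_sets.

Section complex_Lsq.
Context d (T : measurableType d) (R : realType) (m : {measure set T -> \bar R}).
Implicit Type f : T -> R[i].

Lemma norm2_sq_parts f : cmeasurable f ->
  norm2_sq m f = (sqint m (fun t => complex.Re (f t))%R + sqint m (fun t => complex.Im (f t))%R)%E.
Proof.
move=> [mR mI]; rewrite /norm2_sq /sqint -ge0_integralD//.
- by apply: eq_integral => t _; rewrite -EFinD normc_sq.
- by move=> t _; rewrite lee_fin sqr_ge0.
- exact: measurable_sqE.
- by move=> t _; rewrite lee_fin sqr_ge0.
- exact: measurable_sqE.
Qed.

Lemma L2_Lsq f : L2 m f -> Lsq m (fun t => complex.Re (f t)) /\ Lsq m (fun t => complex.Im (f t)).
Proof.
move=> [mf]; rewrite norm2_sq_parts// => fi; case: mf => mR mI.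
by split; split => //; apply: le_lt_trans fi; rewrite ?leeDl ?leeDr// sqint_ge0.
Qed.

End complex_Lsq.

Section stacks.
Context dX (X : measurableType dX) dV (V : measurableType dV) (R : realType).
Variable x : {sigma_finite_measure set X -> \bar R}.
Local Notation w := (sigma_finite_count R \xs x).
Implicit Types (P Q : nat -> V * X -> R[i]).

(** The first index is discrete and countable, so a preimage is a countable union of measurable
    slices. *)
Lemma measurable_countable_slices (F : (nat * X) * V -> R) :
  (forall i, measurable_fun setT (fun p : V * X => F ((i, p.2), p.1))) ->
  measurable_fun setT F.
Proof.
move=> mF _ B mB; rewrite setTI.
have -> : F @^-1` B = \bigcup_i ((fun z : (nat * X) * V => z.1.1) @^-1` [set i] `&`
    (fun z : (nat * X) * V => (z.2, z.1.2)) @^-1` ((fun p : V * X => F ((i, p.2), p.1)) @^-1` B)).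
  apply/seteqP; split => [[[i y] r] Fz|[[i y] r] [j _ [/= -> ]]//].
  by exists i.
apply: bigcup_measurable => i _; apply: measurableI.
  rewrite -[X in measurable X]setTI.
  exact: (measurableT_comp measurable_fst measurable_fst).
rewrite -[X in measurable X]setTI.
have mt : measurable_fun setT (fun z : (nat * X) * V => (z.2, z.1.2)).
  apply/measurable_fun_pairP; split; first exact: measurable_snd.
  exact: (measurableT_comp measurable_snd measurable_fst).
apply: mt => //; rewrite -[X in measurable X]setTI.
exact: mF.
Qed.

Lemma Rintegral_count_prod (g : nat * X -> R) : w.-integrable setT (EFin \o g) ->
  series (fun i => \int[x]_y g (i, y)) @ \oo --> \int[w]_z g z.
Proof.
move=> ig; have := @Rintegral_prod1 _ _ _ _ _ (sigma_finite_count R) x g ig => <-.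
exact: (Rintegral_count (@integrable_Rintegral1 _ _ _ _ _ (sigma_finite_count R) x g ig)).
Qed.

Lemma sqint_count_prod (g : nat * X -> R) : measurable_fun setT g ->
  (sqint w g = \sum_(i <oo) sqint x (fun y => g (i, y)))%E.
Proof.
move=> mg; rewrite -[LHS]/(sqint (sigma_finite_count R \x x)%E g) (sqint_prod1 _ _ mg).
rewrite -[LHS]/(\int[counting]_i sqint x (fun y => g (i, y)))%E.
by rewrite ge0_integral_count// => i; exact: sqint_ge0.
Qed.

Variable c : nat -> R.
Hypothesis c_ge0 : forall i, 0 <= c i.

(* Real and imaginary parts of the kernel [H := sqrt (c i) * (P i)^*]; for
   [P = Psi] the 1-rdm is [H^dagger * H]. *)
Definition re_stack P : (nat * X) * V -> R :=
  fun z => Num.sqrt (c z.1.1) * complex.Re (P z.1.1 (z.2, z.1.2)).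
Definition im_stack P : (nat * X) * V -> R :=
  fun z => - (Num.sqrt (c z.1.1) * complex.Im (P z.1.1 (z.2, z.1.2))).

Lemma measurable_re_stack P : (forall i, cmeasurable (P i)) -> measurable_fun setT (re_stack P).
Proof.
move=> mP; apply: measurable_countable_slices => i; apply: measurable_funM; first exact: (measurable_cst (Num.sqrt (c i))).
rewrite (_ : (fun p => _) = (fun p => complex.Re (P i p))); first by case: (mP i).
by apply/funext => -[].
Qed.

Lemma measurable_im_stack P : (forall i, cmeasurable (P i)) -> measurable_fun setT (im_stack P).
Proof.
move=> mP; apply: measurable_countable_slices => i; apply: measurable_funN; apply: measurable_funM; first exact: (measurable_cst (Num.sqrt (c i))).
rewrite (_ : (fun p => _) = (fun p => complex.Im (P i p))); first by case: (mP i).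
by apply/funext => -[].
Qed.

Lemma sqint_stack P r : (forall i, cmeasurable (P i)) ->
  (\sum_(i <oo) (c i)%:E * \int[x]_y (normc (P i (r, y)) ^+ 2)%:E =
   sqint w (fun z => re_stack P (z, r))%R + sqint w (fun z => im_stack P (z, r))%R)%E.
Proof.
move=> mP; have mr := measurable_section2 r (measurable_re_stack mP).
have mi := measurable_section2 r (measurable_im_stack mP).
rewrite !sqint_count_prod// -nneseriesD; try by move=> i _ _; exact: sqint_ge0.
apply: eq_eseriesr => i _.
have mPr : measurable_fun setT (fun y => complex.Re (P i (r, y))).
  by case: (mP i) => m _; exact: (measurable_section1 r m).
have mPi : measurable_fun setT (fun y => complex.Im (P i (r, y))).
  by case: (mP i) => _ m; exact: (measurable_section1 r m).
rewrite /re_stack /im_stack/= sqintN !sqintZ// sqr_sqrtr// -ge0_muleDr ?sqint_ge0//.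
by congr (_ * _)%E; apply: (@norm2_sq_parts _ _ _ x (fun y => P i (r, y))).
Qed.

Lemma Lsq_count_section (g : nat * X -> R) i : Lsq w g -> Lsq x (fun y => g (i, y)).
Proof.
move=> [mg]; rewrite sqint_count_prod// => ig; split; first exact: (measurable_section1 i mg).
apply: le_lt_trans ig.
have := @nneseries_lim_ge R (fun i => sqint x (fun y => g (i, y))%R) xpredT 0 i.+1
  (fun i _ _ => sqint_ge0 _ _).
by apply: le_trans; rewrite big_nat_recr//= leeDr//; apply: sume_ge0 => j _; exact: sqint_ge0.
Qed.

(** The ensemble series is an integral over [nat] times X, and square integrability of the sections
    makes it absolutely convergent. The limit is the inner product of the two stacked kernels,
    conjugated in the first, written in real and imaginary parts. *)
Lemma stack_series P Q r s :
  Lsq w (fun z => re_stack P (z, r)) -> Lsq w (fun z => im_stack P (z, r)) ->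
  Lsq w (fun z => re_stack Q (z, s)) -> Lsq w (fun z => im_stack Q (z, s)) ->
  cseries_cvg (fun i => (c i)%:C%C * cintegral x (fun y => P i (r, y) * (Q i (s, y))^*%C))
    (Complex (\int[w]_z (re_stack P (z, r) * re_stack Q (z, s)) +
              \int[w]_z (im_stack P (z, r) * im_stack Q (z, s)))
      (\int[w]_z (re_stack P (z, r) * im_stack Q (z, s)) +
       \int[w]_z (- im_stack P (z, r) * re_stack Q (z, s)))).
Proof.
move=> LPr LPi LQr LQi.
have key (f1 g1 f2 g2 : nat * X -> R) (h : nat -> X -> R) : Lsq w f1 -> Lsq w g1 -> Lsq w f2 -> Lsq w g2 ->
    (forall i y, f1 (i, y) * g1 (i, y) + f2 (i, y) * g2 (i, y) = c i * h i y) ->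
    series (fun i => c i * \int[x]_y h i y) @ \oo -->
      \int[w]_z (f1 z * g1 z) + \int[w]_z (f2 z * g2 z).
  move=> L1 L2 L3 L4 E; have I1 := integrable_Lsq_mul L1 L2; have I2 := integrable_Lsq_mul L3 L4.
  rewrite -(RintegralD measurableT I1 I2).
  have I : w.-integrable setT (EFin \o (fun z => f1 z * g1 z + f2 z * g2 z)).
    by have := integrableD measurableT I1 I2; apply: eq_integrable.
  have := Rintegral_count_prod I.
  rewrite (_ : (fun i => \int[x]_y _) = (fun i => c i * \int[x]_y h i y))//; apply/funext => i.
  (* If [c i] is 0 the stacked kernels give no information on [h i], but its term in the series is 0
     as well. *)
  have [c0|c0] := eqVneq (c i) 0.
    transitivity (\int[x]_y (0 : R)); last by rewrite Rintegral_cst//= c0 !mul0r.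
    by apply: eq_Rintegral => y _; rewrite E c0 mul0r.
  have Ei y : h i y = (c i)^-1 * (f1 (i, y) * g1 (i, y) + f2 (i, y) * g2 (i, y)).
    by rewrite E mulKf.
  have J1 := integrable_Lsq_mul (Lsq_count_section i L1) (Lsq_count_section i L2).
  have J2 := integrable_Lsq_mul (Lsq_count_section i L3) (Lsq_count_section i L4).
  have J : x.-integrable setT (EFin \o (fun y => f1 (i, y) * g1 (i, y) + f2 (i, y) * g2 (i, y))).
    by have := integrableD measurableT J1 J2; apply: eq_integrable.
  transitivity (c i * \int[x]_y ((c i)^-1 * (f1 (i, y) * g1 (i, y) + f2 (i, y) * g2 (i, y)))).
    by rewrite RintegralZl// mulVKf.
  by congr (_ * _); apply: eq_Rintegral => y _; rewrite Ei.
have sc i : Num.sqrt (c i) * Num.sqrt (c i) = c i by rewrite -expr2 sqr_sqrtr.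
split => /=.
- under eq_fun do rewrite mul0r subr0.
  apply: key => // i y; rewrite /re_stack /im_stack /= -[in RHS]sc.
  by case: (P i (r, y)) => p1 p2; case: (Q i (s, y)) => q1 q2 /=; ring.
- under eq_fun do rewrite mul0r addr0.
  apply: key => //; first exact: LsqN.
  move=> i y; rewrite /re_stack /im_stack /= -[in RHS]sc.
  by case: (P i (r, y)) => p1 p2; case: (Q i (s, y)) => q1 q2 /=; ring.
Qed.

End stacks.

Section inner_products.
Context d (T : measurableType d) (R : realType) (m : {measure set T -> \bar R}).
Implicit Types f g : T -> R[i].

Definition Lsqc f : Prop :=
  Lsq m (fun t => complex.Re (f t)) /\ Lsq m (fun t => complex.Im (f t)).

Lemma cintegral_conj_mul f g : Lsqc f -> Lsqc g ->
  cintegral m (fun t => (f t)^*%C * g t) =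
  Complex (\int[m]_t (complex.Re (f t) * complex.Re (g t)) +
           \int[m]_t (complex.Im (f t) * complex.Im (g t)))
    (\int[m]_t (complex.Re (f t) * complex.Im (g t)) +
     \int[m]_t (- complex.Im (f t) * complex.Re (g t))).
Proof.
move=> [f1 f2] [g1 g2].
rewrite /cintegral -(RintegralD measurableT (integrable_Lsq_mul f1 g1) (integrable_Lsq_mul f2 g2)).
rewrite -(RintegralD measurableT (integrable_Lsq_mul f1 g2) (integrable_Lsq_mul (LsqN f2) g1)).
congr Complex; apply: eq_Rintegral => t _; case: (f t) => a b; case: (g t) => a' b' /=; ring.
Qed.

Lemma ae_eq_cintegral f g : cmeasurable f -> cmeasurable g ->
  {ae m, forall t, f t = g t} -> cintegral m f = cintegral m g.
Proof.
move=> [f1 f2] [g1 g2] fg; rewrite /cintegral.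
congr Complex; apply: eq_ae_Rintegral => //; by apply: filterS fg => t ->.
Qed.

Lemma RintegralNl (f g : T -> R) : \int[m]_t (- f t * g t) = - \int[m]_t (f t * g t).
Proof. by rewrite -RintegralN; apply: eq_Rintegral => t _; rewrite mulNr. Qed.

Lemma RintegralC (f g : T -> R) : \int[m]_t (f t * g t) = \int[m]_t (g t * f t).
Proof. by apply: eq_Rintegral => t _; rewrite mulrC. Qed.

End inner_products.

Lemma dominated_local d (T : measurableType d) (R : realType) (mu : {measure set T -> \bar R})
    (K' : set T) (g h : T -> R) : measurable K' ->
  measurable_fun setT g -> (forall r, 0 <= g r) -> mu.-integrable setT (EFin \o h) ->
  {ae mu, forall r, K' r -> g r <= h r} ->
  (\int[mu]_(r in K') (g r)%:E < +oo)%E.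
Proof.
move=> mK mg g0 ih gh; have ih' := integrable_abse ih.
have [mh lh] := integrableP _ _ _ ih'.
have mh' := measurable_int _ ih.
apply: (@le_lt_trans _ _ (\int[mu]_(r in K') `|(h r)%:E|)%E).
  apply: ae_ge0_le_integral => //.
  - by move=> r _; rewrite lee_fin.
  - by apply/measurable_EFinP; exact: measurable_funTS.
  - by apply: measurable_funTS.
  - apply: filterS gh => r H Kr; rewrite lee_fin.
    by apply: le_trans (H Kr) (ler_norm _).
apply: le_lt_trans (_ : (_ <= \int[mu]_r `|(h r)%:E|)%E) _.
  by apply: ge0_subset_integral.
by have /integrableP[_] := ih.
Qed.

(** Since [cseries] is a [limn], convergence has to be known before the factor is moved; that of the
    scaled series, divided by [K], provides it. *)
Lemma cseries_scale (R : realType) (K : R) (pr : nat -> R) (z : nat -> R[i]) (l : R[i]) :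
  K != 0 -> cseries_cvg (fun i => (K * pr i)%:C%C * z i) l ->
  K%:C%C * cseries (fun i => (pr i)%:C%C * z i) = l.
Proof.
case: l => l1 l2 K0 [/= c1 c2].
have key (u : nat -> R) (h : R) : series (fun i => K * u i) @ \oo --> h -> K * limn (series u) = h.
  move=> uh; have : (fun n => K^-1 * series (fun i => K * u i) n) @ \oo --> K^-1 * h by exact: cvgMr.
  rewrite (_ : (fun n => _) = series u); last first.
    by apply/funext => n; rewrite /series/= mulr_sumr; apply: eq_bigr => i _; rewrite mulKf.
  by move/cvg_lim => ->//; rewrite mulVKf.
rewrite /cseries; set A := limn _; set B := limn _.
have -> : K%:C%C * Complex A B = Complex (K * A) (K * B).
  by apply/eqP; rewrite eq_complex /= !mul0r subr0 addr0 !eqxx.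
congr Complex; apply: key.
  rewrite (_ : (fun i => _) = (fun i => complex.Re ((K * pr i)%:C%C * z i)))//.
  by apply/funext => i; case: (z i) => a b /=; ring.
rewrite (_ : (fun i => _) = (fun i => complex.Im ((K * pr i)%:C%C * z i)))//.
by apply/funext => i; case: (z i) => a b /=; ring.
Qed.

Section ensembles.
Context (R : realType) (N p q : nat).
Local Notation V := 'rV[R]_N.
Local Notation X := 'M[R]_(p, q).
Local Notation mu := (lebesgue_rV R N).
Variable x : {sigma_finite_measure set X -> \bar R}.
Local Notation W := (nat * X)%type.
Local Notation w := (sigma_finite_count R \xs x).
Local Notation mm := (mu \x mu)%E.
Local Notation ww := (w \x mu)%E.
Variables (K : R) (pr : nat -> R).
Hypotheses (K_gt0 : 0 < K) (pr_ge0 : forall i, 0 <= pr i).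
Let c i := K * pr i.
Let c_ge0 i : 0 <= c i.
Proof. by rewrite mulr_ge0// ltW. Qed.
Implicit Types P Q : nat -> V * X -> R[i].
Local Notation re := (re_stack c).
Local Notation im := (im_stack c).

Definition Lsq_at P r : Prop :=
  Lsq w (fun z => re P (z, r)) /\ Lsq w (fun z => im P (z, r)).

Lemma stack_cseries P Q r s : Lsq_at P r -> Lsq_at Q s ->
  K%:C%C * cseries (fun i => (pr i)%:C%C * cintegral x (fun y => P i (r, y) * (Q i (s, y))^*%C)) =
  Complex (\int[w]_z (re P (z, r) * re Q (z, s)) + \int[w]_z (im P (z, r) * im Q (z, s)))
    (\int[w]_z (re P (z, r) * im Q (z, s)) + \int[w]_z (- im P (z, r) * re Q (z, s))).
Proof.
move=> [P1 P2] [Q1 Q2]; apply: cseries_scale; first by rewrite gt_eqF.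
exact: (stack_series c_ge0 P1 P2 Q1 Q2).
Qed.

Lemma scaled_sqint_stack P r : (forall i, cmeasurable (P i)) ->
  (K%:E * \sum_(i <oo) (pr i)%:E * \int[x]_y (normc (P i (r, y)) ^+ 2)%:E =
   sqint w (fun z => re P (z, r))%R + sqint w (fun z => im P (z, r))%R)%E.
Proof.
move=> mP; rewrite -sqint_stack// -nneseriesZl ?ltW//; last first.
  move=> i _; rewrite mule_ge0 ?lee_fin//.
  by apply: integral_ge0 => y _; rewrite lee_fin sqr_ge0.
by apply: eq_eseriesr => i _; rewrite muleA.
Qed.

(** The squared norm of the stacked kernel is the weighted sum of squared norms; for normalized
    wavefunctions it is the number of particles. *)
Lemma Lsq_stack P : (forall i, cmeasurable (P i)) ->
  (K%:E * \sum_(i <oo) (pr i)%:E * norm2_sq (mu \x x)%E (P i) < +oo)%E ->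
  Lsq ww (re P) /\ Lsq ww (im P).
Proof.
move=> mP; have mr := measurable_re_stack c mP; have mi := measurable_im_stack c mP.
suff -> : (K%:E * \sum_(i <oo) (pr i)%:E * norm2_sq (mu \x x)%E (P i) =
    sqint ww (re P) + sqint ww (im P))%E.
  by move=> S; split; split => //; apply: le_lt_trans S; rewrite ?leeDl ?leeDr// sqint_ge0.
rewrite (sqint_slices x mr) (sqint_slices x mi).
rewrite -nneseriesD; [|by move=> i _ _; exact: sqint_ge0..].
rewrite -nneseriesZl ?ltW//; last first.
  move=> i _; rewrite mule_ge0 ?lee_fin//.
  by apply: integral_ge0 => y _; rewrite lee_fin sqr_ge0.
apply: eq_eseriesr => i _; rewrite muleA.
have mPr : measurable_fun setT (fun z => complex.Re (P i z)) by case: (mP i).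
have mPi : measurable_fun setT (fun z => complex.Im (P i z)) by case: (mP i).
have mPrs : measurable_fun setT (fun z : X * V => complex.Re (P i (z.2, z.1))).
  apply: (measurableT_comp mPr); apply/measurable_fun_pairP; split.
    exact: measurable_snd.
  exact: measurable_fst.
have mPis : measurable_fun setT (fun z : X * V => complex.Im (P i (z.2, z.1))).
  apply: (measurableT_comp mPi); apply/measurable_fun_pairP; split.
    exact: measurable_snd.
  exact: measurable_fst.
rewrite norm2_sq_parts// /re_stack /im_stack/= sqintN !sqintZ// sqr_sqrtr//.
rewrite (sqint_swap mu x mPr) (sqint_swap mu x mPi).
by rewrite -ge0_muleDr ?sqint_ge0// EFinM.
Qed.

(** The null sets for the countably many [i] are merged, and almost every [r] then has a null
    section in each of them. *)
Lemma stack_ae P (f1 f2 : W * V -> R) : (forall i, cmeasurable (P i)) ->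
  measurable_fun setT f1 -> measurable_fun setT f2 ->
  (forall i, {ae (mu \x x)%E, forall z, Num.sqrt (c i) * complex.Re (P i z) = f1 ((i, z.2), z.1) /\
     - (Num.sqrt (c i) * complex.Im (P i z)) = f2 ((i, z.2), z.1)}) ->
  {ae mu, forall r, {ae w, forall z, re P (z, r) = f1 (z, r) /\ im P (z, r) = f2 (z, r)}}.
Proof.
move=> mP m1 m2 H; have H1 i := ae_prod1 (H i).
apply: filterS (ae_foralln H1) => r Hr.
have := @ae_eq_prod1 _ _ _ _ R (sigma_finite_count R) x (fun z => re P (z, r)) (fun z => f1 (z, r))
  (measurable_section2 r (measurable_re_stack c mP)) (measurable_section2 r m1).
have := @ae_eq_prod1 _ _ _ _ R (sigma_finite_count R) x (fun z => im P (z, r)) (fun z => f2 (z, r))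
  (measurable_section2 r (measurable_im_stack c mP)) (measurable_section2 r m2).
move=> h2 h1; apply: filterS2 (h1 _) (h2 _) => //.
  by apply: aeW => i; apply: filterS (Hr i) => y [].
by apply: aeW => i; apply: filterS (Hr i) => y [].
Qed.

Variables (G : V * V -> R[i]) (Psi : nat -> V * X -> R[i]).
Hypotheses (LG : Lsqc mm G) (mPsi : forall i, cmeasurable (Psi i)).
Hypotheses (LPsi1 : Lsq ww (re Psi)) (LPsi2 : Lsq ww (im Psi)).
Hypothesis rdmE : {ae (mu \xs mu), forall z,
  K%:C%C * cseries (fun i => (pr i)%:C%C * cintegral x (fun y =>
    Psi i (z.1, y) * (Psi i (z.2, y))^*%C)) =
  cintegral mu (fun u => (G (u, z.1))^*%C * G (u, z.2))}.

Local Notation a1 := (fun z => complex.Re (G z)).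
Local Notation a2 := (fun z => complex.Im (G z)).

Lemma ae_Lsq_G : {ae mu, forall r, Lsqc mu (fun u => G (u, r))}.
Proof.
have [L1 L2] := LG; apply: filterS2 (ae_Lsq2 L1) (ae_Lsq2 L2) => r; by split.
Qed.

Lemma ae_Lsq_Psi : {ae mu, forall r, Lsq_at Psi r}.
Proof. by apply: filterS2 (ae_Lsq2 LPsi1) (ae_Lsq2 LPsi2) => r; split. Qed.

(** Splitting both sides into real integrals requires the sections at [z.1] and at [z.2] to be
    square integrable, which fails only on a null set of pairs. *)
Lemma gram_identities : {ae (mu \xs mu), forall z,
  (\int[mu]_u (a1 (u, z.1) * a1 (u, z.2)) + \int[mu]_u (a2 (u, z.1) * a2 (u, z.2)) =
   \int[w]_u (re Psi (u, z.1) * re Psi (u, z.2)) + \int[w]_u (im Psi (u, z.1) * im Psi (u, z.2))) /\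
  (\int[mu]_u (a1 (u, z.1) * a2 (u, z.2)) + \int[mu]_u (- a2 (u, z.1) * a1 (u, z.2)) =
   \int[w]_u (re Psi (u, z.1) * im Psi (u, z.2)) + \int[w]_u (- im Psi (u, z.1) * re Psi (u, z.2)))}.
Proof.
have H1 : {ae (mu \xs mu), forall z, Lsqc mu (fun u => G (u, z.1)) /\ Lsqc mu (fun u => G (u, z.2))}.
  exact: filterI (ae_fst mu ae_Lsq_G) (ae_snd mu ae_Lsq_G).
have H2 : {ae (mu \xs mu), forall z, Lsq_at Psi z.1 /\ Lsq_at Psi z.2}.
  exact: filterI (ae_fst mu ae_Lsq_Psi) (ae_snd mu ae_Lsq_Psi).
apply: filterS3 rdmE H1 H2 => z.
move=> + [G1 G2] [P1 P2]; rewrite (cintegral_conj_mul G1 G2) (stack_cseries P1 P2).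
by move=> [-> ->].
Qed.

Let dens r : \bar R :=
  (K%:E * \sum_(i <oo) (pr i)%:E * \int[x]_y (normc (Psi i (r, y)) ^+ 2)%:E)%E.

Lemma ensemble_density_integrable : mu.-integrable setT dens.
Proof.
have E : dens = (fun r => sqint w (fun z => re Psi (z, r))%R + sqint w (fun z => im Psi (z, r))%R)%E.
  by apply/funext => r; exact: scaled_sqint_stack.
have m1 := measurable_sqint2 w LPsi1.1; have m2 := measurable_sqint2 w LPsi2.1.
rewrite E; apply/integrableP; split; first exact: emeasurable_funD.
rewrite (eq_integral (fun r => sqint w (fun z => re Psi (z, r))%R + sqint w (fun z => im Psi (z, r))%R)%E); last first.
  by move=> r _; rewrite gee0_abs// adde_ge0// sqint_ge0.
rewrite ge0_integralD//; [|by move=> r _; exact: sqint_ge0..].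
rewrite -(sqint_prod2 _ _ LPsi1.1) -(sqint_prod2 _ _ LPsi2.1).
by apply: lte_add_pinfty; [exact: LPsi1.2|exact: LPsi2.2].
Qed.

Lemma ensemble_density : {ae mu, forall r, dens r \is a fin_num /\
  (fine (dens r))%:C%C = cintegral mu (fun u => (G (u, r))^*%C * G (u, r))}.
Proof.
have gr : {ae (mu \xs mu), forall z,
  \int[mu]_u (a1 (u, z.1) * a1 (u, z.2)) + \int[mu]_u (a2 (u, z.1) * a2 (u, z.2)) =
  \int[w]_u (re Psi (u, z.1) * re Psi (u, z.2)) + \int[w]_u (im Psi (u, z.1) * im Psi (u, z.2))}.
  by apply: filterS gram_identities => z [].
apply: filterS3 (diagonal_transfer LG.1 LG.2 LPsi1 LPsi2 gr) ae_Lsq_G ae_Lsq_Psi => r dE Gr Pr.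
rewrite /dens scaled_sqint_stack// (sqint_Rintegral Pr.1) (sqint_Rintegral Pr.2) -EFinD.
split => //; rewrite (cintegral_conj_mul Gr Gr) [fine _]/=.
rewrite -[X in X%:C%C]dE.
by rewrite RintegralNl [X in _ - X]RintegralC subrr.
Qed.


Lemma Rintegral_ae_mul d (T : measurableType d) (t : {measure set T -> \bar R})
    (f g f' g' : T -> R) : measurable_fun setT f -> measurable_fun setT g ->
  measurable_fun setT f' -> measurable_fun setT g' ->
  {ae t, forall z, f z = f' z} -> {ae t, forall z, g z = g' z} ->
  \int[t]_z (f z * g z) = \int[t]_z (f' z * g' z).
Proof.
move=> mf mg mf' mg' ff' gg'; apply: eq_ae_Rintegral; try exact: measurable_funM.
by apply: filterS2 ff' gg' => z -> ->.
Qed.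

Lemma inner_cut_integrable d (T : measurableType d) (t : {sigma_finite_measure set T -> \bar R})
    (f g : T * V -> R) M : Lsq (t \x mu)%E f -> Lsq (t \x mu)%E (cut g M) ->
  mu.-integrable setT (EFin \o (fun r => \int[t]_z (f (z, r) * cut g M (z, r)))).
Proof. by move=> Lf Lg; exact: (integrable_Rintegral2 (integrable_Lsq_mul Lf Lg)). Qed.

Lemma Lsq_cut_ae d (T : measurableType d) (t : {sigma_finite_measure set T -> \bar R})
    (f : T * V -> R) : measurable_fun setT f -> (forall n : nat, Lsq (t \x mu)%E (cut f n%:R)) ->
  {ae mu, forall r, Lsq t (fun z => f (z, r))}.
Proof.
move=> mf Lf; apply: filterS (ae_foralln (fun n => ae_Lsq2 (Lf n))) => r Hr.
have nr : cball (Num.bound `|r|)%:R r by rewrite /cball /=; apply/ltW/archi_boundP.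
have := Hr (Num.bound `|r|); congr Lsq; apply/funext => z; exact: cut_in.
Qed.

Section derivative.
Variables (v : V) (dG : V * V -> R[i]).
Hypothesis mdG : cmeasurable dG.
Hypotheses (LdG1 : forall M, Lsq mm (cut (fun z => complex.Re (dG z)) M))
  (LdG2 : forall M, Lsq mm (cut (fun z => complex.Im (dG z)) M)).
Hypothesis dG1 : forall phi : V * V -> R, test_function phi ->
  \int[mm]_z (complex.Re (G z) * 'D_(0, v) phi z) = - \int[mm]_z (complex.Re (dG z) * phi z).
Hypothesis dG2 : forall phi : V * V -> R, test_function phi ->
  \int[mm]_z (complex.Im (G z) * 'D_(0, v) phi z) = - \int[mm]_z (complex.Im (dG z) * phi z).
Hypothesis x_ball : forall M : R, (x [set A : X | (`|A| <= M)%R] < +oo)%E.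

Let mom (dPsi : nat -> V * X -> R[i]) r : R[i] :=
  K%:C%C * cseries (fun i => (pr i)%:C%C * cintegral x (fun y =>
    (- 'i%C * dPsi i (r, y)) * (Psi i (r, y))^*%C)).

(** The stacked kernel is the conjugate of the wavefunction, so the gradient of the momentum density
    falls on the conjugated factor here. *)
Let momG r : R[i] := cintegral mu (fun u => (- 'i%C * (dG (u, r))^*%C) * G (u, r)).

(** Convergence of the series is available almost everywhere at best; [measurable_limn] takes care
    of the points where it diverges. *)
Lemma cmeasurable_mom dPsi : (forall i, cmeasurable (dPsi i)) -> cmeasurable (mom dPsi).
Proof.
move=> md.
have mI i (part : R[i] -> R) : (part = @complex.Re R \/ part = @complex.Im R) ->
    measurable_fun setT (fun r => \int[x]_y part (- 'i%C * dPsi i (r, y) * (Psi i (r, y))^*%C)).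
  have [m1 m2] := md i; have [m3 m4] := mPsi i.
  case=> ->; apply: (measurable_Rintegral1 x (f := fun z => _ (- 'i%C * dPsi i z * (Psi i z)^*%C))).
    rewrite (_ : (fun z => _) = (fun z => complex.Im (dPsi i z) * complex.Re (Psi i z) -
        complex.Re (dPsi i z) * complex.Im (Psi i z))).
      by apply: measurable_funB; exact: measurable_funM.
    by apply/funext => z; case: (dPsi i z) => a b; case: (Psi i z) => a' b' /=; ring.
  rewrite (_ : (fun z => _) = (fun z => - (complex.Re (dPsi i z) * complex.Re (Psi i z) +
      complex.Im (dPsi i z) * complex.Im (Psi i z)))).
    by apply: measurable_funN; apply: measurable_funD; exact: measurable_funM.
  by apply/funext => z; case: (dPsi i z) => a b; case: (Psi i z) => a' b' /=; ring.
have mS (f : nat -> V -> R) : (forall i, measurable_fun setT (f i)) ->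
    measurable_fun setT (fun r => K * limn (series (fun i => f i r))).
  move=> mf; apply: measurable_funM; first exact: measurable_cst.
  apply: (measurable_limn (u := fun n r => series (fun i => f i r) n)) => n.
  rewrite /series/=; exact: measurable_sum.
split.
  rewrite (_ : (fun r => _) = (fun r => K * limn (series (fun i => pr i *
      \int[x]_y complex.Re (- 'i%C * dPsi i (r, y) * (Psi i (r, y))^*%C))))).
    by apply: mS => i; apply: measurable_funM; [exact: measurable_cst|apply: mI; left].
  apply/funext => r.
  rewrite (_ : (fun i => _ * _) = (fun i => complex.Re ((pr i)%:C%C * cintegral x (fun y =>
    - 'i%C * dPsi i (r, y) * (Psi i (r, y))^*%C)))); first by rewrite /mom /cseries /= mul0r subr0.
  by apply/funext => i /=; rewrite mul0r subr0.
rewrite (_ : (fun r => _) = (fun r => K * limn (series (fun i => pr i *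
    \int[x]_y complex.Im (- 'i%C * dPsi i (r, y) * (Psi i (r, y))^*%C))))).
  by apply: mS => i; apply: measurable_funM; [exact: measurable_cst|apply: mI; right].
apply/funext => r.
rewrite (_ : (fun i => _ * _) = (fun i => complex.Im ((pr i)%:C%C * cintegral x (fun y =>
  - 'i%C * dPsi i (r, y) * (Psi i (r, y))^*%C)))); first by rewrite /mom /cseries /= mul0r addr0.
by apply/funext => i /=; rewrite mul0r addr0.
Qed.

Lemma ae_Lsq_dG : {ae mu, forall r, Lsqc mu (fun u => dG (u, r))}.
Proof.
have := Lsq_cut_ae mdG.1 (fun n => LdG1 n%:R); have := Lsq_cut_ae mdG.2 (fun n => LdG2 n%:R).
by apply: filterS2 => r; split.
Qed.

Lemma momGE : {ae mu, forall r, momG r =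
  Complex (- (\int[mu]_u (a1 (u, r) * complex.Im (dG (u, r))) +
              \int[mu]_u (- a2 (u, r) * complex.Re (dG (u, r)))))
    (- (\int[mu]_u (a1 (u, r) * complex.Re (dG (u, r))) +
        \int[mu]_u (a2 (u, r) * complex.Im (dG (u, r)))))}.
Proof.
apply: filterS2 ae_Lsq_G ae_Lsq_dG => r [g1 g2] [h1 h2]; rewrite /momG /cintegral.
rewrite -(RintegralD measurableT (integrable_Lsq_mul g1 h2) (integrable_Lsq_mul (LsqN g2) h1)).
rewrite -(RintegralD measurableT (integrable_Lsq_mul g1 h1) (integrable_Lsq_mul g2 h2)) -!RintegralN.
by congr Complex; apply: eq_Rintegral => u _; case: (dG (u, r)) => a b;
  case: (G (u, r)) => a' b' /=; ring.
Qed.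

(** The four real integrals of [momGE] are integrable in [r] once the derivative is truncated, and
    the truncation is invisible on the ball. *)
Lemma momG_local (n : nat) : exists2 h : V -> R, mu.-integrable setT (EFin \o h) &
  {ae mu, forall r, cball n%:R r -> normc (momG r) <= h r}.
Proof.
have I f g := @inner_cut_integrable _ _ mu f g n%:R.
have I1 := I _ _ LG.1 (LdG2 n%:R); have I2 := I _ _ (LsqN LG.2) (LdG1 n%:R).
have I3 := I _ _ LG.1 (LdG1 n%:R); have I4 := I _ _ LG.2 (LdG2 n%:R).
have nI (f : V -> R) : mu.-integrable setT (EFin \o f) -> mu.-integrable setT (EFin \o (fun r => `|f r|)).
  by move=> fi; have := integrable_abse fi; apply: eq_integrable.
have DI (f g : V -> R) : mu.-integrable setT (EFin \o f) -> mu.-integrable setT (EFin \o g) ->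
    mu.-integrable setT (EFin \o (fun r => f r + g r)).
  by move=> fi gi; have := integrableD measurableT fi gi; apply: eq_integrable.
exists (fun r => `| \int[mu]_u (a1 (u, r) * cut (fun z => complex.Im (dG z)) n%:R (u, r))| +
  `| \int[mu]_u (- a2 (u, r) * cut (fun z => complex.Re (dG z)) n%:R (u, r))| +
  (`| \int[mu]_u (a1 (u, r) * cut (fun z => complex.Re (dG z)) n%:R (u, r))| +
  `| \int[mu]_u (a2 (u, r) * cut (fun z => complex.Im (dG z)) n%:R (u, r))|)).
  by apply: (DI _ _ (DI _ _ (nI _ I1) (nI _ I2)) (DI _ _ (nI _ I3) (nI _ I4))).
apply: filterS momGE => r -> nr; apply: le_trans (normc_le_parts _) _ => /=.
have E (f g : V * V -> R) : \int[mu]_u (f (u, r) * cut g n%:R (u, r)) = \int[mu]_u (f (u, r) * g (u, r)).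
  by apply: eq_Rintegral => u _; rewrite cut_in.
rewrite (E a1 (fun z => complex.Im (dG z))) (E (fun z => - a2 z) (fun z => complex.Re (dG z))).
rewrite (E a1 (fun z => complex.Re (dG z))) (E a2 (fun z => complex.Im (dG z))).
by rewrite !normrN; apply: lerD; exact: ler_normD.
Qed.

(** The derivatives [db1] and [db2] arise as limits, whereas the densities are defined with one
    chosen weak derivative per wavefunction. The last clause is therefore stated for every [dPsi]
    that agrees with them almost everywhere. *)
Lemma ensemble_derivative : exists db1 db2 : W * V -> R,
  [/\ [/\ measurable_fun setT db1, measurable_fun setT db2,
        forall n : nat, Lsq ww (cut db1 n%:R) & forall n : nat, Lsq ww (cut db2 n%:R)],
    forall i (phi : V * X -> R), test_function phi ->
      (\int[(mu \x x)%E]_z (re Psi ((i, z.2), z.1) * 'D_(v, 0) phi z) =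
        - \int[(mu \x x)%E]_z (db1 ((i, z.2), z.1) * phi z)) /\
      (\int[(mu \x x)%E]_z (im Psi ((i, z.2), z.1) * 'D_(v, 0) phi z) =
        - \int[(mu \x x)%E]_z (db2 ((i, z.2), z.1) * phi z)) &
    forall dPsi, (forall i, cmeasurable (dPsi i)) ->
    (forall i, {ae (mu \x x)%E, forall z,
       Num.sqrt (c i) * complex.Re (dPsi i z) = db1 ((i, z.2), z.1) /\
       - (Num.sqrt (c i) * complex.Im (dPsi i z)) = db2 ((i, z.2), z.1)}) ->
    [/\ {ae mu, forall r, Lsq_at dPsi r},
      forall n : nat, (\int[mu]_(r in cball n%:R) (sqint w (fun z => re dPsi (z, r))%R +
         sqint w (fun z => im dPsi (z, r))%R) < +oo)%E,
      {ae mu, forall r, mom dPsi r = momG r} &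
      {ae mu, forall r, (sqint w (fun z => re dPsi (z, r))%R + sqint w (fun z => im dPsi (z, r))%R =
        (\int[mu]_u (complex.Re (dG (u, r)) * complex.Re (dG (u, r))) +
         \int[mu]_u (complex.Im (dG (u, r)) * complex.Im (dG (u, r))))%:E)%E}]].
Proof.
have gr1 : {ae (mu \xs mu), forall z,
  \int[mu]_u (a1 (u, z.1) * a1 (u, z.2)) + \int[mu]_u (a2 (u, z.1) * a2 (u, z.2)) =
  \int[w]_u (re Psi (u, z.1) * re Psi (u, z.2)) + \int[w]_u (im Psi (u, z.1) * im Psi (u, z.2))}.
  by apply: filterS gram_identities => z [].
have gr2 : {ae (mu \xs mu), forall z,
  \int[mu]_u (a1 (u, z.1) * a2 (u, z.2)) + \int[mu]_u (- a2 (u, z.1) * a1 (u, z.2)) =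
  \int[w]_u (re Psi (u, z.1) * im Psi (u, z.2)) + \int[w]_u (- im Psi (u, z.1) * re Psi (u, z.2))}.
  by apply: filterS gram_identities => z [].
have [db1 [db2 [[m1 m2 L1 L2] sl E1 E2 E3]]] := derivative_kernel_transfer x_ball LG.1 LG.2 LPsi1 LPsi2
  gr1 gr2 mdG.1 LdG1 mdG.2 LdG2 dG1 dG2.
exists db1, db2; split => // dPsi mdP dPE.
have S := stack_ae mdP m1 m2 dPE.
have mr := measurable_re_stack c mdP; have mi := measurable_im_stack c mdP.
have mr1 := measurable_re_stack c mPsi; have mi1 := measurable_im_stack c mPsi.
have sE1 : {ae mu, forall r, sqint w (fun z => re dPsi (z, r)) = sqint w (fun z => db1 (z, r))}.
  apply: filterS S => r Sr; apply: ae_eq_sqint; [exact: measurable_section2|exact: measurable_section2|].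
  by apply: filterS Sr => z [].
have sE2 : {ae mu, forall r, sqint w (fun z => im dPsi (z, r)) = sqint w (fun z => db2 (z, r))}.
  apply: filterS S => r Sr; apply: ae_eq_sqint; [exact: measurable_section2|exact: measurable_section2|].
  by apply: filterS Sr => z [].
have Ld1 := Lsq_cut_ae m1 L1; have Ld2 := Lsq_cut_ae m2 L2.
have Lat : {ae mu, forall r, Lsq_at dPsi r}.
  apply: filterS2 (filterI sE1 sE2) (filterI Ld1 Ld2) => r [e1 e2] [[_ l1] [_ l2]].
  by split; split; [exact: measurable_section2|rewrite e1|exact: measurable_section2|rewrite e2].
split => //.
- move=> n; have mb : measurable (@cball R N n%:R) by exact: measurable_cball.
  have M1 := measurable_sqint2 w mr; have M2 := measurable_sqint2 w mi.
  rewrite ge0_integralD//; try by [move=> r _; exact: sqint_ge0|exact: measurable_funTS].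
  have bd (f g : W * V -> R) : measurable_fun setT f -> measurable_fun setT g -> Lsq ww (cut g n%:R) ->
      {ae mu, forall r, sqint w (fun z => f (z, r)) = sqint w (fun z => g (z, r))} ->
      (\int[mu]_(r in cball n%:R) sqint w (fun z => f (z, r))%R < +oo)%E.
    move=> mf mg [mcg Lcg] fg; rewrite (sqint_prod2 _ _ mcg) in Lcg.
    have MF := measurable_sqint2 w mf; have MG := measurable_sqint2 w mg.
    have -> : (\int[mu]_(r in cball n%:R) sqint w (fun z => f (z, r))%R =
        \int[mu]_(r in cball n%:R) sqint w (fun z => g (z, r))%R)%E.
      apply: ge0_ae_eq_integral => //.
      - exact: (measurable_funTS MF).
      - exact: (measurable_funTS MG).
      - by move=> r _; exact: sqint_ge0.
      - by move=> r _; exact: sqint_ge0.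
      - by apply: filterS fg => r -> _.
    apply: le_lt_trans Lcg; rewrite integral_mkcond; apply: ge0_le_integral => //.
    + by move=> r _; rewrite patchE; case: ifP => _ //; exact: sqint_ge0.
    + by apply/(measurable_restrictT _ mb); exact: (measurable_funTS MG).
    + exact: (measurable_sqint2 w mcg).
    + move=> r _; rewrite patchE; case: ifPn => rn; last exact: sqint_ge0.
      rewrite inE in rn; rewrite le_eqVlt; apply/orP; left; apply/eqP; congr sqint.
      by apply/funext => z; rewrite cut_in.
  by apply: lte_add_pinfty; [exact: bd mr m1 (L1 n) sE1|exact: bd mi m2 (L2 n) sE2].
- apply: filterS3 (filterI E1 E2) (filterI S momGE) (filterI Lat ae_Lsq_Psi).
  move=> r [e1 e2] [Sr ->] [Lr Pr].
  (* The factor -i rotates the stacked parts: the real one becomes minus the imaginary one, and the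
     imaginary one becomes the real one. *)
  pose P' i z := - 'i%C * dPsi i z.
  have reP z : re P' z = - im dPsi z.
    rewrite /re_stack /im_stack /P' opprK; congr (_ * _).
    by case: (dPsi _ _) => a b /=; ring.
  have imP z : im P' z = re dPsi z.
    rewrite /re_stack /im_stack /P' -mulrN; congr (_ * _).
    by case: (dPsi _ _) => a b /=; ring.
  have LP' : Lsq_at P' r.
    split.
      rewrite (_ : (fun z => _) = (fun z => - im dPsi (z, r))); first exact: LsqN Lr.2.
      by apply/funext => z; exact: reP.
    rewrite (_ : (fun z => _) = (fun z => re dPsi (z, r))); first exact: Lr.1.
    by apply/funext => z; exact: imP.
  rewrite [LHS](stack_cseries (P := P') (Q := Psi) LP' Pr).
  have R1 (f g : W * V -> R) : measurable_fun setT f -> measurable_fun setT g ->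
      {ae w, forall z, f (z, r) = g (z, r)} -> forall h : W * V -> R, measurable_fun setT h ->
      \int[w]_z (h (z, r) * f (z, r)) = \int[w]_z (h (z, r) * g (z, r)).
    move=> mf mg fg h mh; apply: Rintegral_ae_mul => //;
      by [exact: measurable_section2|apply: aeW].
  have rr : {ae w, forall z, re dPsi (z, r) = db1 (z, r)} by apply: filterS Sr => z [].
  have ii : {ae w, forall z, im dPsi (z, r) = db2 (z, r)} by apply: filterS Sr => z [].
  rewrite e1 e2.
  rewrite -(R1 _ _ mr m1 rr _ mr1) -(R1 _ _ mi m2 ii _ mi1) -(R1 _ _ mi m2 ii _ mr1).
  have -> : \int[w]_u (- im Psi (u, r) * db1 (u, r)) = \int[w]_u (- im Psi (u, r) * re dPsi (u, r)).
    by rewrite [LHS]RintegralNl [RHS]RintegralNl -(R1 _ _ mr m1 rr _ mi1).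
  have Z1 : \int[w]_z (re P' (z, r) * re Psi (z, r)) = - \int[w]_z (re Psi (z, r) * im dPsi (z, r)).
    by rewrite RintegralC -RintegralN; apply: eq_Rintegral => z _; rewrite reP mulrN.
  have Z2 : \int[w]_z (im P' (z, r) * im Psi (z, r)) = \int[w]_z (im Psi (z, r) * re dPsi (z, r)).
    by rewrite RintegralC; apply: eq_Rintegral => z _; rewrite imP.
  have Z3 : \int[w]_z (re P' (z, r) * im Psi (z, r)) = - \int[w]_z (im Psi (z, r) * im dPsi (z, r)).
    by rewrite RintegralC -RintegralN; apply: eq_Rintegral => z _; rewrite reP mulrN.
  have Z4 : \int[w]_z (- im P' (z, r) * re Psi (z, r)) = - \int[w]_z (re Psi (z, r) * re dPsi (z, r)).
    by rewrite RintegralNl RintegralC; congr (- _); apply: eq_Rintegral => z _; rewrite imP.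
  by rewrite Z1 Z2 Z3 Z4 RintegralNl; congr Complex; ring.
- apply: filterS3 E3 (filterI sE1 sE2) (filterI Ld1 Ld2) => r e3 [-> ->] [l1 l2].
  by rewrite (sqint_Rintegral l1) (sqint_Rintegral l2) -EFinD -e3.
Qed.

End derivative.

End ensembles.

Section kinetic_sums.
Context (R : realType) (N p q : nat).
Local Notation V := 'rV[R]_N.
Local Notation X := 'M[R]_(p, q).
Variable x : {sigma_finite_measure set X -> \bar R}.
Local Notation w := (sigma_finite_count R \xs x).
Variables (K : R) (pr : nat -> R).
Hypotheses (K_gt0 : 0 < K) (pr_ge0 : forall i, 0 <= pr i).
Local Notation c := (fun i => K * pr i).
Implicit Types P Q : nat -> V * X -> R[i].

Lemma scaled_kinetic_stack (I : finType) (P : I -> nat -> V * X -> R[i]) r :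
  (forall j i, cmeasurable (P j i)) ->
  ((K / 2)%:E * \sum_(i <oo) (pr i)%:E *
    \int[x]_y (\sum_(j : I) normc (P j i (r, y)) ^+ 2)%R%:E =
   (2^-1)%:E * \sum_(j : I) (sqint w (fun z => re_stack c (P j) (z, r))%R +
     sqint w (fun z => im_stack c (P j) (z, r))%R))%E.
Proof.
move=> mP; rewrite mulrC EFinM -muleA; congr (_ * _)%E.
have I0 j i : (0 <= \int[x]_y (normc (P j i (r, y)) ^+ 2)%:E)%E.
  by apply: integral_ge0 => y _; rewrite lee_fin sqr_ge0.
under [RHS]eq_bigr => j _ do rewrite -(scaled_sqint_stack x K_gt0 pr_ge0 r (mP j)).
rewrite -ge0_sume_distrr; last first.
  by move=> j _; apply: nneseries_ge0 => i _ _; rewrite mule_ge0// lee_fin.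
congr (_ * _)%E; rewrite -nneseries_sum; last by move=> j i _; rewrite mule_ge0// lee_fin.
apply: eq_eseriesr => i _; rewrite -ge0_sume_distrr//; congr (_ * _)%E.
rewrite -ge0_integral_sum//; first by apply: eq_integral => y _; rewrite -sumEFin.
  move=> j; apply/measurable_EFinP; apply: measurable_funX.
  by apply: (measurable_section1 r (f := fun z => normc (P j i z))); exact: measurable_normc.
by move=> j y _; rewrite lee_fin sqr_ge0.
Qed.

(** From |P||Q| <= |P|^2 + |Q|^2, both squares being summable at [r]. With the wavefunctions and
    their gradients this is absolute convergence of the momentum density. *)
Lemma stack_mul_summable P Q r : (forall i, cmeasurable (P i)) -> (forall i, cmeasurable (Q i)) ->
  Lsq_at x K pr P r -> Lsq_at x K pr Q r ->
  (\sum_(i <oo) (pr i)%:E * \int[x]_y (normc (P i (r, y)) * normc (Q i (r, y)))%:E < +oo)%E.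
Proof.
move=> mP mQ [P1 P2] [Q1 Q2].
have I0 (S : nat -> V * X -> R[i]) i : (0 <= (pr i)%:E * \int[x]_y (normc (S i (r, y)) ^+ 2)%:E)%E.
  rewrite mule_ge0 ?lee_fin//.
  by apply: integral_ge0 => y _; rewrite lee_fin sqr_ge0.
have fin (S : nat -> V * X -> R[i]) : (forall i, cmeasurable (S i)) -> Lsq_at x K pr S r ->
    (\sum_(i <oo) (pr i)%:E * \int[x]_y (normc (S i (r, y)) ^+ 2)%:E < +oo)%E.
  move=> mS [S1 S2]; have E := scaled_sqint_stack x K_gt0 pr_ge0 r mS.
  have : (K%:E * \sum_(i <oo) (pr i)%:E * \int[x]_y (normc (S i (r, y)) ^+ 2)%:E < +oo)%E.
    by rewrite E lte_add_pinfty//; [case: S1|case: S2].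
  have N0 : (0 <= \sum_(i <oo) (pr i)%:E * \int[x]_y (normc (S i (r, y)) ^+ 2)%:E)%E.
    by apply: nneseries_ge0 => i _ _; exact: I0.
  by case: (\sum_(i <oo) _)%E N0 => // [s|]; rewrite ?ltry// gt0_muley ?lte_fin.
apply: le_lt_trans (lte_add_pinfty (fin P mP (conj P1 P2)) (fin Q mQ (conj Q1 Q2))).
have mnS (S : nat -> V * X -> R[i]) i : (forall i, cmeasurable (S i)) ->
    measurable_fun setT (fun y => normc (S i (r, y))).
  move=> mS; apply: (measurable_section1 r (f := fun z => normc (S i z))).
  exact: measurable_normc.
rewrite -nneseriesD; [|by move=> i _ _; exact: I0..].
apply: lee_nneseries => i _.
  move=> _; rewrite mule_ge0 ?lee_fin//; apply: integral_ge0 => y _.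
  by rewrite lee_fin mulr_ge0 ?normc_ge0'.
rewrite -ge0_muleDr; try by apply: integral_ge0 => y _; rewrite lee_fin sqr_ge0.
apply: lee_wpmul2l; first by rewrite lee_fin.
rewrite -ge0_integralD//; last 4 first.
- by move=> y _; rewrite lee_fin sqr_ge0.
- by apply/measurable_EFinP; apply: measurable_funX; exact: mnS.
- by move=> y _; rewrite lee_fin sqr_ge0.
- by apply/measurable_EFinP; apply: measurable_funX; exact: mnS.
apply: ge0_le_integral => //.
- by move=> y _; rewrite lee_fin mulr_ge0 ?normc_ge0'.
- by apply/measurable_EFinP; apply: measurable_funM; exact: mnS.
- by apply: emeasurable_funD; apply/measurable_EFinP; apply: measurable_funX; exact: mnS.
- move=> y _; rewrite -EFinD lee_fin.
  have := sqr_ge0 (normc (P i (r, y)) - normc (Q i (r, y))).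
  have := normc_ge0' (P i (r, y)); have := normc_ge0' (Q i (r, y)); nra.
Qed.

End kinetic_sums.

Section local_integrability.
Variables (R : realType) (n : nat).
Local Notation mu3 := (lebesgue_rV R 3).
Local Notation X := 'M[R]_(n, 3).
Local Notation V := ('rV[R]_3 * X)%type.
Local Notation m := (mu3 \x lebesgue_mx R 3 n)%E.
Implicit Types f : V -> R[i].
Local Notation box k := (@cbox R 1 3 n 3 k%:R).

Lemma Lsq_cbox k : Lsq m (\1_(box k)).
Proof.
split; first by apply: measurable_indic; exact: measurable_cbox.
rewrite /sqint (eq_integral (fun z => (\1_(box k) z)%:E)); last first.
  by move=> z _; rewrite indicE; case: (_ \in _); rewrite ?expr1n ?expr0n.
rewrite integral_indic ?setIT//; last exact: measurable_cbox.
rewrite cboxE; have M1 := @measurable_cball_mx R 1 3 k%:R; have M2 := @measurable_cball_mx R n 3 k%:R.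
have E := @product_measure1E _ _ _ _ R mu3 (lebesgue_mx R 3 n) _ _ M1 M2.
refine (eq_ind_r (fun y => (y < +oo)%E) _ E).
apply: lte_mul_pinfty; first exact: measure_ge0.
  by rewrite ge0_fin_numE ?measure_ge0//; exact: lebesgue_rV_cball.
exact: lebesgue_mx_cball.
Qed.

(** Boxes have finite measure, so square integrability on each of them gives integrability on every
    compact set. *)
Lemma L1_on_of_Lsq f : cmeasurable f ->
  (forall k : nat, Lsq m (fun z => complex.Re (f z) * \1_(box k) z)) ->
  (forall k : nat, Lsq m (fun z => complex.Im (f z) * \1_(box k) z)) ->
  L1_on m compact f.
Proof.
move=> mf L1 L2; split=> // A cA; have [k Ak] := compact_sub_cbox cA.
have nI (h : V -> R) : m.-integrable setT (EFin \o h) -> m.-integrable setT (EFin \o (fun r => `|h r|)).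
  by move=> fi; have := integrable_abse fi; apply: eq_integrable.
have I1 := nI _ (integrable_Lsq_mul (L1 k) (Lsq_cbox k)).
have I2 := nI _ (integrable_Lsq_mul (L2 k) (Lsq_cbox k)).
have I := integrableD measurableT I1 I2.
have I' : m.-integrable setT (EFin \o (fun z => `|complex.Re (f z) * \1_(box k) z * \1_(box k) z| +
    `|complex.Im (f z) * \1_(box k) z * \1_(box k) z|)) by move: I; apply: eq_integrable.
apply: (dominated_local (compact_measurable_prod cA) (measurable_normc mf) _ I').
  by move=> z; exact: normc_ge0'.
apply: aeW => z Az; rewrite indicE mem_set ?mulr1; last exact: Ak.
exact: normc_le_parts.
Qed.

Lemma L1_on_test_integrable f (phi : V -> R) : L1_on m compact f -> test_function phi ->
  m.-integrable setT (EFin \o (fun z => complex.Re (f z) * phi z)) /\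
  m.-integrable setT (EFin \o (fun z => complex.Im (f z) * phi z)).
Proof.
move=> Lf tphi; have [M bM _] := test_function_bounded tphi.
have mphi := continuous_measurable_prod (smooth_continuous tphi.1).
have cK : compact (closure [set z | phi z != 0]) by case: tphi.
have phi0 z : ~ closure [set z | phi z != 0] z -> phi z = 0.
  by move=> nz; apply/eqP; apply: contrapT => /negP p0; apply: nz; exact: subset_closure.
have [I1 I2] := L1_on_integrable Lf cK; have [m1 m2] := Lf.1.
by split; apply: (compact_support_Rintegral cK) => //; exists M.
Qed.

End local_integrability.

Section chosen_weak_derivative.
Variables (R : realType) (n : nat).
Local Notation V := ('rV[R]_3 * 'M[R]_(n, 3))%type.
Variable m : {measure set V -> \bar R}.
Implicit Types (f : V -> R[i]) (v : V).

Lemma weak_derivativeP v f : weakly_derivable m v f ->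
  is_weak_derivative m v f (weak_derivative m v f).
Proof. by move=> fd; exact: xgetPex. Qed.

(** If no weak derivative exists, the chosen function is the default 0. This case can occur for
    wavefunctions of weight 0. *)
Lemma cmeasurable_weak_derivative v f : cmeasurable (weak_derivative m v f).
Proof.
have [fd|fd] := pselect (weakly_derivable m v f).
  by have [_ [] //] := weak_derivativeP fd.
rewrite /weak_derivative xgetPN; last by move=> g fg; apply: fd; exists g.
by split; exact: measurable_cst.
Qed.

(** The derivatives of [f] and of its conjugate are chosen independently, so they correspond only
    almost everywhere, by uniqueness. *)
Lemma weak_derivative_conj v f : weakly_derivable m v f ->
  {ae m, forall z, weak_derivative m v (fun z => (f z)^*%C) z = (weak_derivative m v f z)^*%C}.
Proof.
move=> /weak_derivativeP; set g := weak_derivative m v f => fg.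
have cL (h : V -> R[i]) : L1_on m compact h -> L1_on m compact (fun z => (h z)^*%C).
  move=> [[m1 m2] ih]; split.
    split; first by move: m1; congr measurable_fun; apply/funext => z; case: (h z).
    rewrite (_ : (fun z => _) = (fun z => - complex.Im (h z))); first exact: measurable_funN.
    by apply/funext => z; case: (h z).
  move=> A cA; apply: le_lt_trans (ih A cA); rewrite le_eqVlt; apply/orP; left; apply/eqP.
  by apply: eq_integral => z _; case: (h z) => a b /=; rewrite sqrrN.
have fg' : is_weak_derivative m v (fun z => (f z)^*%C) (fun z => (g z)^*%C).
  have [Lf Lg r1 r2] := (is_weak_derivativeP m v f g).1 fg.
  apply/is_weak_derivativeP; split; [exact: cL|exact: cL|..].
    have E h : (fun z => complex.Re ((h z : R[i])^*%C)) = (fun z : V => complex.Re (h z)).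
      by apply/funext => z; case: (h z).
    by rewrite !E.
  have E h : (fun z => complex.Im ((h z : R[i])^*%C)) = (fun z : V => - complex.Im (h z)).
    by apply/funext => z; case: (h z).
  by rewrite !E => phi tphi; rewrite !RintegralNl (r2 phi tphi).
refine (is_weak_derivative_unique _ fg').
by apply: weak_derivativeP; exists (fun z => (g z)^*%C).
Qed.

End chosen_weak_derivative.

(** * Weak derivatives of the wavefunctions of a mixed state *)

Section mixed_states.
Context (R : realType) (n : nat) (Gamma : mixed_state R n).
Local Notation mu3 := (lebesgue_rV R 3).
Local Notation x := (lebesgue_mx R 3 n).
Local Notation X := 'M[R]_(n, 3).
Local Notation V := 'rV[R]_3.
Local Notation m := (mu3 \x x)%E.
Local Notation w := (sigma_finite_count R \xs x).
Local Notation pr := (weight Gamma).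
Local Notation Psi := (split_wavefun Gamma).
Local Notation K := (n.+1%:R : R).
Let c i := K * pr i.

Let K_gt0 : 0 < K. Proof. by []. Qed.
Let c_ge0 i : 0 <= c i. Proof. by rewrite mulr_ge0// weight_ge0. Qed.

Lemma cmeasurable_split_wavefun i : cmeasurable (Psi i).
Proof.
have [[m1 m2] _] := wavefun_L2 Gamma i; split.
  exact: (measurableT_comp m1 (@measurable_mx_cons R 3 n)).
exact: (measurableT_comp m2 (@measurable_mx_cons R 3 n)).
Qed.

(** The measure on [n.+1] rows is by construction the image of the product measure under
    [mx_cons]. *)
Lemma norm2_split_wavefun i : norm2_sq m (Psi i) = 1%E.
Proof.
rewrite -(wavefun_normalized Gamma i); apply/esym.
have mf : measurable_fun setT (fun y => (normc (wavefun Gamma i y) ^+ 2)%:E : \bar R).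
  by apply: measurable_sqE; apply: measurable_normc; case: (wavefun_L2 Gamma i).
have P := @ge0_integral_pushforward _ _ _ _ R _ (@measurable_mx_cons R 3 n) m setT _ measurableT mf.
have {}P := P (fun y _ => _ : (0 <= (normc (wavefun Gamma i y) ^+ 2)%:E)%E).
apply: (etrans (P _)) => //.
by move=> y; rewrite lee_fin sqr_ge0.
Qed.

Lemma weight_esum : (\sum_(i <oo) (pr i)%:E = 1%:E)%E.
Proof.
have H : (fun k => (series pr k)%:E) @ \oo --> (1%:E : \bar R).
  by apply: cvg_EFin; [exact: nearW|exact: weight_sum1].
rewrite -(cvg_lim _ H)//; congr (lim (_ @ \oo)).
by apply/funext => k; rewrite /series/= -sumEFin.
Qed.

Lemma Lsq_wavefun_stack :
  Lsq (w \x mu3)%E (re_stack c Psi) /\ Lsq (w \x mu3)%E (im_stack c Psi).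
Proof.
apply: (Lsq_stack K_gt0 (weight_ge0 Gamma) cmeasurable_split_wavefun).
rewrite (@eq_eseriesr _ _ (fun i => (pr i)%:E)).
  by rewrite weight_esum mule1 ltry.
by move=> i _; rewrite norm2_split_wavefun mule1.
Qed.

Section direction.
Variables (v : V) (db1 db2 : (nat * X) * V -> R).
Hypotheses (m1 : measurable_fun setT db1) (m2 : measurable_fun setT db2).
Hypotheses (L1 : forall k : nat, Lsq (w \x mu3)%E (cut db1 k%:R))
  (L2 : forall k : nat, Lsq (w \x mu3)%E (cut db2 k%:R)).
Hypothesis slice : forall i (phi : V * X -> R), test_function phi ->
  (\int[m]_z (re_stack c Psi ((i, z.2), z.1) * 'D_(v, 0) phi z) =
    - \int[m]_z (db1 ((i, z.2), z.1) * phi z)) /\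
  (\int[m]_z (im_stack c Psi ((i, z.2), z.1) * 'D_(v, 0) phi z) =
    - \int[m]_z (db2 ((i, z.2), z.1) * phi z)).

Let sl (db : (nat * X) * V -> R) i : V * X -> R := fun z => db ((i, z.2), z.1).

Let measurable_sl db i : measurable_fun setT db -> measurable_fun setT (sl db i).
Proof.
move=> mdb; apply: (measurableT_comp mdb); apply/measurable_fun_pairP; split.
  apply/measurable_fun_pairP; split; first exact: measurable_cst.
  exact: measurable_snd.
exact: measurable_fst.
Qed.

Let Lsq_sl db i (s : R) (k : nat) : measurable_fun setT db -> Lsq (w \x mu3)%E (cut db k%:R) ->
  Lsq m (fun z => (s * sl db i z) * \1_(@cbox R 1 3 n 3 k%:R) z).
Proof.
move=> mdb Ldb; have L := LsqZ s (Lsq_swap (Lsq_slice i Ldb)).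
apply: (le_Lsq _ _ L).
  apply: measurable_funM; last by apply: measurable_indic; exact: measurable_cbox.
  by apply: measurable_funM; [exact: measurable_cst|exact: measurable_sl].
move=> [r y]; rewrite -mulrA normrM [leRHS]normrM ler_wpM2l//.
rewrite /cut /sl normrM [leRHS]normrM ler_wpM2l// !indicE.
have [rin|rin] := boolP (_ \in cbox _); last by rewrite normr0.
by rewrite mem_set//; move: rin; rewrite inE => -[].
Qed.

Let sliceL1 i (s t : R) : L1_on m compact (fun z => Complex (s * sl db1 i z) (t * sl db2 i z)).
Proof.
apply: L1_on_of_Lsq.
- split; apply: measurable_funM; try exact: measurable_cst; exact: measurable_sl.
- by move=> k; exact: Lsq_sl.
- by move=> k; exact: Lsq_sl.
Qed.

Let PsiL1 i : L1_on m compact (Psi i).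
Proof.
have mP := cmeasurable_split_wavefun i.
have [P1 P2] := L2_Lsq (conj mP (eq_ind_r (fun y => (y < +oo)%E) (ltry 1) (norm2_split_wavefun i))).
by apply: L1_on_of_Lsq => // k; [apply: (le_Lsq _ _ P1)|apply: (le_Lsq _ _ P2)];
  [apply: measurable_funM; [exact: (mP).1|apply: measurable_indic; exact: measurable_cbox]|
  |apply: measurable_funM; [exact: (mP).2|apply: measurable_indic; exact: measurable_cbox]|];
  move=> z; rewrite normrM ler_piMr// indicE; case: (_ \in _); rewrite ?normr1 ?normr0.
Qed.

(** The slice is sqrt(c i) times the conjugate of [Psi i]: dividing by the positive factor and
    changing the sign of the imaginary part undoes this. *)
Lemma positive_weight_derivative i : 0 < pr i ->
  is_weak_derivative m (v, 0) (Psi i) (fun z => Complex ((Num.sqrt (c i))^-1 * sl db1 i z)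
    (- (Num.sqrt (c i))^-1 * sl db2 i z)).
Proof.
move=> pi0; have c0 : Num.sqrt (c i) != 0 by rewrite sqrtr_eq0 -ltNge mulr_gt0.
apply/is_weak_derivativeP; split; [exact: PsiL1|exact: sliceL1|..] => phi tphi.
- have tD := test_function_derive (v, 0) tphi.
  have [I _] := L1_on_test_integrable (PsiL1 i) tD.
  have [J _] := L1_on_test_integrable (sliceL1 i 1 1) tphi.
  have [S _] := slice i tphi.
  transitivity ((Num.sqrt (c i))^-1 * \int[m]_z (re_stack c Psi ((i, z.2), z.1) * 'D_(v, 0) phi z)).
    apply: (mulfI c0); rewrite mulVKf// -RintegralZl//.
    by apply: eq_Rintegral => -[r y] _; rewrite /re_stack /= mulrA.
  rewrite S mulrN; congr (- _); rewrite -RintegralZl//; last first.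
    by move: J; apply: eq_integrable => // z _; rewrite /= mul1r.
  by apply: eq_Rintegral => z _; rewrite /sl /= mulrA.
- have tD := test_function_derive (v, 0) tphi.
  have [_ I] := L1_on_test_integrable (PsiL1 i) tD.
  have [_ J] := L1_on_test_integrable (sliceL1 i 1 1) tphi.
  have [_ S] := slice i tphi.
  transitivity (- (Num.sqrt (c i))^-1 * \int[m]_z (im_stack c Psi ((i, z.2), z.1) * 'D_(v, 0) phi z)).
    rewrite mulNr -mulrN -RintegralN.
    apply: (mulfI c0); rewrite mulVKf// -RintegralZl//.
    by apply: eq_Rintegral => -[r y] _; rewrite /im_stack /= mulNr opprK mulrA.
  rewrite S mulrN; congr (- _); rewrite -RintegralZl//; last first.
    by move: J; apply: eq_integrable => // z _; rewrite /= mul1r.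
  by apply: eq_Rintegral => z _; rewrite /sl /= mulrA.
Qed.

(** The slice of the stacked kernel is identically 0, so its derivative vanishes almost everywhere
    by uniqueness. *)
Lemma zero_weight_derivative i : pr i = 0 ->
  {ae m, forall z, sl db1 i z = 0} /\ {ae m, forall z, sl db2 i z = 0}.
Proof.
move=> p0; have c0 : Num.sqrt (c i) = 0 by rewrite /c p0 mulr0 sqrtr0.
have LI := L1_on_integrable (sliceL1 i 1 1).
have I1 A : compact A -> m.-integrable A (EFin \o sl db1 i).
  move=> cA; have [I _] := LI A cA; move: I; apply: eq_integrable => //.
    exact: compact_measurable_prod.
  by move=> z _; rewrite /= mul1r.
have I2 A : compact A -> m.-integrable A (EFin \o sl db2 i).
  move=> cA; have [_ I] := LI A cA; move: I; apply: eq_integrable => //.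
    exact: compact_measurable_prod.
  by move=> z _; rewrite /= mul1r.
have I0 A : compact A -> m.-integrable A (EFin \o (fun=> 0 : R)).
  move=> cA; have := @integrable0 _ _ R m A; apply: eq_integrable => //.
  exact: compact_measurable_prod.
have Z (f : V * X -> R) : (forall z, f z = 0) -> real_weak_derivative m (v, 0) f (fun=> 0).
  move=> f0 phi tphi.
  have Z0 (g : V * X -> R) : (forall z, g z = 0) -> \int[m]_z (g z) = 0.
    move=> g0; transitivity (\int[m]_z (0 : R)); first by apply: eq_Rintegral => z _; rewrite g0.
    by rewrite Rintegral_cst//= mul0r.
  by rewrite !Z0 ?oppr0// => z; rewrite ?f0 mul0r.
split.
  apply: (@real_weak_derivative_unique _ _ m (v, 0) (fun z => re_stack c Psi ((i, z.2), z.1)) _ (fun=> 0)) => //.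
  - exact: measurable_sl.
  - by move=> phi tphi; case: (slice i tphi).
  - by apply: Z => z; rewrite /re_stack /= c0 mul0r.
apply: (@real_weak_derivative_unique _ _ m (v, 0) (fun z => im_stack c Psi ((i, z.2), z.1)) _ (fun=> 0)) => //.
- exact: measurable_sl.
- by move=> phi tphi; case: (slice i tphi).
- by apply: Z => z; rewrite /im_stack /= c0 mul0r oppr0.
Qed.

(** For positive weight this is uniqueness of weak derivatives. For weight 0 the wavefunction may
    have no weak derivative, but the factor sqrt(c i) and the slices of [db1] and [db2] vanish
    together. *)
Lemma weak_derivative_slices i : {ae m, forall z,
  Num.sqrt (c i) * complex.Re (weak_derivative m (v, 0) (Psi i) z) = db1 ((i, z.2), z.1) /\
  - (Num.sqrt (c i) * complex.Im (weak_derivative m (v, 0) (Psi i) z)) = db2 ((i, z.2), z.1)}.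
Proof.
have := weight_ge0 Gamma i; rewrite le_eqVlt => /orP[/eqP p0|pi0].
  have [z1 z2] := zero_weight_derivative (esym p0).
  apply: filterS2 z1 z2 => z z1 z2; rewrite /sl in z1 z2.
  by rewrite z1 z2 /c -p0 mulr0 sqrtr0 !mul0r oppr0.
have c0 : Num.sqrt (c i) != 0 by rewrite sqrtr_eq0 -ltNge mulr_gt0.
have D := positive_weight_derivative pi0.
have E : weakly_derivable m (v, 0) (Psi i) by eexists; exact: D.
apply: filterS (is_weak_derivative_unique (weak_derivativeP E) D) => z ->.
by rewrite /sl /= mulVKf// mulNr mulrN opprK mulVKf.
Qed.

End direction.

End mixed_states.

Section finite_sums.
Context d (T : measurableType d) (R : realType) (t : {measure set T -> \bar R}).

Lemma integrable_Rsum (I : Type) (s : seq I) (f : I -> T -> R) :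
  (forall j, t.-integrable setT (EFin \o f j)) ->
  t.-integrable setT (EFin \o (fun z => \sum_(j <- s) f j z)).
Proof.
move=> fi; elim: s => [|j s ih].
  have := @integrable0 _ _ R t setT; apply: eq_integrable => // z _.
  by rewrite /= big_nil.
have := integrableD measurableT (fi j) ih; apply: eq_integrable => // z _.
by rewrite /= big_cons.
Qed.

Lemma Rintegral_sum (I : Type) (s : seq I) (f : I -> T -> R) :
  (forall j, t.-integrable setT (EFin \o f j)) ->
  \int[t]_z (\sum_(j <- s) f j z) = \sum_(j <- s) \int[t]_z f j z.
Proof.
move=> fi; elim: s => [|j s ih].
  rewrite big_nil; transitivity (\int[t]_z (0 : R)); last by rewrite Rintegral_cst//= mul0r.
  by apply: eq_Rintegral => z _; rewrite big_nil.
rewrite big_cons -ih -RintegralD//; last exact: integrable_Rsum.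
by apply: eq_Rintegral => z _; rewrite big_cons.
Qed.

Lemma cintegral_sum_conj_mul (I : Type) (s : seq I) (f : I -> T -> R[i]) :
  (forall j, Lsqc t (f j)) ->
  cintegral t (fun z => \sum_(j <- s) (f j z)^*%C * f j z) =
  (\sum_(j <- s) (\int[t]_z (complex.Re (f j z) * complex.Re (f j z)) +
    \int[t]_z (complex.Im (f j z) * complex.Im (f j z))))%:C%C.
Proof.
move=> Lf; rewrite /cintegral; congr Complex.
  have I1 j := integrable_Lsq_mul (Lf j).1 (Lf j).1.
  have I2 j := integrable_Lsq_mul (Lf j).2 (Lf j).2.
  have I3 j : t.-integrable setT (EFin \o (fun z => complex.Re (f j z) * complex.Re (f j z) +
      complex.Im (f j z) * complex.Im (f j z))).
    by have := integrableD measurableT (I1 j) (I2 j); apply: eq_integrable.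
  transitivity (\int[t]_z (\sum_(j <- s) (complex.Re (f j z) * complex.Re (f j z) +
      complex.Im (f j z) * complex.Im (f j z)))).
    apply: eq_Rintegral => z _; rewrite Re_sum; apply: eq_bigr => j _.
    by case: (f j z) => a b /=; ring.
  rewrite (Rintegral_sum s I3); apply: eq_bigr => j _.
  exact: (RintegralD measurableT (I1 j) (I2 j)).
transitivity (\int[t]_z (0 : R)); last by rewrite Rintegral_cst//= mul0r.
apply: eq_Rintegral => z _; rewrite Im_sum big1// => j _.
by case: (f j z) => a b /=; ring.
Qed.

End finite_sums.

Lemma Lsq_cut_strip d (Z : measurableType d) (R : realType) (N : nat)
    (m : {sigma_finite_measure set Z -> \bar R}) (f : Z * 'rV[R]_N -> R[i]) (M : R) :
  cmeasurable f ->
  (\int[(m \x lebesgue_rV R N)%E]_(p in setT `*` cball M) (normc (f p) ^+ 2)%:E < +oo)%E ->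
  Lsq (m \x lebesgue_rV R N)%E (cut (fun z => complex.Re (f z)) M) /\
  Lsq (m \x lebesgue_rV R N)%E (cut (fun z => complex.Im (f z)) M).
Proof.
move=> [m1 m2] fi.
have mA : measurable (setT `*` @cball R N M : set (Z * 'rV[R]_N)).
  by apply: measurableX => //; exact: measurable_cball.
have mn : measurable_fun setT (fun z => (normc (f z) ^+ 2)%:E : \bar R).
  by apply: measurable_sqE; exact: measurable_normc.
have key (part : Z * 'rV[R]_N -> R) : measurable_fun setT part ->
    (forall z, `|part z| <= normc (f z)) -> Lsq (m \x lebesgue_rV R N)%E (cut part M).
  move=> mp ple; split; first exact: measurable_cut.
  apply: le_lt_trans fi; rewrite integral_mkcond; apply: ge0_le_integral => //.
  - by move=> z _; rewrite lee_fin sqr_ge0.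
  - by apply: measurable_sqE; exact: measurable_cut.
  - by apply/(measurable_restrictT _ mA); exact: measurable_funTS.
  - move=> z _; rewrite patchE /cut indicE.
    case: (boolP (z.2 \in cball M)) => zM.
      rewrite mem_set; last by split => //; rewrite inE in zM.
      by rewrite mulr1 lee_fin -real_normK ?num_real// ler_pXn2r ?nnegrE ?normc_ge0'.
    by rewrite memNset ?mulr0 ?expr0n//= => -[_ /mem_set]; exact/negP.
by split; apply: key => // z; [exact: ler_Re_normc|exact: ler_Im_normc].
Qed.

Section complex_measurability.
Context d (T : measurableType d) (R : realType).
Implicit Types f g : T -> R[i].

Lemma cmeasurableM f g : cmeasurable f -> cmeasurable g -> cmeasurable (fun z => f z * g z).
Proof.
move=> [f1 f2] [g1 g2]; split.
  rewrite (_ : (fun z => _) = (fun z => complex.Re (f z) * complex.Re (g z) -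
      complex.Im (f z) * complex.Im (g z))).
    by apply: measurable_funB; exact: measurable_funM.
  by apply/funext => z; case: (f z) => a b; case: (g z) => a' b'.
rewrite (_ : (fun z => _) = (fun z => complex.Re (f z) * complex.Im (g z) +
    complex.Im (f z) * complex.Re (g z))).
  by apply: measurable_funD; exact: measurable_funM.
by apply/funext => z; case: (f z) => a b; case: (g z) => a' b'.
Qed.

Lemma cmeasurable_conj f : cmeasurable f -> cmeasurable (fun z => (f z)^*%C).
Proof.
move=> [f1 f2]; split.
  by rewrite (_ : (fun z => _) = (fun z => complex.Re (f z)))//; apply/funext => z; case: (f z).
rewrite (_ : (fun z => _) = (fun z => - complex.Im (f z))); first exact: measurable_funN.
by apply/funext => z; case: (f z).
Qed.

Lemma cmeasurable_cst (k : R[i]) : cmeasurable (fun _ : T => k).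
Proof. by split; exact: measurable_cst. Qed.

Lemma cmeasurable_sum (I : Type) (s : seq I) (f : I -> T -> R[i]) :
  (forall j, cmeasurable (f j)) -> cmeasurable (fun z => \sum_(j <- s) f j z).
Proof.
move=> mf; split.
  under eq_fun do rewrite Re_sum; apply: measurable_sum => j; by case: (mf j).
under eq_fun do rewrite Im_sum; apply: measurable_sum => j; by case: (mf j).
Qed.

End complex_measurability.

Lemma cmeasurable_section2 d1 d2 (T1 : measurableType d1) (T2 : measurableType d2)
    (R : realType) (f : T1 * T2 -> R[i]) y :
  cmeasurable f -> cmeasurable (fun z => f (z, y)).
Proof.
by move=> [m1 m2]; split; [exact: (measurable_section2 y m1)|exact: (measurable_section2 y m2)].
Qed.

Theorem mainTheorem5 (R : realType) (n : nat)
    (D G : 'rV[R]_3 * 'rV[R]_3 -> R[i])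
    (G_L2 : L2 (lebesgue_rV R 3 \x lebesgue_rV R 3)%E G)
    (DE : {ae (lebesgue_rV R 3 \x lebesgue_rV R 3)%E,
      forall q, D q = kernel_comp (kernel_adj G) G q})
    (D_1rdm : is_1rdm n.+1 D)
    (G_diff : weakly_differentiable2 G)
    (gradG_L2 : forall j,
      L2_on (lebesgue_rV R 3 \x lebesgue_rV R 3)%E (@strips R) (grad2 G j))
    (Gamma : mixed_state R n)
    (Gamma_D : {ae (lebesgue_rV R 3 \x lebesgue_rV R 3)%E,
      forall q, rdm Gamma q = D q}) :
  [/\ (* the quantities are well defined *)
      (forall i, 0 < weight Gamma i ->
        weakly_differentiable1 (split_wavefun Gamma i)) /\
      {ae lebesgue_rV R 3, forall r, forall j,
        momentum_density_abs_cvg Gamma j r},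
      (lebesgue_rV R 3).-integrable setT (density Gamma),
      forall j, L1_on (lebesgue_rV R 3) compact (momentum_density Gamma j),
      forall K, compact K ->
        (lebesgue_rV R 3).-integrable K (kinetic_energy_density Gamma)
    & {ae lebesgue_rV R 3, forall r,
        [/\ density Gamma r \is a fin_num,
            (fine (density Gamma r))%:C%C =
              cintegral (lebesgue_rV R 3) (fun u => (G (u, r))^*%C * G (u, r)),
            forall j, momentum_density Gamma j r =
              cintegral (lebesgue_rV R 3) (fun u =>
                (- 'i%C * grad2 (fun q => (G q)^*%C) j (u, r)) * G (u, r)),
            kinetic_energy_density Gamma r \is a fin_num
          & (fine (kinetic_energy_density Gamma r))%:C%C =
              2^-1 * cintegral (lebesgue_rV R 3) (fun u =>
                \sum_(j < 3) grad2 (fun q => (G q)^*%C) j (u, r) *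
                             grad2 G j (u, r))]}].
Proof.
pose mu := lebesgue_rV R 3; pose x := lebesgue_mx R 3 n.
pose K : R := n.+1%:R; pose pr := weight Gamma; pose c i := K * pr i.
pose Psi := split_wavefun Gamma; pose w := sigma_finite_count R \xs x.
have K0 : 0 < K by [].
have p0 := weight_ge0 Gamma.
have mP := cmeasurable_split_wavefun Gamma.
have [LP1 LP2] := Lsq_wavefun_stack Gamma.
have LG : Lsqc (mu \x mu)%E G := L2_Lsq G_L2.
have KE : (n.+1%:R : R[i]) = K%:C%C by rewrite -(rmorph_nat (real_complex R)).
have rdmE : {ae (mu \xs mu), forall z,
    K%:C%C * cseries (fun i => (pr i)%:C%C * cintegral x (fun y =>
      Psi i (z.1, y) * (Psi i (z.2, y))^*%C)) =
    cintegral mu (fun u => (G (u, z.1))^*%C * G (u, z.2))}.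
  by apply: filterS2 DE Gamma_D => q dq gq; rewrite -KE; exact: (etrans gq dq).
pose dG j := grad2 G j.
have isw j := weak_derivativeP (G_diff j).
have mdG j : cmeasurable (dG j) by exact: cmeasurable_weak_derivative.
have LdG j (M : R) : Lsq (mu \x mu)%E (cut (fun z => complex.Re (dG j z)) M) /\
    Lsq (mu \x mu)%E (cut (fun z => complex.Im (dG j z)) M).
  apply: Lsq_cut_strip; first exact: mdG.
  have [_ H] := gradG_L2 j; apply: H; exists (cball M) => //.
  exact: compact_cball_mx.
have wd j := (is_weak_derivativeP _ _ _ _).1 (isw j).
have wd1 j : forall phi : 'rV[R]_3 * 'rV[R]_3 -> R, test_function phi ->
    \int[(mu \x mu)%E]_z (complex.Re (G z) * 'D_(0, delta_mx 0 j) phi z) =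
    - \int[(mu \x mu)%E]_z (complex.Re (dG j z) * phi z) by case: (wd j).
have wd2 j : forall phi : 'rV[R]_3 * 'rV[R]_3 -> R, test_function phi ->
    \int[(mu \x mu)%E]_z (complex.Im (G z) * 'D_(0, delta_mx 0 j) phi z) =
    - \int[(mu \x mu)%E]_z (complex.Im (dG j z) * phi z) by case: (wd j).
pose dP (j : 'I_3) i := grad1 (Psi i) j.
have mdP j i : cmeasurable (dP j i) by exact: cmeasurable_weak_derivative.
pose S j r := (sqint w (fun z => re_stack c (dP j) (z, r))%R +
  sqint w (fun z => im_stack c (dP j) (z, r))%R)%E.
have H j : [/\ forall i, 0 < pr i -> weakly_derivable (mu \x x)%E (delta_mx 0 j, 0) (Psi i),
    {ae mu, forall r, Lsq_at x K pr (dP j) r},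
    forall k : nat, (\int[mu]_(r in cball k%:R) S j r < +oo)%E,
    {ae mu, forall r, momentum_density Gamma j r =
      cintegral mu (fun u => (- 'i%C * (dG j (u, r))^*%C) * G (u, r))} &
    {ae mu, forall r, S j r = (\int[mu]_u (complex.Re (dG j (u, r)) * complex.Re (dG j (u, r))) +
      \int[mu]_u (complex.Im (dG j (u, r)) * complex.Im (dG j (u, r))))%:E}].
  have [db1 [db2 [[m1 m2 L1 L2] sl E]]] := ensemble_derivative K0 p0 LG mP LP1 LP2 rdmE
    (mdG j) (fun M => (LdG j M).1) (fun M => (LdG j M).2) (wd1 j) (wd2 j) (@lebesgue_mx_cball R 3 n).
  (* The limit kernels are identified with the chosen weak derivatives of the wavefunctions. *)
  have [h1 h2 h3 h4] := E (dP j) (mdP j) (weak_derivative_slices m1 m2 L1 L2 sl).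
  split => //.
    by move=> i pi0; eexists; exact: (positive_weight_derivative m1 m2 L1 L2 sl pi0).
  by apply: filterS h3 => r <-; rewrite /momentum_density KE.
have mS j : measurable_fun setT (S j).
  apply: emeasurable_funD.
    exact: (measurable_sqint2 w (measurable_re_stack c (mdP j))).
  exact: (measurable_sqint2 w (measurable_im_stack c (mdP j))).
have S0 j r : (0 <= S j r)%E by rewrite adde_ge0// sqint_ge0.
have kinE r : kinetic_energy_density Gamma r = ((2^-1)%:E * \sum_(j < 3) S j r)%E.
  exact: (scaled_kinetic_stack x K0 p0 r mdP).
have SA A j : compact A -> mu.-integrable A (S j).
  move=> cA; have [k Ak] := compact_sub_cball cA.
  have mA := compact_measurable_mx cA.
  apply/integrableP; split; first exact: (measurable_funTS (mS j)).
  have [_ _ h _ _] := H j; apply: le_lt_trans (h k).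
  rewrite (eq_integral (S j)); last by move=> r _; rewrite gee0_abs.
  apply: ge0_subset_integral => //; first exact: measurable_cball.
  exact: (measurable_funTS (mS j)).
(* The formulas contain the gradient of the conjugate of [G], the argument the conjugate of its
   gradient; for almost every [r] they agree for almost every [u]. *)
have conjG j : {ae mu, forall r, {ae mu, forall u,
    grad2 (fun q => (G q)^*%C) j (u, r) = (dG j (u, r))^*%C}}.
  exact: (ae_prod2 (weak_derivative_conj (G_diff j))).
have mcG j : cmeasurable (grad2 (fun q => (G q)^*%C) j) by exact: cmeasurable_weak_derivative.
have mG : cmeasurable G by case: G_L2.
split.
- split; first by move=> i pi0 j; case: (H j) => h _ _ _ _; exact: h.
  apply: filter_forall => j; have [_ h _ _ _] := H j.
  apply: filterS2 h (ae_Lsq_Psi LP1 LP2) => r; exact: stack_mul_summable.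
- exact: (ensemble_density_integrable K0 p0 mP LP1 LP2).
- move=> j; have mM : cmeasurable (momentum_density Gamma j).
    have := cmeasurable_mom x K pr mP (mdP j); congr cmeasurable.
    by apply/funext => r; rewrite /momentum_density KE.
  split=> // A cA; have [k Ak] := compact_sub_cball cA.
  have [h ih hb] := momG_local LG (mdG j) (fun M => (LdG j M).1) (fun M => (LdG j M).2) k.
  apply: (dominated_local (compact_measurable_mx cA) (measurable_normc mM) _ ih).
    by move=> r; exact: normc_ge0'.
  have [_ _ _ hM _] := H j; apply: filterS2 hM hb => r -> hr /Ak; exact: hr.
- move=> A cA; rewrite (_ : kinetic_energy_density Gamma = (fun r => (2^-1)%:E * \sum_(j < 3) S j r)%E).
    apply: integrableZl => //; first exact: compact_measurable_mx.
    by apply: integrable_sum => [|j *]; [exact: compact_measurable_mx|exact: SA].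
  by apply/funext => r; exact: kinE.
(* There are three directions only, so their exceptional null sets are merged into one. *)
have HS : {ae mu, forall r, forall j, S j r = (\int[mu]_u (complex.Re (dG j (u, r)) * complex.Re (dG j (u, r))) +
      \int[mu]_u (complex.Im (dG j (u, r)) * complex.Im (dG j (u, r))))%:E}.
  by apply: filter_forall => j; case: (H j).
have HM : {ae mu, forall r, forall j, momentum_density Gamma j r =
      cintegral mu (fun u => (- 'i%C * (dG j (u, r))^*%C) * G (u, r))}.
  by apply: filter_forall => j; case: (H j).
have HC : {ae mu, forall r, forall j, {ae mu, forall u,
    grad2 (fun q => (G q)^*%C) j (u, r) = (dG j (u, r))^*%C}} by exact: filter_forall.
have HL : {ae mu, forall r, forall j, Lsqc mu (fun u => dG j (u, r))}.
  apply: filter_forall => j.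
  exact: (ae_Lsq_dG (mdG j) (fun M => (LdG j M).1) (fun M => (LdG j M).2)).
have HD := ensemble_density K0 p0 LG mP LP1 LP2 rdmE.
apply: filterS3 (filterI HS HM) (filterI HC HL) HD => r [hS hM] [hC hL] [d1 d2].
pose T j := \int[mu]_u (complex.Re (dG j (u, r)) * complex.Re (dG j (u, r))) +
      \int[mu]_u (complex.Im (dG j (u, r)) * complex.Im (dG j (u, r))).
have kr : kinetic_energy_density Gamma r = (2^-1 * \sum_(j < 3) T j)%:E.
  by rewrite kinE EFinM -sumEFin; congr (_ * _)%E; apply: eq_bigr => j _; exact: hS.
split => //.
- move=> j; rewrite hM; apply: ae_eq_cintegral.
  + apply: cmeasurableM; last exact: cmeasurable_section2.
    by apply: cmeasurableM; [exact: cmeasurable_cst|exact: cmeasurable_conj (cmeasurable_section2 r (mdG j))].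
  + apply: cmeasurableM; last exact: cmeasurable_section2.
    by apply: cmeasurableM; [exact: cmeasurable_cst|exact: cmeasurable_section2 r (mcG j)].
  + by apply: filterS (hC j) => u ->.
- by rewrite kr.
- rewrite kr [fine _]/=.
  have -> : cintegral mu (fun u => \sum_(j < 3) grad2 (fun q => (G q)^*%C) j (u, r) * grad2 G j (u, r)) =
      cintegral mu (fun u => \sum_(j < 3) (dG j (u, r))^*%C * dG j (u, r)).
    apply: ae_eq_cintegral.
    + apply: cmeasurable_sum => j; apply: cmeasurableM; exact: cmeasurable_section2.
    + apply: cmeasurable_sum => j; apply: cmeasurableM.
        exact: cmeasurable_conj (cmeasurable_section2 r (mdG j)).
      exact: cmeasurable_section2 r (mdG j).
    + have hC' : {ae mu, forall u, forall j, grad2 (fun q => (G q)^*%C) j (u, r) = (dG j (u, r))^*%C}.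
        exact: filter_forall.
      by apply: filterS hC' => u hu; apply: eq_bigr => j _; rewrite hu.
  rewrite (cintegral_sum_conj_mul _ hL) rmorphM fmorphV rmorph_nat.
  by [].
Qed.
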